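(* Let $\Omega\subset\mathbb{C}$ be a simply connected domain with non-empty boundary, let $\varphi:\Omega\to\mathbb{D}$ be a conformal homeomorphism of $\Omega$ onto the unit disc $\mathbb{D}$, and let $h(z)=J(z,\varphi)=|\varphi'(z)|^2$. Then for every $1\le r<\infty$ the embedding operator $$j_r:\overset{\circ}{W_2^1}(\Omega)\hookrightarrow L_r(\Omega,h),\qquad j_r(f)=f,$$ is compact.
   Context: $\mu$ is Lebesgue measure on $\mathbb{C}\cong\mathbb{R}^2$; $\mathbb{D}$ is the open unit disc. Functions are real-valued. $J(z,\varphi)$ is the Jacobian of $\varphi$ at $z$; $h$ is called the universal conformal weight on $\Omega$. $L_r(\Omega,h)$ is the weighted Lebesgue space with norm $\|f\mid L_r(\Omega,h)\|=\bigl(\int_\Omega|f(z)|^r h(z)\,d\mu\bigr)^{1/r}$. For $1\le p<\infty$, $W_p^1(\Omega)$ is the space of locally integrable weakly differentiable functions $f:\Omega\to\mathbb{R}$ with finite norm $\|f\mid W_p^1(\Omega)\|=\bigl(\int_\Omega|f|^p\,d\mu\bigr)^{1/p}+\bigl(\int_\Omega|\nabla f|^p\,d\mu\bigr)^{1/p}$, and $\overset{\circ}{W_p^1}(\Omega)$ is the closure of $C_0^\infty(\Omega)$ in $W_p^1(\Omega)$. *)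

(* Defs.v *)
From HB Require Import structures.
From mathcomp Require Import all_boot all_order all_algebra.
From mathcomp Require Import all_classical all_reals all_analysis.
From mathcomp Require Import complex.

Set Implicit Arguments.
Unset Strict Implicit.
Unset Printing Implicit Defensive.

Import Order.TTheory GRing.Theory Num.Theory.
Import numFieldNormedType.Exports.

Local Open Scope classical_set_scope.
Local Open Scope ring_scope.
Local Open Scope complex_scope.

(* R[i] as a numClosedFieldType, so as to inherit the norm and the topology of
   a numFieldType. For f : Cplx R -> Cplx R, [derivable f z 1] is complex
   differentiability of f at z and [derive1 f z] is the complex derivative. *)
Definition Cplx (R : realType) : numClosedFieldType := R[i].

Section complex_plane.
Variable R : realType.
Implicit Types (A B : set (Cplx R)) (phi : Cplx R -> Cplx R).

Definition domain A := [/\ open A, connected A & A !=set0].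

Definition boundary A := closure A `\` interior A.

Definition path_connected A := forall x y, A x -> A y ->
  exists gamma : R -> Cplx R,
    [/\ {within `[0, 1], continuous gamma}, gamma 0 = x, gamma 1 = y &
        forall t, t \in `[0, 1] -> A (gamma t)].

(* Every loop in A is homotopic to a constant in A, with fixed base point. *)
Definition loops_contractible A := forall gamma : R -> Cplx R,
  {within `[0, 1], continuous gamma} -> gamma 0 = gamma 1 ->
  (forall t, t \in `[0, 1] -> A (gamma t)) ->
  exists H : R * R -> Cplx R,
    [/\ {within `[0, 1] `*` `[0, 1], continuous H},
        forall s t, s \in `[0, 1] -> t \in `[0, 1] -> A (H (s, t)),
        forall t, t \in `[0, 1] -> H (0, t) = gamma t,
        forall t, t \in `[0, 1] -> H (1, t) = gamma 0 &
        forall s, s \in `[0, 1] -> H (s, 0) = gamma 0 /\ H (s, 1) = gamma 0].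

Definition simply_connected A := path_connected A /\ loops_contractible A.

Definition unit_disc : set (Cplx R) := [set z | `|z| < 1].

Definition homeomorphism_onto A B phi :=
  set_bij A B phi /\
  exists psi : Cplx R -> Cplx R,
    [/\ {in A, cancel phi psi}, {within A, continuous phi} &
        {within B, continuous psi}].

Definition conformal_on A phi :=
  forall z, A z -> derivable phi z 1 /\ derive1 phi z != 0.

Definition conformal_homeomorphism A B phi :=
  homeomorphism_onto A B phi /\ conformal_on A phi.

(* J(z, phi) = |phi'(z)|^2, as a real number. *)
Definition conformal_weight phi (z : Cplx R) : R :=
  Normc.normc (derive1 phi z) ^+ 2.

End complex_plane.

Section plane.
Variable R : realType.

Definition to_complex (z : R * R) : Cplx R := z.1 +i* z.2.

Definition plane : measurableType _ :=
  (measurableTypeR R * measurableTypeR R)%type.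

Definition lebesgue2 : {measure set plane -> \bar R} :=
  (@lebesgue_measure R \x @lebesgue_measure R)%E.

End plane.

Section sobolev.
Variable R : realType.
Local Notation mu := (@lebesgue2 R).
Implicit Types (U : set (R * R)) (f g : R * R -> R) (v : R * R -> R * R).

(* Partial derivative in the first (false) or second (true) coordinate. *)
Definition partial (i : bool) f (z : R * R) : R :=
  'D_(if i then (0, 1) else (1, 0) : R * R) f z.

Definition smooth f :=
  forall (s : seq bool) (z : R * R), differentiable (foldr partial f s) z.

(* C_0^oo(U), each function being extended by 0 to the whole plane. *)
Definition test_function U f :=
  [/\ smooth f, compact (closure [set z | f z != 0]) &
      closure [set z | f z != 0] `<=` U].

Definition locally_integrable U f := forall K : set (R * R),
  compact K -> K `<=` U -> mu.-integrable K (EFin \o f).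

Definition is_weak_partial U (i : bool) f g :=
  forall psi, test_function U psi ->
  (\int[mu]_(z in U) (f z * partial i psi z)%:E =
   - \int[mu]_(z in U) (g z * psi z)%:E)%E.

Definition is_weak_gradient U f v :=
  [/\ locally_integrable U (fst \o v), locally_integrable U (snd \o v),
      is_weak_partial U false f (fst \o v) &
      is_weak_partial U true f (snd \o v)].

Definition weakly_differentiable U f := exists v, is_weak_gradient U f v.

(* A representative of the weak gradient, which is unique up to a.e. equality
   on U when it exists. *)
Definition weak_gradient U f : R * R -> R * R :=
  xget (fun=> (0, 0)) [set v | is_weak_gradient U f v].

Definition euclidean_norm (w : R * R) : R := Num.sqrt (w.1 ^+ 2 + w.2 ^+ 2).

Definition weighted_norm U (r : R) (h : R * R -> R) f : \bar R :=
  ((\int[mu]_(z in U) (`|f z| `^ r * h z)%:E) `^ r^-1)%E.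

Definition weighted_Lebesgue U r h : set (R * R -> R) :=
  [set f | measurable_fun (U : set (plane R)) f /\
           (weighted_norm U r h f < +oo)%E].

Definition lebesgue_norm U (p : R) f : \bar R :=
  ((\int[mu]_(z in U) (`|f z| `^ p)%:E) `^ p^-1)%E.

Definition sobolev_norm U (p : R) f : \bar R :=
  (lebesgue_norm U p f +
   lebesgue_norm U p (euclidean_norm \o weak_gradient U f))%E.

Definition sobolev U p : set (R * R -> R) :=
  [set f | [/\ locally_integrable U f, weakly_differentiable U f &
               (sobolev_norm U p f < +oo)%E]].

Definition sobolev0 U p : set (R * R -> R) :=
  [set f | sobolev U p f /\
           forall e : R, 0 < e -> exists2 psi, test_function U psi &
             (sobolev_norm U p (f \- psi)%R < e%:E)%E].

End sobolev.

(* Seminormed spaces are given by a carrier and a seminorm on representatives;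
   functions at distance 0 stand for the same element. *)
Definition compact_operator (R : realType) (E F : lmodType R)
    (X : set E) (normX : E -> \bar R) (Y : set F) (normY : F -> \bar R)
    (T : E -> F) :=
  [/\ forall f, X f -> Y (T f),
      forall a f g, X f -> X g -> T (a *: f + g) = a *: T f + T g &
      forall u : nat -> E, (forall n, X (u n)) ->
        (exists M : R, forall n, (normX (u n) <= M%:E)%E) ->
        exists s : nat -> nat, {homo s : m n / (m < n)%N} /\
          exists2 g, Y g &
            normY (T (u (s k)) - g) @[k --> \oo] --> 0%E].

(* Main.v *)
Require Import Defs.
From mathcomp Require Import all_boot all_order all_algebra.
From mathcomp Require Import all_classical all_reals all_analysis.
From mathcomp Require Import complex.
From mathcomp Require Import measurable_realfun separation_axioms.
From mathcomp Require Import ring lra.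

(** Why the embedding is compact. Let T be the map phi read in the real plane,
    from the open set U to the disc, and S its inverse. Changing variables,
    the integral of |f|^r h over U is that of |f o S|^r over the disc, and the
    Dirichlet integral of f is that of f o S, by conformal invariance. For a
    test function f on U the function f o S, extended by 0, is supported in a
    fixed square. The theorem is thus Rellich's theorem for functions
    supported in a square, together with the fact that a bound on their
    energy bounds all their moments. Only inequalities up to constants are
    used, which allows each of these classical tools to be replaced by a
    version requiring very little regularity.

    Change of variables. The derivative of phi is known to exist at each
    point, and phi is Lipschitz near z with a constant close to |phi'(z)|;
    the inverse map has the analogous property. This pointwise information is
    integrated by bisection: if a measure m satisfies m(Q) <= kappa(z) |Q| for
    the small squares Q around each z, then m is at most the integral of kappa
    up to a factor [measure_domination]. Bisection requires a local comparison
    with something additive and semicontinuous, for which the level sets of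
    kappa are enclosed in open sets [semicontinuous_majorant]. Applied to the
    image of the area under a map, this gives the inequality
    [lipschitz_change_of_variables]; applied on the line, it bounds the
    increments of a function by the integral of its pointwise Lipschitz
    constant [oscillation_le_integral]. Accordingly functions on the square
    are handled through upper gradients [slope_bound], for which the chain
    rule holds under mere pointwise Lipschitz assumptions, and f o S is never
    differentiated.

    The square. Bounding a function by the integrals of its upper gradient
    along horizontal and vertical lines gives the Gagliardo-Nirenberg
    inequality [gagliardo_nirenberg]; its application to powers bounds all the
    moments [moment_le]. Poincare's inequality on the squares of a fine
    subdivision reduces compactness in L2 to the convergence of finitely many
    means along an ultrafilter [rellich]. Interpolation with the moments then
    improves L2 to every finite exponent [energy_lp_small].

    The closure. Members of the Sobolev space are limits of test functions,
    and the Dirichlet integral of a test function is at most the square norm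
    of any of its weak gradients [dirichlet_le]. So the estimates for test
    functions can be applied to differences of approximants, and Fatou's lemma
    carries them over to the limits [weighted_remainder]. Given a bounded
    sequence u_n, test functions psi_n with gradients closer and closer to
    those of u_n are Cauchy along an ultrafilter in the weighted norms of
    exponents 1 and r; a subsequence converges [test_limit], and u_n - psi_n
    tends to 0 in the weighted norm. *)

Set Implicit Arguments.
Unset Strict Implicit.
Unset Printing Implicit Defensive.

Import Order.TTheory GRing.Theory Num.Theory.
Import numFieldNormedType.Exports.

Local Open Scope classical_set_scope.
Local Open Scope ring_scope.

(** * Topology and Borel sets of the plane *)

Section plane_topology.
Variable R : realType.
Implicit Types (A : set (R * R)) (z w : R * R).

Lemma plane_nbhsP (x : R * R) (A : set (R * R)) :
  nbhs x A <-> exists2 e : R, 0 < e & forall y, `|y - x| < e -> A y.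
Proof.
split.
  move/nbhs_ballP => [e /= e0 sub]; exists e => // y yx; apply: sub.
  by rewrite -ball_normE /= distrC.
move=> [e e0 sub]; apply/nbhs_ballP; exists e => //= y.
by rewrite -ball_normE /= distrC; exact: sub.
Qed.

Lemma plane_norm_lt (z : R * R) (e : R) :
  (`|z| < e) = (`|z.1| < e) && (`|z.2| < e).
Proof. by rewrite prod_normE gt_max. Qed.

Lemma plane_norm_le (z : R * R) (e : R) :
  (`|z| <= e) = (`|z.1| <= e) && (`|z.2| <= e).
Proof. by rewrite prod_normE ge_max. Qed.

Lemma open_plane_setX (A B : set R) :
  open A -> open B -> open (A `*` B : set (R * R)).
Proof.
move=> oA oB; have -> : A `*` B = (fst @^-1` A) `&` (snd @^-1` B) by [].
apply: openI; apply: open_comp => // z _; [exact: cvg_fst|exact: cvg_snd].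
Qed.

Lemma measurable_itvX (i j : interval R) :
  measurable (([set` i] `*` [set` j]) : set (plane R)).
Proof. by apply: measurableX; exact: measurable_itv. Qed.

Lemma open_measurable_plane A : open A -> measurable (A : set (plane R)).
Proof.
move=> oA.
pose B (p : rat * rat * (rat * rat)) : set (plane R) :=
  `]ratr p.1.1, ratr p.1.2[ `*` `]ratr p.2.1, ratr p.2.2[.
have -> : A = \bigcup_p (if `[< B p `<=` A >] then B p else set0).
  apply/seteqP; split => [z Az|z [p _]]; last first.
    by case: asboolP => // BA; exact: BA.
  have /plane_nbhsP [e e0 eA] : nbhs z A by apply: open_nbhs_nbhs; split.
  have [q1 /[!in_itv] /= /andP[a1 b1]] := @rat_in_itvoo R _ _ (ltr_pwDr e0 (lexx (z.1 - e))).
  have [q2 /[!in_itv] /= /andP[a2 b2]] := @rat_in_itvoo R _ _ (ltr_pwDr e0 (lexx z.1)).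
  have [q3 /[!in_itv] /= /andP[a3 b3]] := @rat_in_itvoo R _ _ (ltr_pwDr e0 (lexx (z.2 - e))).
  have [q4 /[!in_itv] /= /andP[a4 b4]] := @rat_in_itvoo R _ _ (ltr_pwDr e0 (lexx z.2)).
  exists (q1, q2, (q3, q4)) => //.
  case: asboolP; last first.
    case=> y [] /=; rewrite !in_itv /= => /andP[? ?] /andP[? ?].
    apply: eA; rewrite plane_norm_lt /= !ltr_norml; apply/andP; split; apply/andP; split; lra.
  by move=> _; split; rewrite /= in_itv /=; apply/andP; split; lra.
apply: countable_bigcupT_measurable => [|p]; first exact: countableP.
case: asboolP => // _; exact: measurable_itvX.
Qed.

Lemma closed_measurable_plane A : closed A -> measurable (A : set (plane R)).
Proof.
move=> cA; rewrite -(setCK A); apply: measurableC.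
by apply: open_measurable_plane; exact: closed_openC.
Qed.

Definition inner (O : set (R * R)) (n : nat) : set (R * R) :=
  [set x | forall y, `|y - x| < n.+1%:R^-1 -> O y].

Lemma closed_inner A n : closed (inner A n).
Proof.
rewrite -(setCK (inner A n)); apply: open_closedC.
rewrite openE => x /= /existsNP[y /not_implyP[yx nAy]].
apply/plane_nbhsP; exists (n.+1%:R^-1 - `|y - x|); first by rewrite subr_gt0.
move=> z zx /(_ y) H; apply: nAy; apply: H.
rewrite (_ : y - z = (y - x) - (z - x)); last by rewrite opprB addrA subrK.
by rewrite (le_lt_trans (ler_normB _ _))// -ltrBrDl.
Qed.

Lemma inner_sub A n : inner A n `<=` A.
Proof. by move=> x; apply; rewrite subrr normr0 invr_gt0. Qed.

Lemma inner_mono A m n : (m <= n)%N -> inner A m `<=` inner A n.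
Proof.
move=> mn x Ax y yx; apply: Ax; apply: lt_le_trans yx _.
by rewrite lef_pV2 ?posrE ?ltr0n// ler_nat.
Qed.

(** An exhaustion of an open set by closed ones, on which both the regularity
    of measures and the measurability of locally integrable functions rest. *)
Lemma open_inner A x : open A -> A x -> exists n, inner A n x.
Proof.
move=> oA Ax; have /plane_nbhsP[d d0 dA] : nbhs x A by apply: open_nbhs_nbhs; split.
have [n nd] := ltr_add_invr d0; rewrite add0r in nd.
by exists n => y yx; apply: dA; exact: lt_trans nd.
Qed.

(** The projections are continuous, so products of Borel sets are Borel;
    conversely an open set is a countable union of rational rectangles.
    Generation by open sets is the form suited to the induction in
    [plane_regularity]. *)
Lemma plane_measurableE :
  @measurable _ (plane R) = <<s [set A : set (R * R) | open A] >>.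
Proof.
apply/seteqP; split; last first.
  apply: smallest_sub; first exact: sigma_algebra_measurable.
  by move=> A /= oA; exact: open_measurable_plane.
rewrite measurable_prod_measurableType; apply: smallest_sub.
  exact: smallest_sigma_algebra.
move=> _ [X mX] [Y mY] <-.
pose T := g_sigma_algebraType [set A : set (R * R) | open A].
have mfst : measurable_fun [set: T] (fst : T -> measurableTypeR R).
  apply: (measurability _ (@RGenOpens.measurableE R)) => _ [_ [x [y ->]] <-].
  rewrite setTI; apply: sub_sigma_algebra => /=.
  by apply: open_comp; [move=> z _; exact: cvg_fst|exact: interval_open].
have msnd : measurable_fun [set: T] (snd : T -> measurableTypeR R).
  apply: (measurability _ (@RGenOpens.measurableE R)) => _ [_ [x [y ->]] <-].
  rewrite setTI; apply: sub_sigma_algebra => /=.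
  by apply: open_comp; [move=> z _; exact: cvg_snd|exact: interval_open].
have -> : X `*` Y = (fst @^-1` X) `&` (snd @^-1` Y) by [].
apply: (@measurableI _ T); rewrite -[X in measurable X]setTI.
  exact: mfst.
exact: msnd.
Qed.

Lemma continuous_measurable_plane (f : R * R -> R) :
  continuous f -> measurable_fun [set: plane R] (f : plane R -> R).
Proof.
move=> cf; apply: (measurability _ (@RGenOpens.measurableE R)) => _ [_ [x [y ->]] <-].
rewrite setTI; apply: open_measurable_plane.
by apply: open_comp => //; exact: interval_open.
Qed.

Lemma lebesgue2_itvX (i j : interval R) :
  lebesgue2 R ([set` i] `*` [set` j]) =
  (lebesgue_measure [set` i] * lebesgue_measure [set` j])%E.
Proof. by apply: product_measure1E; exact: measurable_itv. Qed.

End plane_topology.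

(** * Bisection *)

Section bisection.
Variable R : realType.

Lemma nested_intervals (a s : nat -> R) : (forall n, 0 <= s n) ->
  (forall n, a n <= a n.+1) -> (forall n, a n.+1 + s n.+1 <= a n + s n) ->
  exists x, forall n, a n <= x <= a n + s n.
Proof.
move=> s0 ai ci.
have aM m n : (m <= n)%N -> a m <= a n.
  by move=> mn; apply: (homo_leq (f := a) (r := fun x y => x <= y)) mn => // y x z /le_trans; exact.
have cM m n : (m <= n)%N -> a n + s n <= a m + s m.
  move=> mn; apply: (homo_leq (f := fun k => a k + s k) (r := fun x y => y <= x)) mn => //.
  by move=> y x z xy yz; exact: le_trans xy.
have ac m n : a m <= a n + s n.
  have [mn|/ltnW nm] := leqP m n; first by rewrite (le_trans (aM _ _ mn))// lerDl.
  by rewrite (le_trans _ (cM _ _ nm))// lerDl.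
have hs n : ubound (range a) (a n + s n) by move=> _ [m _ <-].
exists (sup (range a)) => n; apply/andP; split.
  by apply: ub_le_sup; [exists (a 0%N + s 0%N); exact: hs|exists n].
by apply: ge_sup; [exists (a 0%N), 0%N|exact: hs].
Qed.

(** The square is returned as a total function of the given one, so that the
    nested sequence can be built by plain iteration after a single choice. *)
Lemma bisection_step (P : R -> R -> R -> Prop) :
  (forall a b s, 0 < s -> P a b (s / 2) -> P (a + s / 2) b (s / 2) ->
    P a (b + s / 2) (s / 2) -> P (a + s / 2) (b + s / 2) (s / 2) -> P a b s) ->
  forall p : R * R * R, exists q : R * R * R, 0 < p.2 -> ~ P p.1.1 p.1.2 p.2 ->
    [/\ ~ P q.1.1 q.1.2 q.2, q.2 = p.2 / 2,
      p.1.1 <= q.1.1 /\ q.1.1 + q.2 <= p.1.1 + p.2 &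
      p.1.2 <= q.1.2 /\ q.1.2 + q.2 <= p.1.2 + p.2].
Proof.
move=> H [[a b] s] /=.
have [s0|] := pselect (0 < s); last by move=> n; exists (a, b, s) => /n.
have [|N] := pselect (P a b s); first by move=> h; exists (a, b, s) => _ /(_ h).
have [nq|H'] := pselect (forall q : bool * bool,
    P (a + (if q.1 then s / 2 else 0)) (b + (if q.2 then s / 2 else 0)) (s / 2)).
  exfalso; apply: N; apply: H => //.
  - by have := nq (false, false); rewrite /= !addr0.
  - by have := nq (true, false); rewrite /= !addr0.
  - by have := nq (false, true); rewrite /= !addr0.
  - by have := nq (true, true).
move/existsNP : H' => [[i j] /= nP].
exists (a + (if i then s / 2 else 0), b + (if j then s / 2 else 0), s / 2) => /= _ _.
by split => //; [case: i {nP}|case: j {nP}]; split; lra.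
Qed.

(** As in Goursat's lemma: squares on which [P] fails would be nested around a
    point, at which [P] would fail on arbitrarily small squares. Locally [P]
    is only required for the squares that contain the point. *)
Lemma square_bisection (P : R -> R -> R -> Prop) :
  (forall a b s, 0 < s -> P a b (s / 2) -> P (a + s / 2) b (s / 2) ->
    P a (b + s / 2) (s / 2) -> P (a + s / 2) (b + s / 2) (s / 2) -> P a b s) ->
  forall a b s, 0 < s ->
  (forall x y, a <= x <= a + s -> b <= y <= b + s ->
    exists2 d, 0 < d & forall a' b' t, 0 < t < d ->
      a <= a' /\ a' + t <= a + s -> b <= b' /\ b' + t <= b + s ->
      a' <= x <= a' + t -> b' <= y <= b' + t -> P a' b' t) ->
  P a b s.
Proof.
move=> H a b s s0 loc; apply: contrapT => nP.
have [F HF] := choice (bisection_step H).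
pose p n := iter n F (a, b, s).
have Hp n : [/\ ~ P (p n).1.1 (p n).1.2 (p n).2, (p n).2 = s / 2 ^+ n,
    a <= (p n).1.1 /\ (p n).1.1 + (p n).2 <= a + s &
    b <= (p n).1.2 /\ (p n).1.2 + (p n).2 <= b + s].
  elim: n => [|n [np sn [a1 a2] [b1 b2]]]; first by split => //; rewrite expr0 divr1.
  have pn0 : 0 < (p n).2 by rewrite sn divr_gt0// exprn_gt0.
  rewrite /p iterS -/(p n); have [? sF [? ?] [? ?]] := HF (p n) pn0 np.
  split; [by []|by rewrite sF sn exprS; field; rewrite expf_neq0// pnatr_eq0|lra|lra].
have p0 n : 0 < (p n).2.
  by have [_ -> _ _] := Hp n; rewrite divr_gt0// exprn_gt0.
have step n : ((p n).1.1 <= (p n.+1).1.1 /\ (p n.+1).1.1 + (p n.+1).2 <= (p n).1.1 + (p n).2) /\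
    ((p n).1.2 <= (p n.+1).1.2 /\ (p n.+1).1.2 + (p n.+1).2 <= (p n).1.2 + (p n).2).
  by have [np _ _ _] := Hp n; have [_ _ ? ?] := HF (p n) (p0 n) np.
have [x Hx] : exists x, forall n, (p n).1.1 <= x <= (p n).1.1 + (p n).2.
  by apply: nested_intervals => n; [exact: ltW|case: (step n) => -[]..].
have [y Hy] : exists x, forall n, (p n).1.2 <= x <= (p n).1.2 + (p n).2.
  by apply: nested_intervals => n; [exact: ltW|case: (step n) => _ []..].
have [|//|d d0 Hd] := loc x y; [exact: (Hx 0%N)|exact: (Hy 0%N)|].
have [n nd] : exists n, s / 2 ^+ n < d.
  have /cvgrPdist_lt/(_ _ d0) : s * (2^-1 ^+ n) @[n --> \oo] --> s * 0.
    apply: cvgMr; apply: cvg_expr; rewrite ger0_norm ?invr_ge0//.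
    by rewrite invf_lt1// ltr1n.
  rewrite mulr0 => -[N _ /(_ N (leqnn _))]; rewrite /= sub0r normrN => h.
  by exists N; rewrite -exprVn (le_lt_trans (ler_norm _)).
have [np sn ab bb] := Hp n; apply: np; apply: Hd => //.
by rewrite p0 sn.
Qed.

Lemma interval_bisection (P : R -> R -> Prop) :
  (forall a s, 0 < s -> P a (s / 2) -> P (a + s / 2) (s / 2) -> P a s) ->
  forall a s, 0 < s ->
  (forall x, a <= x <= a + s ->
    exists2 d, 0 < d & forall a' t, 0 < t < d ->
      a <= a' /\ a' + t <= a + s -> a' <= x <= a' + t -> P a' t) ->
  P a s.
Proof.
move=> H a s s0 loc; apply: (@square_bisection (fun a _ => P a) _ a 0 s s0).
  by move=> a' b' t t0 p1 p2 _ _; exact: H.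
move=> x y /loc[d d0 Hd] _; exists d => // a' b' t td ab _ + _; exact: Hd.
Qed.

End bisection.

(** * Regularity of measures on the plane *)

Section regularity.
Variable R : realType.
Local Open Scope ereal_scope.

Definition regular_set (nu : set (plane R) -> \bar R) (F : set (R * R)) :=
  forall e : R, (0 < e)%R -> exists C O : set (R * R),
    [/\ closed C, open O, C `<=` F, F `<=` O & nu (O `\` C) < e%:E].

Lemma decreasing_to_empty_small (nu : {measure set (plane R) -> \bar R})
    (F : nat -> set (plane R)) (e : R) : nu setT < +oo -> (0 < e)%R ->
  (forall n, measurable (F n)) -> (forall n, F n.+1 `<=` F n) ->
  \bigcap_n F n = set0 -> exists n, nu (F n) < e%:E.
Proof.
move=> nuT e0 mF dF F0.
have : nu \o F @ \oo --> nu (\bigcap_n F n).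
  apply: nonincreasing_cvg_mu => //.
  - by apply: le_lt_trans nuT; apply: le_measure => //; rewrite inE.
  - by rewrite F0.
  - by move=> n m nm; apply/subsetPset; move: nm; apply: (homo_leq (f := F) (r := fun x y => y `<=` x)) => // [A x //|A B C AB BC x /BC]; exact: AB.
rewrite F0 measure0 => /fine_cvgP[fF /cvgrPdist_lt/(_ _ e0)].
move=> H; near \oo => n; exists n.
have fn : nu (F n) \is a fin_num by near: n; exact: fF.
rewrite -(fineK fn) lte_fin.
have : (`|0 - fine (nu (F n))| < e)%R by near: n; exact: H.
by rewrite sub0r normrN; apply: le_lt_trans; exact: ler_norm.
Unshelve. all: by end_near. Qed.

Lemma open_regular (nu : {measure set (plane R) -> \bar R}) (O : set (R * R)) :
  nu setT < +oo -> open O -> regular_set nu O.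
Proof.
move=> nuT oO e e0.
have cO := @closed_inner R O; have mO := open_measurable_plane oO.
have mi n : measurable (inner O n : set (plane R)) by exact: closed_measurable_plane.
have [n nO] : exists n, nu (O `\` inner O n) < e%:E.
  apply: decreasing_to_empty_small => // [n|n x [Ox nO]|].
  - exact: measurableD.
  - by split=> // H; apply: nO; exact: inner_mono H.
  - apply/seteqP; split=> // x H; have [Ox _] := H 0%N Logic.I.
    by have [n nx] := open_inner oO Ox; have [_] := H n Logic.I.
by exists (inner O n), O; split => //; exact: inner_sub.
Qed.

(** The sets that can be squeezed between a closed and an open set form a
    sigma-algebra, which contains the open sets because these are exhausted by
    closed ones. *)
Lemma plane_regularity (nu : {measure set (plane R) -> \bar R}) (F : set (plane R)) :
  nu setT < +oo -> measurable F -> regular_set nu F.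
Proof.
move=> nuT; rewrite plane_measurableE; move: F.
have mo := @open_measurable_plane R.
have mc := @closed_measurable_plane R.
apply: smallest_sub; last by move=> O /= oO; exact: open_regular.
split.
- by apply: open_regular => //; exact: open0.
- move=> A HA e e0; have [C [V [cC oO CA AO nOC]]] := HA e e0.
  exists (~` V), (~` C); split.
  + exact: open_closedC.
  + exact: closed_openC.
  + by rewrite setTD; exact: subsetC.
  + by rewrite setTD; exact: subsetC.
  + by rewrite setDE setCK setIC -setDE.
- move=> A HA e e0.
  pose en n : R := (e / 2 / (2 ^ n.+1)%:R)%R.
  have en0 n : (0 < en n)%R by rewrite !divr_gt0// ltr0n expn_gt0.
  have [C HC] := choice (fun n => HA n (en n) (en0 n)).
  have {HC}[V HO] := choice HC.
  have cC n : closed (C n) by have [] := HO n.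
  have oO n : open (V n) by have [] := HO n.
  pose CN N := \big[setU/set0]_(i < N) C i.
  have mCN N : measurable (CN N : set (plane R)).
    by apply: bigsetU_measurable => i _; exact: mc.
  have mO : measurable (\bigcup_n V n : set (plane R)).
    by apply: bigcupT_measurable => n; exact: mo.
  have mC : measurable (\bigcup_n C n : set (plane R)).
    by apply: bigcupT_measurable => n; exact: mc.
  have h1 : nu (\bigcup_n V n `\` \bigcup_n C n) <= (e / 2)%:E.
    have mOC n : measurable (V n `\` C n : set (plane R)).
      by apply: measurableD; [exact: mo|exact: mc].
    apply: (@le_trans _ _ (\sum_(0 <= n <oo) nu (V n `\` C n))).
      apply: measure_sigma_subadditive => //; first exact: measurableD.
      by move=> x [[n _ Onx] nC]; exists n => //; split=> // Cx; apply: nC; exists n.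
    apply: le_trans (epsilon_trick0 xpredT _); last by rewrite divr_ge0// ltW.
    by apply: lee_nneseries => // n _; have [_ _ _ _ /ltW] := HO n.
  have [N hN] : exists N, nu ((\bigcup_n C n) `\` CN N) < (e / 2)%:E.
    apply: decreasing_to_empty_small => //; first by rewrite divr_gt0.
    - by move=> n; exact: measurableD.
    - move=> n x [Cx nC]; split=> // CNx; apply: nC.
      by rewrite /CN big_ord_recr; left.
    - apply/seteqP; split=> // x H; have [[n _ Cnx] _] := H 0%N Logic.I.
      have [_] := H n.+1 Logic.I; apply; rewrite /CN big_ord_recr; right => //.
  exists (CN N), (\bigcup_n V n); split.
  + by apply: closed_bigsetU => i _; exact: cC.
  + by apply: bigcup_open => n _; exact: oO.
  + move=> x; rewrite /CN -bigcup_mkord => -[n _ Cnx]; exists n => //.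
    by have [_ _ + _ _] := HO n; exact.
  + by move=> x [n _ Ax]; exists n => //; have [_ _ _ + _] := HO n; exact.
  + apply: (@le_lt_trans _ _ (nu ((\bigcup_n V n `\` \bigcup_n C n) `|`
        ((\bigcup_n C n) `\` CN N)))).
      apply: le_measure; rewrite ?inE.
      * exact: measurableD.
      * by apply: measurableU; exact: measurableD.
      * move=> x [Ox nCN]; have [Cx|nCx] := pselect ((\bigcup_n C n) x).
          by right.
        by left.
    rewrite [ltRHS](_ : _ = (e / 2)%:E + (e / 2)%:E); last by rewrite -EFinD -splitr.
    have h2 : nu ((\bigcup_n V n `\` \bigcup_n C n) `|` ((\bigcup_n C n) `\` CN N)) <=
        nu (\bigcup_n V n `\` \bigcup_n C n) + nu ((\bigcup_n C n) `\` CN N).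
      by apply: measureU2; exact: measurableD.
    by apply: (le_lt_trans h2); apply: lee_ltD => //; rewrite ge0_fin_numE// (le_lt_trans h1)// ltry.
Qed.

(** The area is not finite: the previous lemma is applied to its restrictions
    to an increasing sequence of squares, with summable errors. *)
Lemma lebesgue2_outer_regularity (E : set (plane R)) (e : R) :
  measurable E -> (0 < e)%R ->
  exists O : set (R * R), [/\ open O, E `<=` O & lebesgue2 R (O `\` E) <= e%:E].
Proof.
move=> mE e0.
pose B n : set (plane R) := `](- n.+1%:R)%R, n.+1%:R[ `*` `](- n.+1%:R)%R, n.+1%:R[.
have oB n : open (B n : set (R * R)) by apply: open_plane_setX; exact: interval_open.
have mB n : measurable (B n) by exact: measurable_itvX.
pose en n : R := (e / (2 ^ n.+1)%:R)%R.
have en0 n : (0 < en n)%R by rewrite !divr_gt0// ltr0n expn_gt0.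
have H n : exists O : set (R * R),
    [/\ open O, E `<=` O & lebesgue2 R ((O `\` E) `&` B n) < (en n)%:E].
  have [|C [V [cC oO CE EO nOC]]] := @plane_regularity (mrestr (lebesgue2 R) (mB n)) E _ mE _ (en0 n).
    by rewrite /= /mrestr setTI /B lebesgue2_itvX !lebesgue_measure_itv /= lte_fin gtrN ?ltr0n//= -!EFinD -EFinM ltry.
  exists V; split => //; apply: le_lt_trans nOC.
  rewrite [leRHS]/= /mrestr; apply: le_measure; rewrite ?inE.
  - apply: measurableI => //; apply: measurableD => //; exact: open_measurable_plane.
  - apply: measurableI => //; apply: measurableD; [exact: open_measurable_plane|exact: closed_measurable_plane].
  - by move=> x [[Ox nE] Bx]; split=> //; split=> // /CE.
have [V HO] := choice H.
exists (\bigcup_n (V n `&` B n)); split.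
- by apply: bigcup_open => n _; apply: openI => //; have [] := HO n.
- move=> x Ex.
  have xn : (`|x| < (Num.truncn `|x|).+1%:R)%R by exact: truncnS_gt.
  exists (Num.truncn `|x|) => //; split; first by have [_ + _] := HO (Num.truncn `|x|); exact.
  move: xn; rewrite plane_norm_lt !ltr_norml => /andP[x1 x2].
  by split; rewrite /= in_itv.
- have mOn n : measurable (V n : set (plane R)).
    by apply: open_measurable_plane; have [] := HO n.
  apply: (@le_trans _ _ (\sum_(0 <= n <oo) lebesgue2 R ((V n `\` E) `&` B n))).
    apply: measure_sigma_subadditive => //.
    + by move=> n; apply: measurableI => //; exact: measurableD.
    + by apply: measurableD => //; apply: bigcupT_measurable => n; exact: measurableI.
    + by move=> x [[n _ [Onx Bnx]] nE]; exists n.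
  apply: le_trans (epsilon_trick0 xpredT (ltW e0)).
  by apply: lee_nneseries => // n _; have [_ _ /ltW] := HO n.
Qed.

End regularity.

(** * Squares and level sets *)

Section squares.
Variable R : realType.
Local Open Scope ereal_scope.

(** Half-open squares, so that the four quarters of a square partition it. *)
Definition sq (a b t : R) : set (R * R) := `[a, (a + t)%R[ `*` `[b, (b + t)%R[.

Lemma sq_measurable a b t : measurable (sq a b t : set (plane R)).
Proof. exact: measurable_itvX. Qed.

Lemma sqP a b t (z : R * R) :
  sq a b t z <-> [/\ a <= z.1, z.1 < a + t, b <= z.2 & z.2 < b + t]%R.
Proof.
rewrite /sq; split; first by case; rewrite /= !in_itv /= => /andP[? ?] /andP[].
by case=> ? ? ? ?; split; rewrite /= in_itv /=; apply/andP; split.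
Qed.

Lemma lebesgue2_sq a b t : (0 <= t)%R -> lebesgue2 R (sq a b t) = (t ^+ 2)%:E.
Proof.
move=> t0; rewrite /sq lebesgue2_itvX !lebesgue_measure_itv /= !lte_fin !ltrDl.
by case: ltP => [tp|tn]; [rewrite -!EFinB -EFinM; congr EFin; ring|
  rewrite mul0e (_ : t = 0%R) ?expr0n//; apply/eqP; rewrite eq_le tn t0].
Qed.

Lemma sq_split a b s : (0 < s)%R ->
  [/\ sq a b s = (sq a b (s / 2) `|` sq (a + s / 2) b (s / 2)) `|`
        (sq a (b + s / 2) (s / 2) `|` sq (a + s / 2) (b + s / 2) (s / 2)),
      sq a b (s / 2) `&` sq (a + s / 2) b (s / 2) = set0,
      sq a (b + s / 2) (s / 2) `&` sq (a + s / 2) (b + s / 2) (s / 2) = set0 &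
      (sq a b (s / 2) `|` sq (a + s / 2) b (s / 2)) `&`
        (sq a (b + s / 2) (s / 2) `|` sq (a + s / 2) (b + s / 2) (s / 2)) = set0].
Proof.
move=> s0.
have d1 p q r t : sq p q r `&` sq (p + r) q t = set0.
  apply/seteqP; split=> // x [/sqP[? ? _ _] /sqP[? _ _ _]]; exfalso; lra.
split=> //; last first.
  by apply/seteqP; split=> // x [[] /sqP[_ _ _ ?] [] /sqP[_ _ ? _]]; exfalso; lra.
apply/seteqP; split => x.
- move=> /sqP[? ? ? ?].
  have [l1|l1] := ltP x.1 (a + s / 2)%R; have [l2|l2] := ltP x.2 (b + s / 2)%R.
  + by left; left; apply/sqP; split=> //; lra.
  + by right; left; apply/sqP; split=> //; lra.
  + by left; right; apply/sqP; split=> //; lra.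
  + by right; right; apply/sqP; split=> //; lra.
- by case=> -[] /sqP[? ? ? ?]; apply/sqP; split=> //; lra.
Qed.

Lemma sq_quarters (nu : {measure set (plane R) -> \bar R}) a b s : (0 < s)%R ->
  nu (sq a b s) = nu (sq a b (s / 2)) + nu (sq (a + s / 2) b (s / 2)) +
    (nu (sq a (b + s / 2) (s / 2)) + nu (sq (a + s / 2) (b + s / 2) (s / 2))).
Proof.
move=> s0; have m := sq_measurable; have [-> d1 d2 d3] := sq_split a b s0.
by rewrite !measureU //; exact: measurableU.
Qed.

Lemma integral_sq_quarters (f : plane R -> \bar R) a b s : (0 < s)%R ->
  measurable_fun [set: plane R] f -> (forall z, 0 <= f z) ->
  let I a b s := \int[lebesgue2 R]_(z in sq a b s) f z in
  I a b s = I a b (s / 2)%R + I (a + s / 2)%R b (s / 2)%R +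
    (I a (b + s / 2)%R (s / 2)%R + I (a + s / 2)%R (b + s / 2)%R (s / 2)%R).
Proof.
move=> s0 mf f0 I; rewrite /I; have m := sq_measurable.
have [-> d1 d2 d3] := sq_split a b s0.
have mfs (A : set (plane R)) : measurable A -> measurable_fun A f.
  by move=> mA; exact: measurable_funS mf.
by rewrite !ge0_integral_setU //; try (by apply/disj_setPS; rewrite ?d1 ?d2 ?d3);
  try (exact: measurableU); apply: mfs; try (exact: measurableU);
  apply: measurableU; exact: measurableU.
Qed.

Lemma sq_near a b t (x y : R * R) : (a <= x.1 <= a + t)%R -> (b <= x.2 <= b + t)%R ->
  sq a b t y -> (`|y - x| <= t)%R.
Proof.
move=> /andP[? ?] /andP[? ?] /sqP[? ? ? ?].
by rewrite plane_norm_le /= !ler_norml; apply/andP; split; apply/andP; split; lra.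
Qed.

Definition big_square (n : nat) : set (R * R) :=
  sq (- n.+1%:R) (- n.+1%:R) (n.+1%:R *+ 2).

Lemma big_square_cover : \bigcup_n big_square n = setT.
Proof.
apply/seteqP; split=> // x _.
have xn : (`|x| < (Num.truncn `|x|).+1%:R)%R by exact: truncnS_gt.
exists (Num.truncn `|x|) => //; move: xn.
rewrite plane_norm_lt !ltr_norml => /andP[/andP[? ?] /andP[? ?]].
apply/sqP; split; lra.
Qed.

Lemma big_square_mono i j : (i <= j)%N -> big_square i `<=` big_square j.
Proof.
move=> ij x /sqP[? ? ? ?]; have ijR : (i.+1%:R <= j.+1%:R :> R)%R by rewrite ler_nat.
by apply/sqP; split; lra.
Qed.

Lemma measure_le_on_squares (nu : {measure set (plane R) -> \bar R})
    (E : set (plane R)) (B : \bar R) :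
  measurable E -> (forall n, nu (E `&` big_square n) <= B) -> nu E <= B.
Proof.
move=> mE EB.
have mEn n : measurable (E `&` big_square n : set (plane R)).
  by apply: measurableI => //; exact: sq_measurable.
have cv : nu \o (fun n => E `&` big_square n) @ \oo --> nu (\bigcup_n (E `&` big_square n)).
  apply: nondecreasing_cvg_mu => //; first exact: bigcupT_measurable.
  by move=> i j /big_square_mono ij; apply/subsetPset; exact: setIS.
rewrite -setI_bigcupr big_square_cover setIT in cv.
rewrite -(cvg_lim _ cv)//; apply: lime_le; first by apply/cvg_ex; eexists; exact: cv.
by near=> n; exact: EB.
Unshelve. all: by end_near. Qed.

End squares.

Section levels.
Variables (R : realType) (d : measure_display) (T : measurableType d).
Variables (mu : {measure set T -> \bar R}) (F : set T) (kappa : T -> R).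
Hypotheses (mF : measurable F) (mk : measurable_fun F kappa).
Hypothesis k0 : forall x, F x -> (0 < kappa x)%R.
Local Open Scope ereal_scope.

(** All the integers have to serve as exponents of [expR 1], since [kappa]
    need be neither bounded nor bounded away from 0; hence the enumeration of
    [int]. An index that codes no integer gets the value 1, which keeps
    [level_bound] positive. *)
Definition level (n : nat) : set T :=
  if pickle_inv n is Some j then
    F `&` kappa @^-1` `[expR (j : int)%:~R, expR (j + 1)%:~R[%classic else set0.

Definition level_bound (n : nat) : R :=
  if pickle_inv n is Some j then expR ((j : int) + 1)%:~R else 1%R.

Lemma level_bound_gt0 n : (0 < level_bound n)%R.
Proof. by rewrite /level_bound; case: pickle_inv => // j; exact: expR_gt0. Qed.

Lemma level_measurable n : measurable (level n).
Proof. by rewrite /level; case: pickle_inv => // j; exact: mk. Qed.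

Lemma level_bigcup : \bigcup_n level n = F.
Proof.
apply/seteqP; split => [x [n _]|x Fx]; rewrite /level.
  by case: pickle_inv => // j [].
have [j /andP[l r]] : exists j : int, (j%:~R <= ln (kappa x) < (j + 1)%:~R)%R.
  by exists (Num.floor (ln (kappa x))); exact: floor_itv.
exists (pickle j); [by []|rewrite pickleK_inv; split; first by []].
have kx := k0 Fx; rewrite /= in_itv /=; apply/andP; split.
  by rewrite -[leRHS]lnK ?posrE// ler_expR.
by rewrite -[ltLHS]lnK ?posrE// ltr_expR.
Qed.

Lemma level_le n x : level n x -> (kappa x <= level_bound n)%R.
Proof.
rewrite /level /level_bound; case: pickle_inv => // j [_] /=.
by rewrite in_itv /= => /andP[_ /ltW].
Qed.

Lemma level_ge n x : level n x -> (level_bound n <= expR 1 * kappa x)%R.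
Proof.
rewrite /level /level_bound; case: pickle_inv => // j [_] /=.
by rewrite in_itv /= => /andP[+ _]; rewrite intrD expRD mulrC ler_pM2l// expR_gt0.
Qed.

Lemma level_trivIset : trivIset setT level.
Proof.
apply/trivIsetP => n m _ _ nm; apply/seteqP; split=> // x [].
rewrite /level; case En: (pickle_inv n) => [j|//]; case Em: (pickle_inv m) => [k|//].
move=> [_ +] [_] /=; rewrite !in_itv /= => /andP[a1 a2] /andP[b1 b2].
have h (p q : int) : (expR p%:~R <= kappa x)%R -> (kappa x < expR (q + 1)%:~R)%R -> (p <= q)%R.
  by move=> pk kq; rewrite -ltzD1 -(ltr_int R) -ltr_expR; exact: le_lt_trans pk kq.
have jk : j = k by apply/eqP; rewrite eq_le (h _ _ a1 b2) (h _ _ b1 a2).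
have : n = m.
  by have := @pickle_invK int n; have := @pickle_invK int m; rewrite En Em /= jk => -> ->.
by move/eqP; rewrite (negbTE nm).
Qed.

(** On a level set [kappa] and [level_bound] agree up to a factor [expR 1]:
    the source of the powers of this number in all the later estimates. *)
Lemma level_sum : \sum_(0 <= n <oo) (level_bound n)%:E * mu (level n) <=
  (expR 1)%:E * \int[mu]_(x in F) (kappa x)%:E.
Proof.
have mkl n : measurable_fun (level n) (fun x => (kappa x)%:E).
  apply/measurable_EFinP; apply: measurable_funS mk => //.
  by move=> x nx; rewrite -level_bigcup; exists n.
have lF n x : level n x -> F x by move=> nx; rewrite -level_bigcup; exists n.
rewrite -[X in \int[mu]_(x in X) _]level_bigcup ge0_integral_bigcup; last 4 first.
- exact: level_measurable.
- by rewrite level_bigcup; exact/measurable_EFinP.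
- by move=> x; rewrite level_bigcup => Fx; rewrite lee_fin ltW ?k0.
- exact: level_trivIset.
rewrite -nneseriesZl; last by move=> n _; apply: integral_ge0 => x /lF /k0 /ltW; rewrite lee_fin.
apply: lee_nneseries => [n _|n _]; first by rewrite mule_ge0// lee_fin ltW// level_bound_gt0.
have ml := level_measurable.
rewrite -ge0_integralZl//; last by move=> x /lF /k0 /ltW; rewrite lee_fin.
rewrite -integral_cst; last exact: level_measurable.
apply: ge0_le_integral => //.
- by move=> x _; rewrite lee_fin ltW// level_bound_gt0.
- exact: measurable_funeM.
- by move=> x /level_ge; rewrite lee_fin.
Qed.

End levels.

(** * Domination of a measure by a density *)

Section majorant.
Variables (R : realType) (d : measure_display) (T : measurableType d).
Variables (mu : {measure set T -> \bar R}) (F : set T) (kappa : T -> R).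
Hypotheses (mF : measurable F) (mk : measurable_fun F kappa).
Hypothesis k0 : forall x, F x -> (0 < kappa x)%R.
Local Open Scope ereal_scope.

(** Each level set of [kappa] is enclosed in an open set of nearly the same
    measure, as in the Vitali-Caratheodory theorem. The semicontinuous
    majorant of [kappa] so obtained is only used through its integrals over
    squares or intervals, so it is given directly as the measure [M]. The
    predicate [op] stands for openness, in the plane or on the line. *)
Lemma semicontinuous_majorant (op : set T -> Prop) (eta : R) :
  (forall O, op O -> measurable O) ->
  (forall n e, (0 < e)%R -> exists O, [/\ op O, level F kappa n `<=` O &
     mu (O `\` level F kappa n) <= e%:E]) ->
  (0 < eta)%R ->
  exists M : {measure set T -> \bar R},
    M setT <= (expR 1)%:E * \int[mu]_(x in F) (kappa x)%:E + eta%:E /\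
    forall x, F x -> exists O, [/\ op O, O x & forall X, measurable X -> X `<=` O ->
      (kappa x)%:E * mu X <= M X].
Proof.
move=> mop reg eta0.
pose c := @level_bound R.
have c0 n : (0 < c n)%R by exact: level_bound_gt0.
pose en n : R := (eta / (2 ^ n.+1)%:R)%R.
have en0 n : (0 < en n)%R by rewrite !divr_gt0// ltr0n expn_gt0.
have en0c n : (0 < en n / c n)%R by rewrite divr_gt0.
have [V HV] := choice (fun n => reg n _ (en0c n)).
have mV n : measurable (V n) by apply: mop; have [] := HV n.
have ml := level_measurable mF mk.
have cV n : (c n)%:E * mu (V n) <= (c n)%:E * mu (level F kappa n) + (en n)%:E.
  have [_ lV muV] := HV n.
  have -> : (en n)%:E = (c n)%:E * (en n / c n)%:E.
    by rewrite -EFinM mulrC divfK// gt_eqF.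
  rewrite -muleDr ?ge0_adde_def ?inE//; last by rewrite lee_fin ltW.
  apply: lee_wpmul2l; first by rewrite lee_fin ltW.
  rewrite -{1}(setDUK lV) measureU//; last 2 first.
  - exact: measurableD.
  - by rewrite setDIK.
  - by rewrite leeD2l.
pose cn n : {nonneg R} := NngNum (ltW (c0 n)).
pose M : {measure set T -> \bar R} :=
  mseries (fun n => mscale (cn n) (mrestr mu (mV n))) 0.
have ME X : M X = \sum_(0 <= n <oo) (c n)%:E * mu (X `&` V n) by [].
have t0 n X : 0 <= (c n)%:E * mu X by rewrite mule_ge0// lee_fin ltW.
exists M; split.
- rewrite ME.
  apply: (@le_trans _ _ (\sum_(0 <= n <oo) ((c n)%:E * mu (level F kappa n) + (en n)%:E))).
    by apply: lee_nneseries => // n _; rewrite setTI.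
  apply: le_trans (epsilon_trick xpredT _ (ltW eta0)) _ => //.
  by rewrite leeD2r//; exact: level_sum.
- move=> x Fx; have : (\bigcup_n level F kappa n) x by rewrite level_bigcup.
  move=> [n _ nx]; exists (V n); have [opV lV _] := HV n.
  split => //; first exact: lV.
  move=> X mX XV; rewrite ME.
  apply: (@le_trans _ _ ((c n)%:E * mu (X `&` V n))).
    rewrite (setIidl XV); apply: lee_wpmul2r => //.
    by rewrite lee_fin; exact: level_le nx.
  by rewrite (nneseriesD1 (n := n)) // leeDl // nneseries_ge0.
Qed.

End majorant.

Section domination.
Variable R : realType.
Local Open Scope ereal_scope.

(** Let [M] be a majorant of [kappa], and [K] a closed subset of [F] carrying
    nearly all of its [m]-measure. A small square around a point of [K] has
    [m]-measure at most [kappa x] times its area, hence at most its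
    [M]-measure; a small square around any other point misses [K]. As measures
    are additive, bisection propagates the inequality to all the squares. *)
Lemma measure_domination (m : {measure set (plane R) -> \bar R}) (F : set (plane R))
    (kappa : plane R -> R) :
  m setT < +oo -> measurable F -> measurable_fun F kappa ->
  (forall x, F x -> (0 < kappa x)%R) ->
  (forall x, F x -> exists2 e : R, (0 < e)%R & forall a b t, (0 < t < e)%R ->
     (a <= x.1 <= a + t)%R -> (b <= x.2 <= b + t)%R ->
     m (sq a b t) <= (kappa x * t ^+ 2)%:E) ->
  m F <= (expR 1)%:E * \int[lebesgue2 R]_(x in F) (kappa x)%:E.
Proof.
move=> mT mF mk k0 loc.
apply/lee_addgt0Pr => e e0.
rewrite [e]splitr EFinD addeA.
have e20 : (0 < e / 2)%R by rewrite divr_gt0.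
have [|||M [MT MF]] := @semicontinuous_majorant _ _ _ (lebesgue2 R) F kappa mF mk k0
  (fun A => open (A : set (R * R))) (e / 2).
- exact: open_measurable_plane.
- by move=> n eps eps0; apply: lebesgue2_outer_regularity => //; exact: level_measurable.
- exact: e20.
have [K [V [cK oV KF FV mVK]]] := plane_regularity mT mF e20.
have mK := closed_measurable_plane cK.
have mKQ a b s : (0 < s)%R -> m (sq a b s `&` K) <= M (sq a b s).
  move=> s0; apply: (@square_bisection R (fun a b s => m (sq a b s `&` K) <= M (sq a b s))) => //.
    move=> {s0}a {}b {}s s0 h1 h2 h3 h4.
    rewrite (sq_quarters M)//.
    have := sq_quarters (mrestr m mK) a b s0; rewrite /= /mrestr => ->.
    by rewrite !leeD.
  move=> x y _ _.
  have [Kz|nKz] := pselect (K (x, y)).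
    have [e1 e10 He1] := loc _ (KF _ Kz).
    have [W [oW Wz HW]] := MF _ (KF _ Kz).
    have /plane_nbhsP[e2' e20' He2] : nbhs ((x, y) : R * R) W by apply: open_nbhs_nbhs.
    exists (Num.min e1 e2'); first by rewrite lt_min e10.
    move=> a' b' t /andP[t0]; rewrite lt_min => /andP[te1 te2] _ _ xa yb.
    apply: (@le_trans _ _ (m (sq a' b' t))).
      by apply: le_measure; rewrite ?inE; [apply: measurableI; [exact: sq_measurable|]|exact: sq_measurable|exact: subIsetl].
    apply: le_trans (He1 a' b' t _ xa yb) _; first by rewrite t0.
    have := HW (sq a' b' t) (@sq_measurable R a' b' t).
    rewrite lebesgue2_sq; last exact: ltW.
    rewrite -EFinM; apply => w /(@sq_near _ _ _ _ (x, y) _ xa yb) /= wt.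
    by apply: He2; exact: le_lt_trans wt te2.
  have : nbhs ((x, y) : R * R) (~` K) by apply: open_nbhs_nbhs; split=> //; exact: closed_openC.
  move=> /plane_nbhsP[e1 e10 He1]; exists e1 => // a' b' t /andP[t0 te1] _ _ xa yb.
  rewrite (_ : _ `&` _ = set0) ?measure0//; apply/seteqP; split=> // w [/(@sq_near _ _ _ _ (x, y) _ xa yb) /= wt Kw].
  by apply: (He1 w _ Kw); exact: le_lt_trans wt te1.
have mKM : m K <= M setT.
  apply: measure_le_on_squares => // n; rewrite setIC.
  apply: le_trans (mKQ _ _ _ _) _; first by rewrite pmulrn_lgt0// ltr0n.
  by apply: le_measure; rewrite ?inE//; exact: sq_measurable.
have mFK : m (F `\` K) <= (e / 2)%:E.
  apply: le_trans (ltW mVK); apply: le_measure; rewrite ?inE.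
  - exact: measurableD.
  - by apply: measurableD => //; exact: open_measurable_plane.
  - by move=> x [/FV].
rewrite -{1}(setDUK KF) measureU//; [|exact: measurableD|by rewrite setDIK].
by rewrite leeD// (le_trans mKM).
Qed.

End domination.

(** * Change of variables for pointwise Lipschitz maps *)

Section comparison.
Variable R : realType.
Local Open Scope ereal_scope.

Import HBNNSimple.

(** Both sides are additive in the integrand, so the comparison passes from
    indicators to simple functions, and to their supremum. *)
Lemma integral_comparison (d1 d2 : measure_display) (X : measurableType d1)
    (Y : measurableType d2) (mu : {measure set X -> \bar R})
    (nu : {measure set Y -> \bar R}) (B : set X) (A : set Y) (T : Y -> X)
    (w : Y -> \bar R) (G : X -> \bar R) :
  measurable B -> measurable A -> measurable_fun [set: Y] T ->
  (forall y, A y -> B (T y)) ->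
  measurable_fun A w -> (forall y, A y -> 0 <= w y) ->
  (forall E, measurable E -> E `<=` B ->
    mu E <= \int[nu]_(y in A `&` T @^-1` E) w y) ->
  measurable_fun B G -> (forall x, B x -> 0 <= G x) ->
  \int[mu]_(x in B) G x <= \int[nu]_(y in A) (G (T y) * w y).
Proof.
move=> mB mA mT AB mw w0 H mG G0.
have mGT : measurable_fun A (G \o T).
  apply: (@measurable_comp _ _ _ _ _ _ B) => //; first by move=> _ [y Ay <-]; exact: AB.
  exact: measurable_funS mT.
rewrite integral_mkcond ge0_integralE; last by move=> x _; rewrite patchE; case: ifPn => // /set_mem /G0.
apply: ge_ereal_sup => _ [h /= hG] <-.
have mpre (E : set X) : measurable E -> measurable (T @^-1` E).
  by move=> mE; rewrite -[X in measurable X]setTI; exact: mT.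
have hGx x : (h x)%:E <= (G \_ B) x by have := hG x; rewrite patch_setT.
have h0 x : ~ B x -> h x = 0%R.
  move=> nBx; apply/eqP; rewrite eq_le fun_ge0 andbT -lee_fin.
  by have := hGx x; rewrite patchE memNset.
apply: (@le_trans _ _ (\int[nu]_(y in A) ((h (T y))%:E * w y))); last first.
  apply: ge0_le_integral => //.
  - by move=> y Ay; rewrite mule_ge0 ?w0// lee_fin fun_ge0.
  - apply: emeasurable_funM => //; apply/measurable_EFinP.
    by apply: measurable_funS (measurableT) _ _ => //; exact: measurableT_comp.
  - exact: emeasurable_funM.
  - move=> y Ay; apply: lee_wpmul2r; first exact: w0.
    by have := hGx (T y); rewrite patchE mem_set//; exact: AB.
have -> : \int[nu]_(y in A) ((h (T y))%:E * w y) =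
    \int[nu]_(y in A) (\sum_(r \in range h) (`|r|%:E * ((\1_(h @^-1` [set r]) (T y))%:E * w y))).
  apply: eq_integral => y /set_mem Ay; rewrite {1}(fimfunE h (T y)).
  rewrite -fsumEFin// ge0_mule_fsuml//; last first.
    move=> r; rewrite lee_fin; have [hr|hr] := pselect (h (T y) = r).
      by rewrite mulr_ge0// -hr fun_ge0.
    by rewrite indicE memNset ?mulr0.
  apply: eq_fsbigr => r /set_mem [x _ <-].
  by rewrite EFinM muleA ger0_norm// fun_ge0.
have m1 r : measurable_fun A (fun y => (\1_(h @^-1` [set r]) (T y))%:E * w y).
  apply: emeasurable_funM => //; apply/measurable_EFinP.
  by apply: measurable_funS (measurableT) _ _ => //; exact: measurableT_comp.
have p1 r y : A y -> 0 <= (\1_(h @^-1` [set r]) (T y))%:E * w y.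
  by move=> Ay; rewrite mule_ge0// ?w0// lee_fin.
rewrite ge0_integral_fsum//; last 2 first.
- by move=> r; exact: measurable_funeM.
- by move=> r y Ay; rewrite mule_ge0// p1.
rewrite sintegralE; apply: lee_fsum => // r [x _ <-].
have [/h0 hx0|Bx] := pselect (~ B x).
  by rewrite hx0 mul0e; apply: integral_ge0 => y Ay; rewrite mule_ge0// p1.
rewrite ge0_integralZl//; last by move=> y Ay; exact: p1.
rewrite ger0_norm ?fun_ge0//.
have [->|hx0] := eqVneq (h x) 0%R; first by rewrite !mul0e.
apply: lee_wpmul2l; first by rewrite lee_fin fun_ge0.
apply: (le_trans (H _ _ _)) => //.
  move=> z /= hz; apply: contrapT => /h0; rewrite hz; exact/eqP.
rewrite integral_mkcondr; apply: ge0_le_integral => //.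
- by move=> y Ay; rewrite patchE; case: ifPn => // _; exact: w0.
- apply/measurable_restrict => //; first exact: mpre.
  by apply: measurable_funS mw.
- move=> y Ay; rewrite patchE indicE.
  have [hy|hy] := pselect (h (T y) = h x); first by rewrite !mem_set// mul1e.
  by rewrite !memNset// mul0e.
Qed.

(** Half of a change of variables. The part of the domain of [S] that [S]
    sends into a square of side [t] around [x] lies in a square of side [2 *
    rho x * t], so [measure_domination] bounds the area of [E] by the integral
    of [4 * rho x ^+ 2] over its preimage. Applied to a conformal map and to
    its inverse, this compares integrals in both directions, and all it asks
    of the derivative is measurability. *)
Lemma lipschitz_change_of_variables (A B : set (plane R)) (T S : plane R -> plane R)
    (rho : plane R -> R) (G : plane R -> \bar R) :
  measurable A -> measurable B ->
  measurable_fun [set: plane R] T -> measurable_fun [set: plane R] S ->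
  (forall x, A x -> B (T x)) ->
  (forall y, B y -> A (S y) /\ T (S y) = y) ->
  measurable_fun A rho -> (forall x, A x -> (0 < rho x)%R) ->
  (forall x, A x -> exists2 e : R, (0 < e)%R & forall y, A y -> (`|y - x| < e)%R ->
     (`|T y - T x| <= rho x * `|y - x|)%R) ->
  measurable_fun B G -> (forall y, B y -> 0 <= G y) ->
  \int[lebesgue2 R]_(y in B) G y <=
    \int[lebesgue2 R]_(x in A) (G (T x) * (expR 1 * (4 * rho x ^+ 2))%:E).
Proof.
move=> mA mB mT mS AB BA mrho rho0 loc mG G0.
have mrho2 : measurable_fun A (fun x => (4 * rho x ^+ 2)%R).
  by apply: measurable_funM => //; apply: measurable_funX.
apply: integral_comparison => //.
- by apply/measurable_EFinP; apply: measurable_funM.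
- by move=> x Ax; rewrite lee_fin mulr_ge0// ?expR_ge0// mulr_ge0// exprn_ge0// ltW// rho0.
move=> E mE EB.
pose F := A `&` T @^-1` E.
have mF : measurable F.
  by apply: measurableI => //; rewrite -[X in measurable X]setTI; exact: mT.
have FA : F `<=` A by move=> x [].
pose Q n : set (plane R) := big_square n.
have mQ n : measurable (Q n) by exact: sq_measurable.
have mBQ n : measurable (B `&` Q n) by exact: measurableI.
have -> : \int[lebesgue2 R]_(x in F) (expR 1 * (4 * rho x ^+ 2))%:E =
    (expR 1)%:E * \int[lebesgue2 R]_(x in F) (4 * rho x ^+ 2)%:E.
  rewrite -ge0_integralZl//.
  - by apply/measurable_EFinP; exact: measurable_funS mrho2.
  - by move=> x /FA Ax; rewrite lee_fin mulr_ge0// exprn_ge0// ltW// rho0.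
apply: measure_le_on_squares => // n; rewrite -/(Q n).
pose m : {measure set (plane R) -> \bar R} :=
  measure_function_pushforward__canonical__measure_function_Measure
    (mrestr (lebesgue2 R) (mBQ n)) mS.
have mE' (X : set (plane R)) : m X = lebesgue2 R (S @^-1` X `&` (B `&` Q n)) by [].
have -> : lebesgue2 R (E `&` Q n) = m F.
  rewrite mE'; congr (lebesgue2 R _); apply/seteqP; split => [y [Ey Qy]|y [[_ /=]]].
    by have [ASy TSy] := BA _ (EB _ Ey); split; [split=> //=; rewrite TSy|split=> //; exact: EB].
  by move=> + [By Qy]; have [_ ->] := BA _ By.
apply: measure_domination => //.
- rewrite mE' setTI; apply: (@le_lt_trans _ _ (lebesgue2 R (Q n))).
    by apply: le_measure; rewrite ?inE//; exact: subIsetr.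
  by rewrite lebesgue2_sq ?ltry// pmulrn_lge0// ler0n.
- exact: measurable_funS mrho2.
- by move=> x /FA Ax; rewrite mulr_gt0// exprn_gt0// rho0.
- move=> x /FA Ax; have [e e0 He] := loc _ Ax; exists e => // a b t /andP[t0 te] xa xb.
  have rt0 : (0 <= rho x * t)%R by rewrite mulr_ge0 ?ltW// rho0.
  rewrite (_ : 4 * _ * _ = ((rho x * t) *+ 2) ^+ 2)%R; last by rewrite -mulr_natl; ring.
  rewrite mE'.
  pose D : set (plane R) := (`[(T x).1 - rho x * t, (T x).1 + rho x * t]%classic `*`
    `[(T x).2 - rho x * t, (T x).2 + rho x * t]%classic)%R.
  have -> : (((rho x * t) *+ 2) ^+ 2)%:E = lebesgue2 R D.
    rewrite /D lebesgue2_itvX !lebesgue_measure_itv /= !lte_fin.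
    have rtp : (0 < rho x * t)%R by rewrite mulr_gt0// rho0.
    by rewrite !ifT ?ltrD2l ?gtrN// -!EFinD -EFinM; congr EFin; rewrite -mulr_natl; ring.
  apply: le_measure; rewrite ?inE.
  + apply: measurableI => //; rewrite -[X in measurable X]setTI; apply: (mS) => //; exact: sq_measurable.
  + exact: measurable_itvX.
  + move=> y [Sy [By Qy]]; have [ASy TSy] := BA _ By.
    have le1 := sq_near xa xb Sy.
    have := He _ ASy (le_lt_trans le1 te).
    rewrite TSy => /le_trans/(_ (ler_wpM2l (ltW (rho0 _ Ax)) le1)).
    rewrite plane_norm_le !ler_distl => /andP[h1 h2].
    by split; rewrite /= in_itv.
Qed.

End comparison.

(** * The fundamental theorem of calculus as an inequality *)

Section oscillation.
Variable R : realType.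
Local Open Scope ereal_scope.
Local Notation lam := (@lebesgue_measure R).

(** The increment of [g] is subadditive under bisection, whereas the majorant
    of [rho] is additive, and small intervals around a given point satisfy the
    bound by hypothesis. *)
Lemma oscillation_le_integral_gt0 (g rho : R -> R) (a s : R) : (0 < s)%R ->
  measurable_fun `[a, a + s]%classic%R rho ->
  (forall x, (a <= x <= a + s)%R -> (0 < rho x)%R) ->
  (forall x, (a <= x <= a + s)%R -> exists2 e, (0 < e)%R & forall y,
     (`|y - x| < e)%R -> (`|g y - g x| <= rho x * `|y - x|)%R) ->
  (`|g (a + s) - g a|%R)%:E <=
    (expR 1)%:E * \int[lam]_(x in `[a, a + s]%classic%R) (rho x)%:E.
Proof.
move=> s0 mrho rho0 loc.
pose F : set R := `[a, a + s]%classic%R.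
have mF : measurable (F : set (measurableTypeR R)) by exact: measurable_itv.
have FP x : F x <-> (a <= x <= a + s)%R by rewrite /F /= in_itv.
have muF : lam F < +oo.
  by rewrite /F lebesgue_measure_itv /= lte_fin ltrDl s0 -EFinD ltry.
have r0 x : F x -> (0 < rho x)%R by move=> /FP; exact: rho0.
have ml := level_measurable mF mrho.
apply/lee_addgt0Pr => eta eta0.
have [| |//|M [MT MF]] := @semicontinuous_majorant _ _ (measurableTypeR R) lam F rho mF mrho r0
  (fun A => open (A : set R)) eta.
- by move=> U; exact: open_measurable.
- move=> n e e0; have [|U [oU lU mU]] := @lebesgue_regularity_outer R (level F rho n) e (ml n) _ e0.
    apply: le_lt_trans muF; apply: le_measure; rewrite ?inE//; first exact: ml.
    by move=> x nx; rewrite -(@level_bigcup _ _ _ F rho)//; exists n.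
  by exists U; split=> //; exact: ltW.
apply: le_trans MT.
suff : (`|g (a + s) - g a|%R)%:E <= M `[a, (a + s)%R[%classic.
  by move=> /le_trans; apply; apply: le_measure; rewrite ?inE//; exact: measurable_itv.
apply: (@interval_bisection R (fun a s => (`|g (a + s) - g a|%R)%:E <= M `[a, (a + s)%R[%classic)) => //.
  move=> {s0 mrho rho0 loc F mF FP muF r0 ml MF}a {}s s0 h1 h2.
  have -> : `[a, (a + s)%R[%classic = `[a, (a + s / 2)%R[%classic `|` `[(a + s / 2)%R, (a + s / 2 + s / 2)%R[%classic.
    apply/seteqP; split=> x; rewrite /= !in_itv /=.
      move=> /andP[? ?]; have [?|?] := ltP x (a + s / 2)%R; [left|right]; apply/andP; split => //; lra.
    by case=> /andP[? ?]; apply/andP; split; lra.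
  rewrite measureU//; last first.
    by apply/seteqP; split=> x //=; rewrite !in_itv /= => -[/andP[? ?] /andP[? ?]]; lra.
  apply: le_trans (leeD h1 h2); rewrite -EFinD lee_fin.
  have -> : (a + s / 2 + s / 2 = a + s)%R by lra.
  by rewrite [leRHS]addrC; exact: ler_distD.
move=> x xF; have [e1 e10 He1] := loc x xF.
have [W [oW Wx HW]] := MF x (proj2 (FP x) xF).
have /nbhs_ballP[e2 /= e20 He2] : nbhs x W by apply: open_nbhs_nbhs.
exists (Num.min e1 e2); first by rewrite lt_min e10.
move=> c t /andP[t0]; rewrite lt_min => /andP[te1 te2] _ /andP[cx xc].
have := HW _ (measurable_itv `[c, (c + t)%R[).
rewrite [X in _ * X]lebesgue_measure_itv /= lte_fin ltrDl t0 -EFinB.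
have -> : (c + t - c = t)%R by ring.
move=> H; apply: le_trans (H _) => {H}.
  have d1 : (`|(c + t) - x| = c + t - x)%R by rewrite ger0_norm// subr_ge0.
  have d2 : (`|c - x| = x - c)%R by rewrite distrC ger0_norm// subr_ge0.
  rewrite -EFinM lee_fin (le_trans (ler_distD (g x) _ _))//.
  have h1 := He1 (c + t)%R; have h2 := He1 c; rewrite d1 in h1; rewrite d2 in h2.
  rewrite [X in (_ + X <= _)%R]distrC.
  have -> : (rho x * t = rho x * (c + t - x) + rho x * (x - c))%R by ring.
  by apply: lerD; [apply: h1; lra|apply: h2; lra].
move=> y /=; rewrite in_itv /= => /andP[cy yc]; apply: He2.
by rewrite /ball /= ltr_norml; apply/andP; split; lra.
Qed.

(** The fundamental theorem of calculus as an inequality, for a function which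
    is pointwise Lipschitz everywhere. The slack [eps] in the hypothesis lets
    [rho] vanish, as the modulus of a derivative does. *)
Lemma oscillation_le_integral (g rho : R -> R) (a b : R) : (a <= b)%R ->
  measurable_fun `[a, b]%classic rho ->
  (forall x, (a <= x <= b)%R -> (0 <= rho x)%R) ->
  (forall x eps, (a <= x <= b)%R -> (0 < eps)%R -> exists2 e, (0 < e)%R & forall y,
     (`|y - x| < e)%R -> (`|g y - g x| <= (rho x + eps) * `|y - x|)%R) ->
  (`|g b - g a|%R)%:E <=
    (expR 1)%:E * \int[lam]_(x in `[a, b]%classic) (rho x)%:E.
Proof.
rewrite le_eqVlt => /predU1P[->|ab] mrho rho0 loc.
  rewrite subrr normr0; apply: mule_ge0; first by rewrite lee_fin expR_ge0.
  by apply: integral_ge0 => x; rewrite /= in_itv /= => /rho0; rewrite lee_fin.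
apply/lee_addgt0Pr => eta eta0.
have s0 : (0 < b - a)%R by rewrite subr_gt0.
have e10 : (0 < expR 1 * (b - a) :> R)%R by rewrite mulr_gt0// expR_gt0.
pose eps := (eta / (expR 1 * (b - a)))%R.
have eps0 : (0 < eps)%R by rewrite divr_gt0.
have abE : (a + (b - a) = b)%R by rewrite addrC subrK.
have mD : measurable (`[a, b]%classic : set (measurableTypeR R)) by exact: measurable_itv.
have := @oscillation_le_integral_gt0 g (fun x => rho x + eps)%R a (b - a)%R s0.
rewrite abE => /(_ _ _ _)/le_trans; apply.
- by apply: measurable_funD => //; exact: measurable_cst.
- by move=> x xab; rewrite ltr_wpDl// rho0.
- by move=> x xab; exact: loc.
under eq_integral do rewrite EFinD.
have p1 x : `[a, b]%classic x -> 0 <= (rho x)%:E.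
  by rewrite /= in_itv /= => /rho0; rewrite lee_fin.
have p2 (x : R) : `[a, b]%classic x -> 0 <= eps%:E by move=> _; rewrite lee_fin ltW.
have m1 : measurable_fun `[a, b]%classic (fun x => (rho x)%:E) by exact/measurable_EFinP.
have m2 : measurable_fun `[a, b]%classic (fun _ : R => eps%:E) by exact: measurable_cst.
rewrite (ge0_integralD _ mD p1 m1 p2 m2).
rewrite (_ : \int[lam]_(x in `[a, b]%classic) eps%:E = eps%:E * lam `[a, b]%classic); last first.
  by rewrite -integral_cst.
rewrite lebesgue_measure_itv /= lte_fin ab -EFinB muleDr//; last first.
  rewrite ge0_adde_def// inE; last by rewrite -EFinM lee_fin mulr_ge0 ?ltW.
  by apply: integral_ge0 => x; rewrite /= in_itv /= => /rho0; rewrite lee_fin.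
rewrite leeD2l// -!EFinM lee_fin /eps mulrCA divfK// gt_eqF//.
Qed.

End oscillation.

(** * Iterated integrals and the Cauchy-Schwarz inequality *)

Section plane_integrals.
Variable R : realType.
Local Open Scope ereal_scope.
Local Notation mu := (lebesgue2 R).
Local Notation lam := (@lebesgue_measure R).
Implicit Types (i j : interval R) (f : plane R -> \bar R).

Section tonelli.
Variables (f : plane R -> \bar R) (i j : interval R).
Hypotheses (mf : measurable_fun [set: plane R] f) (f0 : forall z, 0 <= f z).

Let D : set (plane R) := [set` i] `*` [set` j].
Let mD : measurable D. Proof. exact: measurable_itvX. Qed.
Let mfD : measurable_fun [set: plane R] (f \_ D).
Proof. by apply: (proj1 (measurable_restrictT f mD)); exact: measurable_funS mf. Qed.
Let fD0 z : 0 <= (f \_ D) z.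
Proof. by rewrite patchE; case: ifP. Qed.

Let fDE x y : (f \_ D) (x, y) =
  (fun x => if x \in [set` i] then ((fun y => f (x, y)) \_ [set` j]) y else 0) x.
Proof.
by rewrite /D !patchE in_setX /=; case: (x \in _) => //=; rewrite patchE.
Qed.

Let fDE' x y : (f \_ D) (x, y) =
  if y \in [set` j] then ((fun x => f (x, y)) \_ [set` i]) x else 0.
Proof.
by rewrite /D !patchE in_setX /= andbC; case: (y \in _) => //=; rewrite patchE.
Qed.

Lemma tonelli_itv1 : \int[mu]_(z in D) f z =
  \int[lam]_(x in [set` i]) \int[lam]_(y in [set` j]) f (x, y).
Proof.
rewrite integral_mkcond [LHS](fubini_tonelli1 _ mfD fD0) [RHS]integral_mkcond.
apply: eq_integral => x _; rewrite patchE /fubini_F.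
under eq_integral do rewrite fDE.
by case: ifPn => xi; [rewrite -integral_mkcond|rewrite integral0].
Qed.

Lemma tonelli_itv2 : \int[mu]_(z in D) f z =
  \int[lam]_(y in [set` j]) \int[lam]_(x in [set` i]) f (x, y).
Proof.
rewrite integral_mkcond [LHS](fubini_tonelli1 _ mfD fD0).
rewrite (fubini_tonelli _ mfD fD0) [RHS]integral_mkcond.
apply: eq_integral => y _; rewrite patchE /fubini_G.
under eq_integral do rewrite fDE'.
by case: ifPn => xi; [rewrite -integral_mkcond|rewrite integral0].
Qed.

End tonelli.

Lemma measurable_slice1 f j : measurable_fun [set: plane R] f ->
  (forall z, 0 <= f z) ->
  measurable_fun [set: measurableTypeR R] (fun x : R => \int[lam]_(y in [set` j]) f (x, y)).
Proof.
move=> mf f0; pose D : set (plane R) := [set: R] `*` [set` j].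
have mD : measurable D by apply: measurableX => //; exact: measurable_itv.
have mfD : measurable_fun [set: plane R] (f \_ D).
  by apply: (proj1 (measurable_restrictT f mD)); exact: measurable_funS mf.
have fD0 z : 0 <= (f \_ D) z by rewrite patchE; case: ifP.
apply: eq_measurable_fun (measurable_fun_fubini_tonelli_F _ mfD fD0) => x _.
rewrite /fubini_F [RHS]integral_mkcond; apply: eq_integral => y _.
by rewrite !patchE /D in_setX /= in_setT.
Qed.

Lemma measurable_slice2 f i : measurable_fun [set: plane R] f ->
  (forall z, 0 <= f z) ->
  measurable_fun [set: measurableTypeR R] (fun y : R => \int[lam]_(x in [set` i]) f (x, y)).
Proof.
move=> mf f0; pose D : set (plane R) := [set` i] `*` [set: R].
have mD : measurable D by apply: measurableX => //; exact: measurable_itv.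
have mfD : measurable_fun [set: plane R] (f \_ D).
  by apply: (proj1 (measurable_restrictT f mD)); exact: measurable_funS mf.
have fD0 z : 0 <= (f \_ D) z by rewrite patchE; case: ifP.
apply: eq_measurable_fun (measurable_fun_fubini_tonelli_G _ mfD fD0) => y _.
rewrite /fubini_G [RHS]integral_mkcond; apply: eq_integral => x _.
by rewrite !patchE /D in_setX /= in_setT andbT.
Qed.

Lemma measurable_section1 (d : measure_display) (T : measurableType d) (f : plane R -> T) x :
  measurable_fun [set: plane R] f -> measurable_fun [set: measurableTypeR R] (fun y : R => f (x, y)).
Proof.
by move=> mf; apply: (measurableT_comp mf); exact: pair1_measurable.
Qed.

Lemma measurable_section2 (d : measure_display) (T : measurableType d) (f : plane R -> T) y :
  measurable_fun [set: plane R] f -> measurable_fun [set: measurableTypeR R] (fun x : R => f (x, y)).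
Proof.
by move=> mf; apply: (measurableT_comp mf); exact: pair2_measurable.
Qed.

End plane_integrals.

Section cauchy_schwarz.
Variables (R : realType) (d : measure_display) (T : measurableType d).
Variable (mu : {measure set T -> \bar R}).
Local Open Scope ereal_scope.

(** Expanding the square of [f - s], where [s] is the mean of [f]. *)
Lemma sqr_integral_le (D : set T) (f : T -> R) (c : R) : measurable D ->
  mu D = c%:E -> (0 < c)%R -> measurable_fun D f -> (forall x, D x -> (0 <= f x)%R) ->
  (\int[mu]_(x in D) (f x)%:E) * (\int[mu]_(x in D) (f x)%:E) <=
  c%:E * \int[mu]_(x in D) (f x ^+ 2)%:E.
Proof.
move=> mD muD c0 mf f0.
have mf1 : measurable_fun D (fun x => (f x)%:E) by exact/measurable_EFinP.
have mf2 : measurable_fun D (fun x => (f x ^+ 2)%:E) by exact/measurable_EFinP/measurable_funX.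
have i0 : 0 <= \int[mu]_(x in D) (f x)%:E by apply: integral_ge0 => x /f0; rewrite lee_fin.
have i20 : 0 <= \int[mu]_(x in D) (f x ^+ 2)%:E.
  by apply: integral_ge0 => x _; rewrite lee_fin sqr_ge0.
have key s : (0 <= s)%R ->
    (2 * s)%:E * \int[mu]_(x in D) (f x)%:E <= \int[mu]_(x in D) (f x ^+ 2)%:E + (s ^+ 2 * c)%:E.
  move=> s0; rewrite -(ge0_integralZl _ mD) //; last by rewrite lee_fin mulr_ge0.
  rewrite [(s ^+ 2 * c)%:E]EFinM -muD -integral_cst// -ge0_integralD//; [|by move=> x _; rewrite lee_fin sqr_ge0..].
  apply: ge0_le_integral => //.
  - by move=> x Dx; rewrite mule_ge0// lee_fin ?mulr_ge0// f0.
  - exact: measurable_funeM.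
  - by apply: emeasurable_funD => //; exact: measurable_cst.
  - move=> x Dx; rewrite -EFinM -EFinD lee_fin -subr_ge0.
    by have := sqr_ge0 (f x - s)%R; rewrite sqrrB => /le_trans; apply; rewrite -mulr_natl; lra.
have [fin|] := boolP (\int[mu]_(x in D) (f x ^+ 2)%:E \is a fin_num); last first.
  by rewrite ge0_fin_numE// -leNgt leye_eq => /eqP ->; rewrite gt0_muley ?leey.
have ifin : \int[mu]_(x in D) (f x)%:E \is a fin_num.
  rewrite ge0_fin_numE//; have := key 1%R ler01; rewrite mulr1 => k1.
  rewrite -(@lte_pmul2l _ 2%:E)//.
  by rewrite (le_lt_trans k1)// gt0_muley// -(fineK fin) -EFinD ltry.
rewrite -(fineK fin) -(fineK ifin) in key i0 *.
set a := fine _ in key i0 *; set b := fine _ in key *.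
rewrite -!EFinM lee_fin; rewrite lee_fin in i0.
have := key (a / c)%R; rewrite -EFinM -EFinD lee_fin => /(_ (divr_ge0 i0 (ltW c0))).
have -> : (2 * (a / c) * a = 2 * (a * a / c))%R by ring.
have -> : ((a / c) ^+ 2 * c = a * a / c)%R by field; rewrite gt_eqF.
by move=> h; rewrite -ler_pdivrMl// mulrC; lra.
Qed.

Lemma sqr_add3_le (a b c : \bar R) : 0 <= a -> 0 <= b -> 0 <= c ->
  (a + b + c) * (a + b + c) <= 3%:E * (a * a + b * b + c * c).
Proof.
move: a b c => [a||] [b||] [c||] //= a0 b0 c0.
  rewrite -!EFinM lee_fin.
  by have := sqr_ge0 (a - b)%R; have := sqr_ge0 (a - c)%R; have := sqr_ge0 (b - c)%R; nra.
all: rewrite ?addey ?addye ?mulyy //=; rewrite ?addey ?addye //=; rewrite ?gt0_muley ?leey ?lte_fin //.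
all: by rewrite -!EFinM /=.
Qed.

End cauchy_schwarz.

(** * Upper gradients *)

Section slopes.
Variable R : realType.
Local Notation mu := (lebesgue2 R).
Local Notation lam := (@lebesgue_measure R).
Implicit Types (g G : R * R -> R).

(** [G] is an upper gradient of [g]. This notion has a chain rule for
    pointwise Lipschitz maps, hence survives composition with a conformal map,
    and controls increments along lines by [oscillation_le_integral]. *)
Definition slope_bound g G :=
  [/\ measurable_fun [set: plane R] (G : plane R -> R), forall w, 0 <= G w &
      forall w eps, 0 < eps -> exists2 e, 0 < e & forall w', `|w' - w| < e ->
        `|g w' - g w| <= (G w + eps) * `|w' - w| ].

Lemma slope_bound_continuous g G : slope_bound g G -> continuous g.
Proof.
move=> [_ G0 loc] w; apply/cvgrPdist_lt => eps eps0.
have [e e0 He] := loc w 1 ltr01.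
have G1 : 0 < G w + 1 by rewrite ltr_wpDl.
apply/plane_nbhsP; exists (Num.min e (eps / (G w + 1))); first by rewrite lt_min e0 divr_gt0.
move=> y; rewrite lt_min distrC [`|g w - g y|]distrC => /andP[y1 y2].
rewrite distrC in y1; rewrite distrC in y2.
by rewrite (le_lt_trans (He _ y1))// mulrC -ltr_pdivlMr.
Qed.

Lemma slope_bound_measurable g G : slope_bound g G ->
  measurable_fun [set: plane R] (g : plane R -> R).
Proof. by move=> /slope_bound_continuous; exact: continuous_measurable_plane. Qed.

Lemma derive_slope (p : R -> R) (x l eta : R) : is_derive x 1 p l -> 0 < eta ->
  exists2 e, 0 < e & forall y, `|y - x| < e ->
    `|p y - p x| <= (`|l| + eta) * `|y - x|.
Proof.
move=> [dp pl] eta0.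
have : h^-1 *: ((p \o shift x) (h *: 1) - p x) @[h --> 0^'] --> l.
  by rewrite -pl; exact: dp.
move=> /cvgrPdist_lt/(_ _ eta0); rewrite near_withinE => /nbhs_ballP[e /= e0 He].
exists e => // y yx.
have [->|yNx] := eqVneq y x; first by rewrite !subrr normr0 mulr0.
have yx0 : y - x != 0 by rewrite subr_eq0.
have := He (y - x); rewrite /ball /= sub0r normrN => /(_ yx yx0).
rewrite scaler1 subrK /GRing.scale /= => h.
have -> : p y - p x = ((y - x)^-1 * (p y - p x)) * (y - x) by rewrite mulrAC mulVf ?mul1r.
rewrite normrM ler_wpM2r//.
rewrite -[X in `|X|](subrK l) (le_trans (ler_normD _ _))// addrC lerD2l.
by rewrite distrC ltW.
Qed.

(** The slack is shared out between the two factors of the chain rule. *)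
Lemma slope_bound_comp g G (p dp : R -> R) : slope_bound g G ->
  (forall x : R, is_derive x 1 p (dp x)) ->
  measurable_fun [set: measurableTypeR R] dp ->
  slope_bound (p \o g) (fun w => `|dp (g w)| * G w).
Proof.
move=> sg Dp mdp; have [mG G0 loc] := sg; split.
- apply: measurable_funM => //; apply: measurableT_comp => //.
  by apply: measurableT_comp => //; exact: slope_bound_measurable sg.
- by move=> w; rewrite mulr_ge0.
- move=> w eps eps0; set l := dp (g w).
  pose e1 := eps / (2 * (`|l| + 1)).
  have l1 : 0 < `|l| + 1 by rewrite ltr_wpDl.
  have e10 : 0 < e1 by rewrite divr_gt0// mulr_gt0.
  have Ge : 0 < G w + e1 by rewrite ltr_wpDl.
  pose eta := eps / (2 * (G w + e1)).
  have eta0 : 0 < eta by rewrite divr_gt0// mulr_gt0.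
  have [d1 d10 H1] := loc w e1 e10.
  have [d2 d20 H2] := derive_slope (Dp (g w)) eta0.
  exists (Num.min d1 (d2 / (G w + e1))); first by rewrite lt_min d10 divr_gt0.
  move=> w' ; rewrite lt_min => /andP[ww1 ww2].
  have h1 := H1 _ ww1.
  have h2 : `|g w' - g w| < d2 by rewrite (le_lt_trans h1)// mulrC -ltr_pdivlMr.
  rewrite (le_trans (H2 _ h2))//.
  have leta : 0 <= `|l| + eta by rewrite addr_ge0// ltW.
  rewrite (le_trans (ler_wpM2l leta h1))// mulrA ler_wpM2r//.
  rewrite mulrDl !mulrDr -addrA lerD2l -mulrDr.
  have -> : eta * (G w + e1) = eps / 2 by rewrite /eta; field; rewrite gt_eqF.
  rewrite [leRHS]splitr lerD2r /e1.
  have -> : `|l| * (eps / (2 * (`|l| + 1))) = (`|l| / (`|l| + 1)) * (eps / 2).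
    by field; rewrite gt_eqF.
  by rewrite -[leRHS]mul1r ler_wpM2r ?divr_ge0 ?ltW// ltr_pdivrMr// mul1r ltrDl.
Qed.

Lemma slope_bound_exp g G (k : nat) : slope_bound g G ->
  slope_bound (fun w => g w ^+ k.+1) (fun w => k.+1%:R * `|g w| ^+ k * G w).
Proof.
move=> sg.
have := @slope_bound_comp g G (fun x => x ^+ k.+1) (fun x => k.+1%:R * x ^+ k) sg.
move=> /(_ _ _)[||m0 m1 m2].
- move=> x; have := @is_deriveX R R id k.+1 x 1 1 (is_derive_id _ _).
  rewrite scaler1 /= (_ : id ^+ k.+1 = (fun y : R => y ^+ k.+1))//.
  by apply/funext => y; rewrite fctE.
- by apply: measurable_funM => //; exact: measurable_funX.
split=> //.
- apply: eq_measurable_fun m0 => w _ /=; by rewrite normrM normr_nat normrX.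
- by move=> w; rewrite -[X in X * _ * _]normr_nat -normrX -normrM; exact: m1.
- by move=> w; rewrite -[X in X * _ * _]normr_nat -normrX -normrM; exact: m2.
Qed.

End slopes.

(** * The Gagliardo-Nirenberg inequality *)

Section gradient_inequalities.
Variable R : realType.
Local Open Scope ereal_scope.
Local Notation mu := (lebesgue2 R).
Local Notation lam := (@lebesgue_measure R).
Implicit Types (g G : R * R -> R).

Lemma oscillation_hor g G (i : interval R) x x' y : slope_bound g G ->
  x \in i -> x' \in i ->
  (`|g (x, y) - g (x', y)|%R)%:E <=
  (expR 1)%:E * \int[lam]_(s in [set` i]) (G (s, y))%:E.
Proof.
move=> sg; wlog xx' : x x' / (x' <= x)%R.
  by move=> H xi x'i; have [/H|/ltW/H] := leP x' x; [exact|rewrite distrC; exact].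
move=> xi x'i; have [mG G0 loc] := sg.
have mGy : measurable_fun [set: measurableTypeR R] (fun s : R => G (s, y)).
  exact: measurable_section2.
apply: le_trans (@oscillation_le_integral R (fun s => g (s, y)) (fun s => G (s, y)) x' x xx' _ _ _) _.
- exact: measurable_funS mGy.
- by move=> s _; exact: G0.
- move=> s eps _ eps0; have [e e0 He] := loc (s, y) eps eps0; exists e => // t ts.
  have nE : (`|((t, y) : R * R) - (s, y)| = `|t - s|)%R.
    by rewrite prod_normE /= subrr normr0; apply/max_idPl.
  by have := He (t, y); rewrite nE; exact.
- apply: lee_wpmul2l; first by rewrite lee_fin expR_ge0.
  apply: ge0_subset_integral => //.
  + by apply/measurable_EFinP; exact: measurable_funS mGy.
  + by move=> s _; rewrite lee_fin.
  + move=> s; rewrite /= in_itv /= => /andP[s1 s2].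
    by apply: (@interval_is_interval _ i x' x) => //; rewrite s1.
Qed.

Lemma oscillation_ver g G (j : interval R) x y y' : slope_bound g G ->
  y \in j -> y' \in j ->
  (`|g (x, y) - g (x, y')|%R)%:E <=
  (expR 1)%:E * \int[lam]_(t in [set` j]) (G (x, t))%:E.
Proof.
move=> [mG G0 loc].
have swm : measurable_fun [set: plane R] (fun w : plane R => (w.2, w.1) : plane R).
  by apply: measurable_fun_pair; [exact: measurable_snd|exact: measurable_fst].
have sg' : slope_bound (fun w => g (w.2, w.1)) (fun w => G (w.2, w.1)).
  split=> [|//|w eps eps0]; first exact: (measurableT_comp mG swm).
  have [e e0 He] := loc (w.2, w.1) eps eps0; exists e => // w' ww'.
  have nE : (`|((w'.2, w'.1) : R * R) - (w.2, w.1)| = `|w' - w|)%R.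
    by rewrite !prod_normE /= maxC.
  by have := He (w'.2, w'.1); rewrite nE; exact.
exact: oscillation_hor sg'.
Qed.

Lemma integral_sqr_norm g : \int[mu]_z (g z ^+ 2)%:E = \int[mu]_z ((`|g z|%R)%:E * (`|g z|%R)%:E).
Proof. by apply: eq_integral => z _; rewrite -EFinM -normrM ger0_norm ?sqr_ge0// -expr2. Qed.

(** The Loomis-Whitney argument: [g] is bounded by the integral of its slope
    along each of the two coordinate lines through a point, and the product of
    the two bounds separates. *)
Lemma gagliardo_nirenberg g G : slope_bound g G ->
  (forall w, ~ sq (-1) (-1) 2 w -> g w = 0%R) ->
  \int[mu]_z (g z ^+ 2)%:E <=
  ((expR 1)%:E * \int[mu]_z (G z)%:E) * ((expR 1)%:E * \int[mu]_z (G z)%:E).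
Proof.
move=> sg supp; have [mG G0 loc] := sg.
pose Z : interval R := `]-oo, +oo[.
have ZT : [set` Z] = setT by rewrite /Z set_itvNyy.
have mGE : measurable_fun [set: plane R] (fun z => (G z)%:E) by exact/measurable_EFinP.
have GE0 (z : plane R) : 0 <= (G z)%:E by rewrite lee_fin.
pose A (y : R) := (expR 1)%:E * \int[lam]_x (G (x, y))%:E.
pose B (x : R) := (expR 1)%:E * \int[lam]_y (G (x, y))%:E.
have e0 : 0 <= (expR 1)%:E :> \bar R by rewrite lee_fin expR_ge0.
have A0 y : 0 <= A y by apply: mule_ge0 => //; apply: integral_ge0 => x _; rewrite lee_fin.
have B0 y : 0 <= B y by apply: mule_ge0 => //; apply: integral_ge0 => x _; rewrite lee_fin.
have mA : measurable_fun [set: measurableTypeR R] A.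
  by apply: measurable_funeM; have := @measurable_slice2 R _ Z mGE GE0; rewrite ZT.
have mB : measurable_fun [set: measurableTypeR R] B.
  by apply: measurable_funeM; have := @measurable_slice1 R _ Z mGE GE0; rewrite ZT.
(* The increments are taken from the point -2, which lies outside of the
   square, so that g vanishes there. *)
have gA x y : (`|g (x, y)|%R)%:E <= A y.
  have := @oscillation_hor g G Z x (-2)%R y sg; rewrite ZT !in_itv /= => /(_ isT isT).
  by rewrite [g (-2, y)%R]supp ?subr0// => /sqP[/=]; lra.
have gB x y : (`|g (x, y)|%R)%:E <= B x.
  have := @oscillation_ver g G Z x y (-2)%R sg; rewrite ZT !in_itv /= => /(_ isT isT).
  by rewrite [g (x, -2)%R]supp ?subr0// => /sqP[/=]; lra.
have ->  : (expR 1)%:E * \int[mu]_z (G z)%:E = \int[lam]_y A y.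
  rewrite -ge0_integralZl//.
  have := @tonelli_itv2 R (fun z => (expR 1)%:E * (G z)%:E) Z Z; rewrite ZT setXTT => ->.
  - by apply: eq_integral => y _; rewrite /A ge0_integralZl//; apply: measurable_section2 mGE.
  - exact: measurable_funeM.
  - by move=> z; rewrite mule_ge0.
have AB : \int[lam]_y A y = \int[lam]_x B x.
  have := @tonelli_itv2 R (fun z => (expR 1)%:E * (G z)%:E) Z Z; have := @tonelli_itv1 R (fun z => (expR 1)%:E * (G z)%:E) Z Z; rewrite ZT setXTT.
  have m1 : measurable_fun [set: plane R] (fun z : plane R => (expR 1)%:E * (G z)%:E).
    exact: measurable_funeM.
  have p1 (z : plane R) : 0 <= (expR 1)%:E * (G z)%:E by rewrite mule_ge0.
  move=> /(_ m1 p1) E1 /(_ m1 p1) E2.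
  transitivity (\int[mu]_z ((expR 1)%:E * (G z)%:E)).
    rewrite E2; apply: eq_integral => y _; rewrite /A ge0_integralZl//; apply: measurable_section2 mGE.
  rewrite E1; apply: eq_integral => y _; rewrite /B ge0_integralZl//; apply: measurable_section1 mGE.
rewrite integral_sqr_norm.
have mg := slope_bound_measurable sg.
have mag : measurable_fun [set: plane R] (fun z => (`|g z|%R)%:E * (`|g z|%R)%:E).
  by apply: emeasurable_funM; apply/measurable_EFinP; exact: measurableT_comp.
have ag0 (z : plane R) : 0 <= (`|g z|%R)%:E * (`|g z|%R)%:E by rewrite -EFinM lee_fin mulr_ge0.
have := @tonelli_itv1 R _ Z Z mag ag0; rewrite ZT setXTT => ->.
rewrite [X in X * _]AB -ge0_integralZr//; last by apply: integral_ge0.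
apply: ge0_le_integral => //.
- by move=> x _; apply: integral_ge0 => y _.
- by have := @measurable_slice1 R _ Z mag ag0; rewrite ZT.
- by apply: emeasurable_funM => //; exact: measurable_cst.
- move=> x _; rewrite -ge0_integralZl//.
  apply: ge0_le_integral => //.
  + exact: measurable_section1 mag.
  + exact: measurable_funeM.
  + by move=> y _; apply: lee_pmul.
Qed.

End gradient_inequalities.

(** * Moments of functions of finite energy *)

Section sobolev_square.
Variable R : realType.
Local Open Scope ereal_scope.
Local Notation mu := (lebesgue2 R).
Local Notation lam := (@lebesgue_measure R).
Implicit Types (g G : R * R -> R).
Local Notation e1 := (expR 1 : R).

(** A square containing the unit disc; all the functions on the disc are
    extended by 0 to the plane and treated as functions supported in it. *)
Definition ref_square : set (R * R) := sq (-1) (-1) 2.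

Lemma ref_square_measurable : measurable (ref_square : set (plane R)). Proof. exact: sq_measurable. Qed.

Lemma ref_square_area : mu ref_square = 4%:E.
Proof. by rewrite lebesgue2_sq//; congr EFin; ring. Qed.

Lemma integral_supported (d : measure_display) (T : measurableType d)
    (nu : {measure set T -> \bar R}) (D : set T) (f : T -> \bar R) :
  (forall x, ~ D x -> f x = 0) -> \int[nu]_x f x = \int[nu]_(x in D) f x.
Proof.
move=> fD; rewrite [RHS]integral_mkcond; apply: eq_integral => x _.
by rewrite patchE; case: ifPn => // /negP xD; apply: fD => Dx; apply: xD; exact: mem_set.
Qed.

(** Upper gradients are not unique, so only upper bounds of the energy make
    sense. *)
Definition energy_le (E : R) g := exists G, [/\ slope_bound g G,
  forall w, ~ ref_square w -> g w = 0%R, forall w, ~ ref_square w -> G w = 0%R &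
  \int[mu]_(z in ref_square) (G z ^+ 2)%:E <= E%:E].

Fixpoint moment_bound (E : R) (k : nat) : R :=
  if k is k'.+1 then ((e1 * (k%:R * ((moment_bound E k' + E) / 2))) ^+ 2)%R else 4.

Lemma moment_bound_ge0 E k : (0 <= moment_bound E k)%R.
Proof. by case: k => [|k] //=; exact: sqr_ge0. Qed.

(** [gagliardo_nirenberg] applied to [g ^+ k.+1], whose slope is [k.+1 * |g|
    ^+ k * G], bounds each even moment by the previous one and the energy. *)
Lemma moment_le E g k : energy_le E g ->
  \int[mu]_(z in ref_square) (g z ^+ (2 * k))%:E <= (moment_bound E k)%:E.
Proof.
move=> [G [sg gS GS GE]]; have mg := slope_bound_measurable sg; have [mG G0 _] := sg.
have mS := ref_square_measurable.
elim: k => [|k IH]; first by under eq_integral do rewrite expr0; rewrite integral_cst// mul1e ref_square_area.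
have := gagliardo_nirenberg (slope_bound_exp k sg) _.
rewrite [X in X <= _](@integral_supported _ (plane R) mu (ref_square : set (plane R))); last by move=> w /gS ->; rewrite !expr0n.
have -> : \int[mu]_z (k.+1%:R * `|g z| ^+ k * G z)%:E =
    \int[mu]_(z in ref_square) (k.+1%:R * `|g z| ^+ k * G z)%:E.
  by apply: integral_supported => w /GS ->; rewrite mulr0.
have gS' w : ~ ref_square w -> (g w ^+ k.+1 = 0)%R by move=> /gS ->; rewrite expr0n.
have -> : \int[mu]_(z in ref_square) (g z ^+ (2 * k.+1))%:E = \int[mu]_(z in ref_square) (g z ^+ k.+1 ^+ 2)%:E.
  by apply: eq_integral => z _; rewrite -exprM mulnC.
move=> /(_ gS')/le_trans; apply.
have h : (e1)%:E * \int[mu]_(z in ref_square) (k.+1%:R * `|g z| ^+ k * G z)%:E <=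
    (e1 * (k.+1%:R * ((moment_bound E k + E) / 2)))%:E.
  rewrite EFinM lee_pmul2l// ?lte_fin ?expR_gt0//.
  have mgk : measurable_fun ref_square (fun z => (g z ^+ (2 * k))%:E).
    by apply/measurable_EFinP/measurable_funX; exact: measurable_funS mg.
  have mG2 : measurable_fun ref_square (fun z => (G z ^+ 2)%:E).
    by apply/measurable_EFinP/measurable_funX; exact: measurable_funS mG.
  apply: (@le_trans _ _ (\int[mu]_(z in ref_square) ((k.+1%:R / 2)%:E * ((g z ^+ (2 * k))%:E + (G z ^+ 2)%:E)))).
    apply: ge0_le_integral => //.
    - by move=> z _; rewrite lee_fin mulr_ge0// mulr_ge0// exprn_ge0.
    - apply/measurable_EFinP; apply: measurable_funM; last exact: measurable_funS mG.
      by apply: measurable_funM => //; apply: measurable_funX; apply: measurableT_comp => //; exact: measurable_funS mg.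
    - by apply: measurable_funeM; exact: emeasurable_funD.
    - move=> z _; rewrite -EFinD -EFinM lee_fin -mulrA -[leRHS]mulrA ler_wpM2l//.
      have -> : (g z ^+ (2 * k) = (`|g z| ^+ k) ^+ 2)%R.
        by rewrite exprM -real_normK ?num_real// -!exprM mulnC.
      by have := sqr_ge0 (`|g z| ^+ k - G z)%R; rewrite sqrrB; nra.
  have p1 z : ref_square z -> 0 <= (g z ^+ (2 * k))%:E by move=> _; rewrite lee_fin exprM exprn_ge0// sqr_ge0.
  have p2 z : ref_square z -> 0 <= (G z ^+ 2)%:E by move=> _; rewrite lee_fin sqr_ge0.
  rewrite ge0_integralZl//; last 2 first.
  - exact: emeasurable_funD.
  - by move=> z Sz; rewrite adde_ge0 ?p1 ?p2.
  rewrite ge0_integralD//.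
  have -> : (k.+1%:R * ((moment_bound E k + E) / 2))%:E = (k.+1%:R / 2)%:E * ((moment_bound E k)%:E + E%:E).
    by rewrite -EFinD -EFinM; congr EFin; field.
  by apply: lee_wpmul2l; [rewrite lee_fin divr_ge0|exact: leeD].
have i0 : 0 <= (e1)%:E * \int[mu]_(z in ref_square) (k.+1%:R * `|g z| ^+ k * G z)%:E.
  rewrite mule_ge0 ?lee_fin ?expR_ge0// integral_ge0// => z _.
  by rewrite lee_fin mulr_ge0// mulr_ge0// exprn_ge0.
by rewrite [leRHS]/= expr2 EFinM; apply: lee_pmul.
Qed.

Lemma energy_ge0 E g : energy_le E g -> (0 <= E)%R.
Proof.
move=> [G [_ _ _]]; rewrite -lee_fin; apply: le_trans; apply: integral_ge0 => z _.
by rewrite lee_fin sqr_ge0.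
Qed.

(** Friedrichs' inequality: [gagliardo_nirenberg] for [g] itself, and the
    Cauchy-Schwarz inequality on the square. *)
Lemma sqr_norm_le E g : energy_le E g ->
  \int[mu]_(z in ref_square) (g z ^+ 2)%:E <= (4 * e1 ^+ 2 * E)%:E.
Proof.
move=> [G [sg gS GS GE]]; have [mG G0 _] := sg; have mS := ref_square_measurable.
rewrite -(@integral_supported _ (plane R) mu (ref_square : set (plane R))); last by move=> w /gS ->; rewrite expr0n.
apply: le_trans (gagliardo_nirenberg sg gS) _.
rewrite (@integral_supported _ (plane R) mu (ref_square : set (plane R))); last by move=> w /GS ->.
rewrite muleACA -EFinM -expr2.
have c4 : (0 < 4 :> R)%R by [].
have h := @sqr_integral_le R _ _ mu ref_square G 4 mS ref_square_area c4 (measurable_funS measurableT (@subsetT _ _) mG) (fun x _ => G0 x).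
apply: (@le_trans _ _ ((e1 ^+ 2)%:E * (4%:E * E%:E))).
  apply: lee_wpmul2l; first by rewrite lee_fin sqr_ge0.
  by apply: le_trans h _; apply: lee_wpmul2l.
by rewrite -!EFinM lee_fin le_eqVlt; apply/orP; left; apply/eqP; ring.
Qed.

End sobolev_square.

(** * Poincare's inequality *)

Section poincare.
Variable R : realType.
Local Open Scope ereal_scope.
Local Notation mu := (lebesgue2 R).
Local Notation lam := (@lebesgue_measure R).
Implicit Types (g G : R * R -> R).
Local Notation e1 := (expR 1 : R).

Lemma integral_cstE (d : measure_display) (T : measurableType d)
    (nu : {measure set T -> \bar R}) (D : set T) (r c : \bar R) :
  measurable D -> nu D = c -> \int[nu]_(x in D) r = r * c.
Proof. by move=> mD <-; rewrite integral_cst. Qed.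

(** On a small square the energy is multiplied by the small factor [l ^+ 2],
    so that the L2-norm is controlled by the mean. *)
Lemma poincare_square g G a b l : slope_bound g G -> (0 < l)%R ->
  mu.-integrable (sq a b l) (EFin \o g) ->
  \int[mu]_(z in sq a b l) (g z ^+ 2)%:E <=
  (6 * e1 ^+ 2 * l ^+ 2)%:E * \int[mu]_(z in sq a b l) (G z ^+ 2)%:E +
  (3 * l ^- 2 * (fine (\int[mu]_(z in sq a b l) (g z)%:E)) ^+ 2)%:E.
Proof.
move=> sg l0 ig; have [mG G0 _] := sg; have mg := slope_bound_measurable sg.
pose I : interval R := `[a, (a + l)%R[; pose J : interval R := `[b, (b + l)%R[.
pose Q : set (plane R) := sq a b l.
have mQ : measurable Q by exact: sq_measurable.
have muQ : mu Q = (l ^+ 2)%:E by rewrite lebesgue2_sq// ltW.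
have mI : measurable ([set` I] : set (measurableTypeR R)) by exact: measurable_itv.
have mJ : measurable ([set` J] : set (measurableTypeR R)) by exact: measurable_itv.
have lamI : lam [set` I] = l%:E.
  by rewrite lebesgue_measure_itv /= lte_fin ltrDl l0 -EFinB; congr EFin; ring.
have lamJ : lam [set` J] = l%:E.
  by rewrite lebesgue_measure_itv /= lte_fin ltrDl l0 -EFinB; congr EFin; ring.
have mGE : measurable_fun [set: plane R] (fun z => (G z)%:E) by exact/measurable_EFinP.
have mG2 : measurable_fun [set: plane R] (fun z => (G z ^+ 2)%:E).
  by apply/measurable_EFinP; exact: measurable_funX.
have G2E0 (z : plane R) : 0 <= (G z ^+ 2)%:E by rewrite lee_fin sqr_ge0.
have GE0 (z : plane R) : 0 <= (G z)%:E by rewrite lee_fin.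
pose H y := \int[lam]_(x in [set` I]) (G (x, y))%:E.
pose K x := \int[lam]_(y in [set` J]) (G (x, y))%:E.
have H0 y : 0 <= H y by apply: integral_ge0 => x _.
have K0 x : 0 <= K x by apply: integral_ge0 => x' _.
have mH : measurable_fun [set: measurableTypeR R] H by exact: (@measurable_slice2 R _ I mGE GE0).
have mK : measurable_fun [set: measurableTypeR R] K by exact: (@measurable_slice1 R _ J mGE GE0).
have mHz : measurable_fun [set: plane R] (fun z => H z.2).
  exact: (measurableT_comp mH (@measurable_snd _ _ (measurableTypeR R) (measurableTypeR R))).
have mKz : measurable_fun [set: plane R] (fun z => K z.1).
  exact: (measurableT_comp mK (@measurable_fst _ _ (measurableTypeR R) (measurableTypeR R))).
pose T := \int[mu]_(z in Q) (G z)%:E.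
pose m := fine (\int[mu]_(z in Q) (g z)%:E).
have mfin : \int[mu]_(z in Q) (g z)%:E = m%:E.
  by rewrite /m fineK//; exact: integrable_fin_num.
have T0 : 0 <= T by apply: integral_ge0.
have e0 : 0 <= e1%:E by rewrite lee_fin expR_ge0.
pose E := \int[mu]_(z in Q) (G z ^+ 2)%:E.
have E0 : 0 <= E by apply: integral_ge0.
have mgs := measurable_funS measurableT (@subsetT _ Q) mg.
(* The increment from z to w is taken along a horizontal segment, then a
   vertical one. Integrated over w, this compares g z with the mean. *)
have pt z : Q z -> (l ^+ 2)%:E * (`|g z|%R)%:E <=
    (`|m|%R)%:E + e1%:E * (l ^+ 2)%:E * H z.2 + e1%:E * l%:E * T.
  move=> Qz.
  have ic : mu.-integrable Q (EFin \o cst (g z)).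
    apply: measurable_bounded_integrable => //; first by rewrite muQ ltry.
    by exists `|g z|%R; split; [exact: num_real|move=> M ltM w _; exact: ltW].
  have idf : mu.-integrable Q (fun w => (g z)%:E - (g w)%:E) by exact: integrableB.
  have mdf : measurable_fun Q (fun w => (g z)%:E - (g w)%:E) by exact: measurable_int idf.
  have E1 : (g z)%:E * (l ^+ 2)%:E = m%:E + \int[mu]_(w in Q) ((g z)%:E - (g w)%:E).
    rewrite -mfin -(integralD mQ ig idf).
    rewrite -muQ -integral_cst//; apply: eq_integral => w _ /=.
    by rewrite -EFinB -EFinD; congr EFin; ring.
  have -> : (l ^+ 2)%:E * (`|g z|%R)%:E = `| (g z)%:E * (l ^+ 2)%:E |.
    by rewrite -!EFinM abse_EFin normrM (ger0_norm (sqr_ge0 _)) mulrC.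
  rewrite E1 (le_trans (lee_abs_add _ _))// -addeA leeD//.
  apply: (le_trans (le_abse_integral _ _ _)) => //.
  apply: (@le_trans _ _ (\int[mu]_(w in Q) (e1%:E * H z.2 + e1%:E * K w.1))).
    apply: ge0_le_integral => //.
    - exact: measurableT_comp mdf.
    - apply: emeasurable_funD; first exact: measurable_cst.
      by apply: measurable_funeM; exact: measurable_funS mKz.
    - move=> w Qw; rewrite -EFinB abse_EFin.
      have [zI zJ] : z.1 \in I /\ z.2 \in J by case: Qz.
      have [wI wJ] : w.1 \in I /\ w.2 \in J by case: Qw.
      have h1 := @oscillation_hor R g G I z.1 w.1 z.2 sg zI wI.
      have h2 := @oscillation_ver R g G J w.1 z.2 w.2 sg zJ wJ.
      apply: le_trans (leeD h1 h2); rewrite -EFinD lee_fin.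
      by rewrite -!surjective_pairing; exact: ler_distD.
  have q1 w : Q w -> 0 <= e1%:E * H z.2 by move=> _; rewrite mule_ge0.
  have q2 : measurable_fun Q (fun _ : plane R => e1%:E * H z.2) by exact: measurable_cst.
  have q3 w : Q w -> 0 <= e1%:E * K w.1 by move=> _; rewrite mule_ge0.
  have q5 : measurable_fun Q (fun w => K w.1) by exact: measurable_funS mKz.
  have q4 : measurable_fun Q (fun w => e1%:E * K w.1) by exact: measurable_funeM.
  rewrite (ge0_integralD _ mQ q1 q2 q3 q4).
  rewrite (integral_cstE _ mQ muQ) muleAC (ge0_integralZl _ mQ q5 (fun w _ => K0 w.1) e0).
  rewrite leeD2l// -muleA lee_wpmul2l//.
  rewrite [leLHS](@tonelli_itv2 R (fun w => K w.1) I J mKz (fun w => K0 w.1)) /=.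
  rewrite (integral_cstE _ mJ lamJ) muleC lee_wpmul2l ?lee_fin ?(ltW l0)//.
  by rewrite /T [leRHS](@tonelli_itv1 R _ I J mGE GE0).
have HI : \int[mu]_(z in Q) (H z.2 * H z.2) <= (l ^+ 2)%:E * E.
  rewrite [leLHS](@tonelli_itv1 R (fun w => H w.2 * H w.2) I J) /=; last 2 first.
  - exact: emeasurable_funM.
  - by move=> z; rewrite mule_ge0.
  rewrite (integral_cstE _ mI lamI) /E [\int[mu]_(z in Q) _](@tonelli_itv2 R _ I J mG2 G2E0).
  rewrite expr2 EFinM -muleA muleC lee_wpmul2l ?lee_fin ?(ltW l0)//.
  have mI2 : measurable_fun [set` J] (fun y => \int[lam]_(x in [set` I]) (G (x, y) ^+ 2)%:E).
    by apply: measurable_funS (measurable_slice2 _ mG2 G2E0).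
  have pI2 y : 0 <= \int[lam]_(x in [set` I]) (G (x, y) ^+ 2)%:E by apply: integral_ge0.
  rewrite -ge0_integralZl// ?lee_fin ?(ltW l0)//.
  have mH' : measurable_fun [set` J] H by exact: measurable_funS mH.
  apply: ge0_le_integral => //.
  - by move=> y _; rewrite mule_ge0.
  - exact: emeasurable_funM.
  - exact: measurable_funeM.
  - move=> y _; apply: sqr_integral_le => //.
    by apply: measurable_funS (measurable_section2 _ mG).
have TI : T * T <= (l ^+ 2)%:E * E.
  apply: sqr_integral_le => //; first by rewrite exprn_gt0.
  exact: measurable_funS mG.
rewrite -/Q -/E -/m.
have [Efin|] := boolP (E \is a fin_num); last first.
  rewrite ge0_fin_numE// -leNgt leye_eq => /eqP ->.
  by rewrite gt0_muley ?lte_fin ?mulr_gt0 ?exprn_gt0 ?expR_gt0// addye ?leey.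
have key : (l ^+ 4)%:E * \int[mu]_(z in Q) (g z ^+ 2)%:E <=
    3%:E * ((m ^+ 2 * l ^+ 2)%:E + (e1 ^+ 2 * l ^+ 6)%:E * E + (e1 ^+ 2 * l ^+ 6)%:E * E).
  have mg2 : measurable_fun Q (fun z => (g z ^+ 2)%:E).
    by apply/measurable_EFinP; exact: measurable_funX.
  have g20 z : Q z -> 0 <= (g z ^+ 2)%:E by move=> _; rewrite lee_fin sqr_ge0.
  have l40 : 0 <= (l ^+ 4)%:E by rewrite lee_fin exprn_ge0// ltW.
  rewrite -(ge0_integralZl _ mQ mg2 g20 l40).
  pose A (z : plane R) := (`|m|%R)%:E * (`|m|%R)%:E
     + (e1%:E * (l ^+ 2)%:E * H z.2) * (e1%:E * (l ^+ 2)%:E * H z.2)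
     + (e1%:E * l%:E * T) * (e1%:E * l%:E * T).
  have el0 : 0 <= e1%:E * l%:E by rewrite mule_ge0// lee_fin ltW.
  have el20 : 0 <= e1%:E * (l ^+ 2)%:E by rewrite mule_ge0// lee_fin sqr_ge0.
  have mHe : measurable_fun Q (fun z => e1%:E * (l ^+ 2)%:E * H z.2).
    by apply: measurable_funeM; exact: measurable_funS mHz.
  have mHe2 : measurable_fun Q (fun z => (e1%:E * (l ^+ 2)%:E * H z.2) * (e1%:E * (l ^+ 2)%:E * H z.2)).
    exact: emeasurable_funM.
  have mA1 : measurable_fun Q (fun z => (`|m|%R)%:E * (`|m|%R)%:E
     + (e1%:E * (l ^+ 2)%:E * H z.2) * (e1%:E * (l ^+ 2)%:E * H z.2)).
    by apply: emeasurable_funD => //; exact: measurable_cst.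
  have mA : measurable_fun Q A.
    by apply: emeasurable_funD => //; exact: measurable_cst.
  have a10 : 0 <= (`|m|%R)%:E * (`|m|%R)%:E :> \bar R by rewrite -EFinM lee_fin mulr_ge0.
  have a20 z : 0 <= (e1%:E * (l ^+ 2)%:E * H z) * (e1%:E * (l ^+ 2)%:E * H z).
    by rewrite mule_ge0// mule_ge0.
  have a30 : 0 <= (e1%:E * l%:E * T) * (e1%:E * l%:E * T) by rewrite mule_ge0// mule_ge0.
  apply: (@le_trans _ _ (\int[mu]_(z in Q) (3%:E * A z))).
    apply: ge0_le_integral => //.
    - by move=> z _; rewrite -EFinM lee_fin mulr_ge0 ?sqr_ge0// exprn_ge0// ltW.
    - exact: measurable_funeM.
    - exact: measurable_funeM.
    - move=> z Qz; have -> : (l ^+ 4)%:E * (g z ^+ 2)%:E =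
        ((l ^+ 2)%:E * (`|g z|%R)%:E) * ((l ^+ 2)%:E * (`|g z|%R)%:E).
        rewrite -!EFinM; congr EFin; rewrite -[(g z ^+ 2)%R]real_normK ?num_real//; ring.
      apply: (le_trans (lee_pmul _ _ (pt z Qz) (pt z Qz))).
      + by rewrite -EFinM lee_fin mulr_ge0// sqr_ge0.
      + by rewrite -EFinM lee_fin mulr_ge0// sqr_ge0.
      by apply: sqr_add3_le; [rewrite lee_fin|exact: mule_ge0|exact: mule_ge0].
  have A0 z : 0 <= A z by rewrite /A !adde_ge0.
  rewrite ge0_integralZl//; apply: lee_wpmul2l => //.
  rewrite /A (ge0_integralD _ mQ _ mA1 (fun z _ => a30)); last 2 first.
  - by move=> z _; rewrite adde_ge0.
  - exact: measurable_cst.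
  rewrite (ge0_integralD _ mQ (fun z _ => a10) _ (fun z _ => a20 z.2) mHe2); last exact: measurable_cst.
  rewrite !(integral_cstE _ mQ muQ); apply: leeD; first apply: leeD.
  - by rewrite -!EFinM lee_fin -normrM ger0_norm ?sqr_ge0 -?expr2.
  - under eq_integral do rewrite muleACA.
    have mHH : measurable_fun Q (fun z => H z.2 * H z.2).
      by apply: emeasurable_funM; exact: measurable_funS mHz.
    have HH0 (z : plane R) : Q z -> 0 <= H z.2 * H z.2 by move=> _; rewrite mule_ge0.
    rewrite (ge0_integralZl _ mQ mHH HH0); last by rewrite mule_ge0.
    apply: (le_trans (lee_wpmul2l _ HI)); first by rewrite mule_ge0.
    rewrite muleA -!EFinM; apply: lee_wpmul2r => //.
    by rewrite lee_fin le_eqVlt; apply/orP; left; apply/eqP; ring.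
  - rewrite [X in X * _]muleACA [leLHS]muleAC; apply: (le_trans (lee_wpmul2l _ TI)).
      by rewrite -!EFinM lee_fin !mulr_ge0 ?sqr_ge0 ?expR_ge0 ?(ltW l0)//.
    rewrite muleA -!EFinM; apply: lee_wpmul2r => //.
    by rewrite lee_fin le_eqVlt; apply/orP; left; apply/eqP; ring.
have l40 : (0 < l ^+ 4)%R by rewrite exprn_gt0.
rewrite -(@lee_pmul2l _ (l ^+ 4)%:E)// (le_trans key)//.
rewrite -(fineK Efin) -!EFinM lee_fin.
rewrite le_eqVlt; apply/orP; left; apply/eqP; field; rewrite gt_eqF//.
Qed.

End poincare.

(** * Rellich's theorem on a square *)

Section precompactness.
Variable R : realType.
Local Open Scope ereal_scope.
Local Notation mu := (lebesgue2 R).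
Implicit Types (g G : R * R -> R).
Local Notation e1 := (expR 1 : R).

Fixpoint subsquares (j : nat) (a b s : R) : seq (R * R * R) :=
  if j is j'.+1 then
    (subsquares j' a b (s / 2) ++ subsquares j' (a + s / 2) b (s / 2)) ++
    (subsquares j' a (b + s / 2) (s / 2) ++ subsquares j' (a + s / 2) (b + s / 2) (s / 2))
  else [:: (a, b, s)].

Definition square_of (q : R * R * R) : set (plane R) := sq q.1.1 q.1.2 q.2.

Lemma integral_subsquares (f : plane R -> \bar R) j a b s : (0 < s)%R ->
  measurable_fun [set: plane R] f -> (forall z, 0 <= f z) ->
  \int[mu]_(z in sq a b s) f z =
  \sum_(q <- subsquares j a b s) \int[mu]_(z in square_of q) f z.
Proof.
move=> + mf f0; elim: j a b s => [|j IH] a b s s0; first by rewrite /= big_seq1.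
have s20 : (0 < s / 2)%R by rewrite divr_gt0.
by rewrite /= !big_cat /= -!IH//; exact: integral_sq_quarters.
Qed.

Lemma subsquares_side j a b s q : (0 < s)%R -> q \in subsquares j a b s ->
  q.2 = (s / 2 ^+ j)%R /\ square_of q `<=` sq a b s.
Proof.
elim: j a b s => [|j IH] a b s s0 /=.
  by rewrite inE => /eqP -> /=; rewrite expr0 divr1; split.
have s20 : (0 < s / 2)%R by rewrite divr_gt0.
have [sE _ _ _] := sq_split a b s0.
have -> : (s / 2 ^+ j.+1 = s / 2 / 2 ^+ j)%R by rewrite exprS invfM mulrA.
rewrite !mem_cat => /orP[/orP[]|/orP[]] /(IH _ _ _ s20)[-> h]; split=> //; rewrite sE => z /h zq.
- by left; left.
- by left; right.
- by right; left.
- by right; right.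
Qed.

Lemma energy_integrable E g (D : set (plane R)) : energy_le E g -> measurable D -> D `<=` @ref_square R ->
  mu.-integrable D (EFin \o g) /\
  (`|fine (\int[mu]_(z in D) (g z)%:E)| <= 4 + 4 * e1 ^+ 2 * E)%R.
Proof.
move=> Eg mD DS; have mS := @ref_square_measurable R.
have mg : measurable_fun [set: plane R] g by have [G [sg _ _ _]] := Eg; exact: slope_bound_measurable sg.
have mgS := measurable_funS measurableT (@subsetT _ (@ref_square R)) mg.
have mgD := measurable_funS measurableT (@subsetT _ D) mg.
have le1 : \int[mu]_(z in @ref_square R) (`|g z|%R)%:E <= (4 + 4 * e1 ^+ 2 * E)%:E.
  apply: (@le_trans _ _ (\int[mu]_(z in @ref_square R) (1 + (g z ^+ 2)%:E))).
    apply: ge0_le_integral => //.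
    - by apply/measurable_EFinP; exact: measurableT_comp.
    - by apply: emeasurable_funD; [exact: measurable_cst|apply/measurable_EFinP; exact: measurable_funX].
    - move=> z _; rewrite -EFinD lee_fin -[(g z ^+ 2)%R]real_normK ?num_real//.
      by have := sqr_ge0 (`|g z| - 1)%R; have := normr_ge0 (g z); nra.
  have g20 z : @ref_square R z -> 0 <= (g z ^+ 2)%:E by move=> _; rewrite lee_fin sqr_ge0.
  have mg2 : measurable_fun (@ref_square R) (fun z => (g z ^+ 2)%:E).
    by apply/measurable_EFinP; exact: measurable_funX.
  have c0 z : @ref_square R z -> 0 <= (1 : \bar R) by [].
  rewrite (ge0_integralD _ mS c0 (measurable_cst _) g20 mg2).
  rewrite (integral_cstE _ mS (ref_square_area R)) mul1e [leRHS]EFinD leeD2l//.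
  exact: sqr_norm_le.
have le2 : \int[mu]_(z in D) `|(g z)%:E| <= (4 + 4 * e1 ^+ 2 * E)%:E.
  apply: le_trans le1; apply: ge0_subset_integral => //.
  by apply/measurable_EFinP; exact: measurableT_comp.
have ig : mu.-integrable D (EFin \o g).
  apply/integrableP; split; first exact/measurable_EFinP.
  by apply: le_lt_trans le2 _; rewrite ltry.
split=> //; rewrite -lee_fin -abse_EFin fineK; last exact: integrable_fin_num.
apply: le_trans le2; apply: le_abse_integral => //; exact/measurable_EFinP.
Qed.

Lemma poincare_subsquares E g j : energy_le E g ->
  \int[mu]_(z in @ref_square R) (g z ^+ 2)%:E <=
  (6 * e1 ^+ 2 * (2 / 2 ^+ j) ^+ 2 * E)%:E +
  \sum_(q <- subsquares j (-1) (-1) 2)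
    (3 * (2 / 2 ^+ j) ^- 2 * (fine (\int[mu]_(z in square_of q) (g z)%:E)) ^+ 2)%:E.
Proof.
move=> Eg; have [G [sg gS GS GE]] := Eg; have [mG G0 _] := sg.
have mg := slope_bound_measurable sg.
have l0 : (0 < 2 / 2 ^+ j :> R)%R by rewrite divr_gt0// exprn_gt0.
have s20 : (0 < 2 :> R)%R by [].
have mg2 : measurable_fun [set: plane R] (fun z => (g z ^+ 2)%:E).
  by apply/measurable_EFinP; exact: measurable_funX.
have mG2 : measurable_fun [set: plane R] (fun z => (G z ^+ 2)%:E).
  by apply/measurable_EFinP; exact: measurable_funX.
have p1 (z : plane R) : 0 <= (g z ^+ 2)%:E by rewrite lee_fin sqr_ge0.
have p2 (z : plane R) : 0 <= (G z ^+ 2)%:E by rewrite lee_fin sqr_ge0.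
rewrite /ref_square (integral_subsquares j _ _ s20 mg2 p1).
have c0 : 0 <= (6 * e1 ^+ 2 * (2 / 2 ^+ j) ^+ 2)%:E :> \bar R.
  by rewrite lee_fin mulr_ge0// ?sqr_ge0// mulr_ge0// sqr_ge0.
apply: (@le_trans _ _ ((6 * e1 ^+ 2 * (2 / 2 ^+ j) ^+ 2)%:E * \int[mu]_(z in @ref_square R) (G z ^+ 2)%:E +
  \sum_(q <- subsquares j (-1) (-1) 2)
    (3 * (2 / 2 ^+ j) ^- 2 * (fine (\int[mu]_(z in square_of q) (g z)%:E)) ^+ 2)%:E)).
  rewrite {1}/ref_square (integral_subsquares j _ _ s20 mG2 p2).
  rewrite ge0_sume_distrr; last by move=> q _; apply: integral_ge0.
  rewrite -big_split /= big_seq [leRHS]big_seq; apply: lee_sum => q qj.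
  have [q2 qS] := subsquares_side s20 qj.
  rewrite -q2; apply: poincare_square => //; first by rewrite q2.
  by have [] := energy_integrable Eg (sq_measurable _ _ _) qS.
by rewrite [(_ * E)%:E]EFinM leeD2r// lee_wpmul2l.
Qed.

(** A bounded sequence converges along an ultrafilter, by compactness of the
    intervals. Ultrafilters make successive extractions of subsequences
    unnecessary. *)
Lemma ultra_cauchy (F : set_system nat) (u : nat -> R) (B d : R) : UltraFilter F ->
  (forall n, (`|u n| <= B)%R) -> (0 < d)%R ->
  exists2 A, F A & forall n m, A n -> A m -> (`|u n - u m| <= d)%R.
Proof.
move=> UF uB d0.
have FF : ProperFilter (u @ F) by exact: fmap_proper_filter.
have [|p [_ clp]] := @segment_compact R (- B)%R B (u @ F) FF.
  by rewrite /fmap /=; apply: filterS filterT => n _; rewrite /= in_itv /= -ler_norml.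
pose A : set nat := [set n | (`|p - u n| < d / 2)%R].
exists A; last first.
  move=> n m; rewrite /A /= => nA mA; apply: le_trans (ler_distD p _ _) _.
  by rewrite distrC [leRHS]splitr lerD// ltW.
have [//|FA] := in_ultra_setVsetC A UF.
have d20 : (0 < d / 2)%R by rewrite divr_gt0.
have [y [[n nA <-] py]] := clp (u @` (~` A)) (ball p (d / 2))%R
  (filterS (@preimage_image _ _ u (~` A)) FA) (nbhsx_ballx _ _ d20).
by exfalso; apply: nA.
Qed.

(** Along an ultrafilter the means over the finitely many squares of a fine
    subdivision converge simultaneously, and Poincare's inequality controls
    the rest. *)
Lemma rellich (F : set_system nat) (E eps : R) (g : nat -> R * R -> R) :
  UltraFilter F ->
  (forall n, energy_le E (g n)) ->
  (forall n m, energy_le E (fun z => g n z - g m z)%R) -> (0 < eps)%R ->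
  exists2 A, F A & forall n m, A n -> A m ->
    \int[mu]_(z in @ref_square R) ((g n z - g m z) ^+ 2)%:E <= eps%:E.
Proof.
move=> UF Eg Egg eps0.
have E0 := energy_ge0 (Eg 0%N).
have [j Hj] : exists j : nat, (6 * e1 ^+ 2 * (2 / 2 ^+ j) ^+ 2 * E <= eps / 2)%R.
  have c0 : (0 < 6 * e1 ^+ 2 * 4 * E + 1)%R.
    by rewrite ltr_wpDl// mulr_ge0// mulr_ge0// mulr_ge0// sqr_ge0.
  pose c := (6 * e1 ^+ 2 * 4 * E + 1)%R.
  have /cvgrPdist_lt/(_ (eps / 2 / c)%R) : (2^-1 ^+ n : R)%R @[n --> \oo] --> (0 : R)%R.
    by apply: cvg_expr; rewrite ger0_norm ?invr_ge0// invf_lt1// ltr1n.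
  rewrite !divr_gt0// => /(_ isT)[N _ /(_ N (leqnn _))]; rewrite /= sub0r normrN => h.
  exists N; have q0 : (0 <= 2^-1 ^+ N :> R)%R by rewrite exprn_ge0.
  have q1 : (2^-1 ^+ N <= 1 :> R)%R by rewrite exprn_ile1// invf_le1// ler1n.
  rewrite ger0_norm// in h.
  rewrite ltr_pdivlMr// in h.
  have -> : (6 * e1 ^+ 2 * (2 / 2 ^+ N) ^+ 2 * E = (6 * e1 ^+ 2 * 4 * E) * (2^-1 ^+ N * 2^-1 ^+ N))%R.
    by rewrite -exprVn; ring.
  apply: le_trans (ltW h); rewrite /c mulrC.
  have k0 : (0 <= 6 * e1 ^+ 2 * 4 * E)%R by rewrite mulr_ge0// mulr_ge0// mulr_ge0// sqr_ge0.
  set k := (6 * _ * _ * _)%R in k0 *; set q := (_ ^+ N)%R in q0 q1 *.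
  by rewrite -mulrA ler_wpM2l//; nra.
pose L := subsquares j (-1 : R)%R (-1 : R)%R (2 : R)%R.
pose l2 : R := (3 * (2 / 2 ^+ j) ^- 2)%R.
have l20 : (0 < l2)%R by rewrite mulr_gt0// invr_gt0 exprn_gt0// divr_gt0// exprn_gt0.
pose N : R := (size L).+1%:R.
have N0 : (0 < N)%R by rewrite ltr0n.
pose I q n := fine (\int[mu]_(z in square_of q) (g n z)%:E).
have d0 : (0 < Num.sqrt (eps / 2 / N / l2))%R by rewrite sqrtr_gt0 !divr_gt0.
have qS q : q \in L -> square_of q `<=` @ref_square R by move=> /subsquares_side[].
have step (L' : seq (R * R * R)) : {subset L' <= L} -> exists2 A, F A & forall n m, A n -> A m ->
    forall q, q \in L' -> (`|I q n - I q m| <= Num.sqrt (eps / 2 / N / l2))%R.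
  elim: L' => [_|q L' IH sub]; first by exists setT => //; exact: filterT.
  have [|A FA HA] := IH; first by move=> x xL; apply: sub; rewrite inE xL orbT.
  have qL : q \in L by apply: sub; rewrite mem_head.
  have [|B FB HB] := @ultra_cauchy F (I q) (4 + 4 * e1 ^+ 2 * E)%R _ UF _ d0.
    by move=> n; have [] := energy_integrable (Eg n) (sq_measurable _ _ _) (qS _ qL).
  exists (A `&` B); first exact: filterI.
  move=> n m [An Bn] [Am Bm] q'; rewrite inE => /predU1P[->|q'L]; first exact: HB.
  exact: HA.
have [A FA HA] := step L (fun x => id).
exists A => // n m An Am.
apply: le_trans (poincare_subsquares j (Egg n m)) _.
rewrite [eps]splitr EFinD; apply: leeD; first by rewrite lee_fin.
apply: (@le_trans _ _ (\sum_(q <- L) (eps / 2 / N)%:E)).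
  rewrite big_seq [leRHS]big_seq; apply: lee_sum => q qL; rewrite lee_fin.
  have ii k := (energy_integrable (Eg k) (sq_measurable _ _ _) (qS _ qL)).1.
  have -> : fine (\int[mu]_(z in square_of q) (g n z - g m z)%:E) = (I q n - I q m)%R.
    have := integralB_EFin (sq_measurable q.1.1 q.1.2 q.2) (ii n) (ii m).
    have fi k : \int[mu]_(z in square_of q) (g k z)%:E \is a fin_num.
      by apply: integrable_fin_num (ii k); exact: sq_measurable.
    by rewrite /= => ->; rewrite fineB//; exact: fi.
  have := HA _ _ An Am q qL; set x := (I q n - I q m)%R => hx.
  rewrite -/l2 -ler_pdivlMl// mulrC -[leLHS]real_normK ?num_real//.
  rewrite -[leRHS]sqr_sqrtr; last by rewrite !divr_ge0 ?ltW.
  by rewrite ler_pXn2r ?nnegrE// ltW.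
rewrite sumEFin lee_fin big_const_seq count_predT iter_addr addr0 -[leLHS]mulr_natr.
by rewrite mulrAC ler_pdivrMr// ler_wpM2l ?divr_ge0 ?(ltW eps0)// ler_nat.
Qed.

End precompactness.

(** * Interpolation between moments *)

Section interpolation.
Variable R : realType.
Local Notation mu := (lebesgue2 R).
Implicit Types (g G : R * R -> R).
Local Notation e1 := (expR 1 : R).

(** Write [x `^ r] as [x * x `^ (r - 1)] and use the inequality between the
    arithmetic and geometric means with weight [t]: the power [r] is
    interpolated between the square, which is small with a large coefficient,
    and a high moment, which is bounded with a small one. *)
Lemma powR_young (x r t : R) (k : nat) : 0 <= x -> 1 <= r -> r - 1 <= k%:R -> 0 < t ->
  x `^ r <= (2 * t)^-1 * x ^+ 2 + t / 2 * (1 + x ^+ (2 * k)).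
Proof.
move=> x0 r1 rk t0.
have [->|xN0] := eqVneq x 0.
  rewrite powR0; last by rewrite gt_eqF// (lt_le_trans ltr01).
  by rewrite expr0n mulr0 add0r mulr_ge0// ?divr_ge0 ?(ltW t0)// addr_ge0// exprn_ge0.
have xp : 0 < x by rewrite lt_neqAle eq_sym xN0.
have -> : x `^ r = x * x `^ (r - 1).
  by rewrite -{2}[x]powRr1// -powRD ?xN0 ?implybT// addrC subrK.
set y := x `^ (r - 1).
have y0 : 0 <= y by exact: powR_ge0.
have y2 : y ^+ 2 <= 1 + x ^+ (2 * k).
  rewrite mulnC exprM.
  have xk0 : 0 <= (x ^+ k) by exact: exprn_ge0.
  have [x1|x1] := leP x 1.
    have : y <= 1.
      have := @ge0_ler_powR R (r - 1) _ x 1; rewrite powR1 !nnegrE subr_ge0.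
      by apply.
    by move=> yle; have := sqr_ge0 (x ^+ k); nra.
  have yx : y <= x ^+ k.
    by rewrite -powR_mulrn// /y; apply: ler_powR => //; exact: ltW.
  have : y ^+ 2 <= (x ^+ k) ^+ 2 by rewrite ler_pXn2r ?nnegrE.
  by lra.
apply: (@le_trans _ _ ((2 * t)^-1 * x ^+ 2 + t / 2 * y ^+ 2)); last first.
  by rewrite lerD2l ler_wpM2l// divr_ge0// ltW.
rewrite -subr_ge0.
have -> : (2 * t)^-1 * x ^+ 2 + t / 2 * y ^+ 2 - x * y = (2 * t)^-1 * (x - t * y) ^+ 2.
  by field; rewrite gt_eqF.
by rewrite mulr_ge0// ?sqr_ge0// invr_ge0 mulr_ge0// ltW.
Qed.

Local Open Scope ereal_scope.

Definition moment_order (r : R) : nat := (Num.truncn (r - 1)).+1.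

Lemma energy_interpolation E g (r t : R) : energy_le E g -> (1 <= r)%R -> (0 < t)%R ->
  \int[mu]_(z in @ref_square R) (`|g z| `^ r)%:E <=
  ((2 * t)^-1)%:E * \int[mu]_(z in @ref_square R) (g z ^+ 2)%:E +
  (t / 2 * (4 + moment_bound E (moment_order r)))%:E.
Proof.
move=> Eg r1 t0; have [G [sg _ _ _]] := Eg; have mg := slope_bound_measurable sg.
have mS := @ref_square_measurable R; set k := moment_order r.
have mgS := measurable_funS measurableT (@subsetT _ (@ref_square R)) mg.
have mg2 j : measurable_fun (@ref_square R) (fun z => (g z ^+ j)%:E).
  by apply/measurable_EFinP; exact: measurable_funX.
have g20 j z : @ref_square R z -> 0 <= (g z ^+ (2 * j))%:E.
  by move=> _; rewrite lee_fin exprM exprn_ge0// sqr_ge0.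
have c1 : 0 <= ((2 * t)^-1)%:E by rewrite lee_fin invr_ge0 mulr_ge0// ltW.
have c2 : 0 <= (t / 2)%:E by rewrite lee_fin divr_ge0// ltW.
have kr : (r - 1 <= k%:R)%R by apply/ltW; exact: truncnS_gt.
have m1 : measurable_fun (@ref_square R) (fun z => ((2 * t)^-1)%:E * (g z ^+ 2)%:E) by exact: measurable_funeM.
have m2 : measurable_fun (@ref_square R) (fun z => 1 + (g z ^+ (2 * k))%:E).
  by apply: emeasurable_funD => //; exact: measurable_cst.
have m3 : measurable_fun (@ref_square R) (fun z => (t / 2)%:E * (1 + (g z ^+ (2 * k))%:E)) by exact: measurable_funeM.
have mag : measurable_fun (@ref_square R : set (plane R)) (fun z => `|g z|%R) by exact: measurableT_comp.
have mr : measurable_fun (@ref_square R : set (plane R)) (fun z => (`|g z| `^ r)%:E).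
  by apply/measurable_EFinP; exact: (measurableT_comp (measurable_powR r) mag).
have p2 z : @ref_square R z -> 0 <= 1 + (g z ^+ (2 * k))%:E by move=> Sz; rewrite adde_ge0// g20.
apply: (@le_trans _ _ (\int[mu]_(z in @ref_square R) (((2 * t)^-1)%:E * (g z ^+ 2)%:E + (t / 2)%:E * (1 + (g z ^+ (2 * k))%:E)))).
  apply: ge0_le_integral => //.
  - exact: emeasurable_funD.
  - move=> z _; rewrite -!EFinD lee_fin.
    rewrite -[(g z ^+ 2)%R]real_normK ?num_real//.
    have -> : (g z ^+ (2 * k) = `|g z| ^+ (2 * k))%R by rewrite !exprM real_normK ?num_real.
    exact: powR_young.
have p1 z : @ref_square R z -> 0 <= ((2 * t)^-1)%:E * (g z ^+ 2)%:E.
  by move=> _; rewrite mule_ge0// lee_fin sqr_ge0.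
have p3 z : @ref_square R z -> 0 <= (t / 2)%:E * (1 + (g z ^+ (2 * k))%:E).
  by move=> Sz; rewrite mule_ge0// ?p2.
rewrite (ge0_integralD _ mS p1 m1 p3 m3) (ge0_integralZl _ mS (mg2 2%N) _ c1); last first.
  by move=> z _; rewrite lee_fin sqr_ge0.
rewrite leeD2l// (ge0_integralZl _ mS m2 p2 c2) [leRHS]EFinM; apply: lee_wpmul2l => //.
have p10 (z : plane R) : @ref_square R z -> 0 <= (1 : \bar R) by [].
rewrite (ge0_integralD _ mS p10 (measurable_cst _) (g20 k) (mg2 _)).
rewrite (integral_cstE _ mS (ref_square_area R)) mul1e [leRHS]EFinD leeD2l//.
exact: moment_le.
Qed.

Lemma energy_le_mono E E' g : (E <= E')%R -> energy_le E g -> energy_le E' g.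
Proof.
move=> EE' [G [? ? ? GE]]; exists G; split=> //.
by apply: le_trans GE _; rewrite lee_fin.
Qed.

(** [t] is chosen first, to absorb the bounded high moment. *)
Lemma energy_lp_small E (r eps : R) : (1 <= r)%R -> (0 < eps)%R ->
  exists2 d : R, (0 < d)%R & forall g, energy_le E g ->
    \int[mu]_(z in @ref_square R) (g z ^+ 2)%:E <= d%:E ->
    \int[mu]_(z in @ref_square R) (`|g z| `^ r)%:E <= eps%:E.
Proof.
move=> r1 eps0; pose M := (4 + moment_bound E (moment_order r))%R.
have M0 : (0 < M)%R by rewrite ltr_pwDl// moment_bound_ge0.
have t0 : (0 < eps / M)%R by rewrite divr_gt0.
exists (eps / M * eps)%R; first by rewrite mulr_gt0.
move=> g Eg gd; apply: le_trans (energy_interpolation Eg r1 t0) _; rewrite -/M.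
rewrite [eps in leRHS]splitr [leRHS]EFinD; apply: leeD; last first.
  by rewrite lee_fin mulrAC divfK ?gt_eqF.
apply: (@le_trans _ _ (((2 * (eps / M))^-1)%:E * (eps / M * eps)%:E)).
  by apply: lee_wpmul2l => //; rewrite lee_fin invr_ge0 mulr_ge0// ltW.
rewrite -EFinM lee_fin le_eqVlt; apply/orP; left; apply/eqP; field.
by rewrite !gt_eqF.
Qed.

Lemma energy_lp_bounded E (r : R) : (1 <= r)%R ->
  exists B : R, forall g, energy_le E g ->
    \int[mu]_(z in @ref_square R) (`|g z| `^ r)%:E <= B%:E.
Proof.
move=> r1; eexists => g Eg.
apply: le_trans (energy_interpolation Eg r1 ltr01) _.
apply: le_trans (leeD (lee_wpmul2l _ (sqr_norm_le Eg)) (le_refl _)) _ => //.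
by rewrite -EFinM -EFinD.
Qed.

Lemma energy_lp_vanishing (r eps : R) : (1 <= r)%R -> (0 < eps)%R ->
  exists2 E : R, (0 < E)%R & forall g, energy_le E g ->
    \int[mu]_(z in @ref_square R) (`|g z| `^ r)%:E <= eps%:E.
Proof.
move=> r1 eps0; have [d d0 H] := @energy_lp_small 1 r eps r1 eps0.
have c0 : (0 < 4 * e1 ^+ 2)%R by rewrite mulr_gt0// exprn_gt0// expR_gt0.
exists (Num.min 1 (d / (4 * e1 ^+ 2)))%R; first by rewrite lt_min ltr01 divr_gt0.
move=> g Eg; apply: H; first by apply: energy_le_mono Eg; rewrite ge_min lexx.
apply: le_trans (sqr_norm_le Eg) _; rewrite lee_fin -ler_pdivlMl// mulrC.
by rewrite ge_min lexx orbT.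
Qed.

End interpolation.

(** * Complex differentiability in real coordinates *)

Section complex_plane_lemmas.
Variable R : realType.
Implicit Types (z w : Cplx R) (x y : R * R) (A : set (Cplx R)).
Local Notation nc := (@Normc.normc R).
Local Notation toC := (@to_complex R).

Definition of_complex (z : Cplx R) : R * R := (complex.Re z, complex.Im z).

Lemma to_complexK : cancel toC of_complex. Proof. by case. Qed.
Lemma of_complexK : cancel of_complex toC. Proof. by case. Qed.

Lemma normCE z : `|z| = (nc z)%:C%C. Proof. by []. Qed.

Lemma nc_ge0 z : 0 <= nc z. Proof. by case: z => a b; exact: sqrtr_ge0. Qed.

Lemma ncE x : nc (toC x) = Num.sqrt (x.1 ^+ 2 + x.2 ^+ 2). Proof. by []. Qed.

Lemma ncN z : nc (- z) = nc z.
Proof. by apply: (@complexI R); rewrite -!normCE normrN. Qed.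

Lemma ncB z w : nc (z - w) = nc (w - z).
Proof. by rewrite -ncN opprB. Qed.

Lemma nc_triangle z w : nc (z + w) <= nc z + nc w.
Proof. by rewrite -lecR rmorphD /=; exact: (@ler_normD _ (Cplx R)). Qed.

Lemma to_complexB x y : toC (x - y) = toC x - toC y. Proof. by []. Qed.

Lemma sup_le_nc x : `|x| <= nc (toC x).
Proof.
rewrite ncE plane_norm_le -!sqrtr_sqr !ler_wsqrtr//.
  by rewrite lerDr sqr_ge0.
by rewrite lerDl sqr_ge0.
Qed.

Lemma nc_le_sup x : nc (toC x) <= 3 / 2 * `|x|.
Proof.
(* 3 / 2 is a rational bound of the square root of 2. *)
rewrite ncE -[leRHS]ger0_norm ?mulr_ge0// -sqrtr_sqr ler_wsqrtr//.
have : `|x| <= `|x| by [].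
rewrite plane_norm_le => /andP[h1 h2].
have k1 : x.1 ^+ 2 <= `|x| ^+ 2 by rewrite -[leLHS]real_normK ?num_real// ler_pXn2r ?nnegrE.
have k2 : x.2 ^+ 2 <= `|x| ^+ 2 by rewrite -[leLHS]real_normK ?num_real// ler_pXn2r ?nnegrE.
by rewrite exprMn; have := sqr_ge0 `|x|; lra.
Qed.

Lemma cplx_nbhsP z A :
  nbhs z A <-> exists2 e : R, 0 < e & forall w, nc (w - z) < e -> A w.
Proof.
split.
  move=> /nbhs_ballP[[e e'] /=]; rewrite ltcE /= => /andP[/eqP -> e0] sub.
  exists e => // w wz; apply: sub; rewrite -ball_normE /=.
  by rewrite normCE ltcR ncB.
move=> [e e0 sub]; apply/nbhs_ballP; exists (e%:C)%C => /=; first by rewrite ltcR.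
by move=> w; rewrite -ball_normE /= normCE ltcR ncB; exact: sub.
Qed.

Lemma open_to_complex A : open A -> open (toC @^-1` A).
Proof.
move=> oA; rewrite openE => x Ax.
have /cplx_nbhsP[e e0 H] : nbhs (toC x) A by apply: open_nbhs_nbhs.
apply/plane_nbhsP; exists (2 / 3 * e); first by rewrite mulr_gt0// divr_gt0.
move=> y yx; apply: H; rewrite -to_complexB (le_lt_trans (nc_le_sup _))//.
lra.
Qed.

Lemma unit_discE z : @unit_disc R z = (nc z < 1) :> Prop.
Proof.
rewrite /unit_disc /= normCE; have -> : (1 : Cplx R) = (1 : R)%:C%C by [].
by rewrite ltcR.
Qed.

Lemma open_unit_disc : open (@unit_disc R).
Proof.
rewrite openE => z; rewrite unit_discE => z1.
apply/cplx_nbhsP; exists (1 - nc z); first by rewrite subr_gt0.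
move=> w wz; rewrite unit_discE.
by rewrite -(subrK z w) (le_lt_trans (nc_triangle _ _))// -ltrBrDr.
Qed.

Lemma unit_disc_ref_square : toC @^-1` (@unit_disc R) `<=` @ref_square R.
Proof.
move=> x; rewrite /= unit_discE => /(le_lt_trans (sup_le_nc x)).
rewrite plane_norm_lt !ltr_norml => /andP[/andP[? ?] /andP[? ?]].
by apply/sqP; split; lra.
Qed.

Lemma derive_nc (phi : Cplx R -> Cplx R) z (eta : R) : derivable phi z 1 -> 0 < eta ->
  exists2 d : R, 0 < d & forall w, nc (w - z) < d ->
    nc (phi w - phi z - derive1 phi z * (w - z)) <= eta * nc (w - z).
Proof.
move=> dphi eta0.
have := dphi; rewrite /derivable => /cvg_ex[l Hl].
have -> : derive1 phi z = l.
  by rewrite derive1E /derive; apply/cvg_lim.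
have eC : (0 : Cplx R) < (eta%:C)%C by rewrite ltcR.
move/cvgrPdist_lt : Hl => /(_ _ eC).
rewrite near_withinE => /cplx_nbhsP[d d0 Hd]; exists d => // w wz.
have [->|wNz] := eqVneq w z; first by rewrite !subrr mulr0 subr0 /Normc.normc /= expr0n /= addr0 sqrtr0 mulr0.
have wz0 : w - z != 0 by rewrite subr_eq0.
have := Hd (w - z); rewrite subr0 => /(_ wz wz0).
rewrite /= scaler1 subrK normCE ltcR => /ltW h.
have -> : phi w - phi z - l * (w - z) = - ((l - (w - z)^-1 *: (phi w - phi z)) * (w - z)).
  by rewrite /GRing.scale /= mulrBl [(w - z)^-1 * _]mulrC mulfVK// opprB.
by rewrite ncN Normc.normcM ler_wpM2r// nc_ge0.
Qed.

(** The lower bound on the increment of [phi] is what makes the inverse map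
    Lipschitz. The factor 4 / 3 is such that, after [nc_le_sup], the constant
    becomes 4 / 3 * 3 / 2 = 2 in the sup norm. *)
Lemma derive_nc_le (phi : Cplx R -> Cplx R) z : derivable phi z 1 -> derive1 phi z != 0 ->
  exists2 d : R, 0 < d & forall w, nc (w - z) < d ->
    nc (phi w - phi z) <= 4 / 3 * nc (derive1 phi z) * nc (w - z) /\
    nc (w - z) <= 4 / 3 * (nc (derive1 phi z))^-1 * nc (phi w - phi z).
Proof.
move=> dphi; set p := derive1 phi z => p0.
have np : 0 < nc p.
  by rewrite lt_neqAle nc_ge0 andbT eq_sym; apply: contra p0 => /eqP h; apply/eqP/(@Normc.eq0_normc R).
have e0 : 0 < nc p / 4 by rewrite divr_gt0.
have [d d0 H] := derive_nc dphi e0; exists d => // w /H; rewrite -/p.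
set u := phi w - phi z; set v := w - z => h.
have v0 := nc_ge0 v; have u0 := nc_ge0 u.
have h1 : nc u <= nc (u - p * v) + nc p * nc v.
  by rewrite -Normc.normcM -[X in nc X <= _](subrK (p * v)); exact: nc_triangle.
have h2 : nc p * nc v <= nc (u - p * v) + nc u.
  rewrite -Normc.normcM ncB -[X in nc X <= _](subrK u); exact: nc_triangle.
split; first by nra.
have : 3 / 4 * (nc p * nc v) <= nc u by lra.
move=> h3; rewrite mulrAC ler_pdivlMr//; lra.
Qed.

Lemma measurable_on_open (U : set (R * R)) (f : R * R -> R * R) : open U ->
  (forall x, U x -> {for x, continuous f}) ->
  measurable_fun [set: plane R] ((fun x => if `[< U x >] then f x else 0) : plane R -> plane R).
Proof.
move=> oU cf; have mU := open_measurable_plane oU.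
have key (p : R * R -> R) : continuous p ->
    measurable_fun [set: plane R] ((fun x => if `[< U x >] then p (f x) else 0) : plane R -> R).
  move=> cp; rewrite (_ : (fun x => _) = ((p \o f) \_ U)); last first.
    apply/funext => x; rewrite patchE; case: asboolP => Ux; first by rewrite mem_set.
    by rewrite memNset.
  have m1 : measurable_fun (U : set (plane R)) (p \o f : plane R -> R).
    apply: (measurability _ (@RGenOpens.measurableE R)) => _ [_ [s [t ->]] <-].
    apply: open_measurable_plane; rewrite openE => x [Ux fx].
    apply: filterI; first by apply: open_nbhs_nbhs.
    have : {for x, continuous (p \o f)} by apply: continuous_comp; [exact: cf|exact: cp].
    by apply; apply: open_nbhs_nbhs; split=> //; exact: interval_open.
  exact: (proj1 (measurable_restrictT _ mU) m1).
rewrite (_ : (fun x => _) = (fun x => (if `[< U x >] then (f x).1 else 0, if `[< U x >] then (f x).2 else 0))).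
  by apply: measurable_fun_pair; apply: key => z; [exact: cvg_fst|exact: cvg_snd].
by apply/funext => x; case: ifP => // _; exact: surjective_pairing.
Qed.

End complex_plane_lemmas.

(** * Conformal maps of plane domains *)

Section conformal_maps.
Variable R : realType.
Variables (Omega : set (Cplx R)) (phi psi : Cplx R -> Cplx R).
Hypotheses (oOmega : open Omega) (bij : set_bij Omega (@unit_disc R) phi)
  (psiK : {in Omega, cancel phi psi})
  (cpsi : {within (@unit_disc R), continuous psi})
  (conf : conformal_on Omega phi).
Local Notation nc := (@Normc.normc R).
Local Notation toC := (@to_complex R).
Local Notation ofC := (@of_complex R).
Local Notation mu := (lebesgue2 R).

Let U : set (R * R) := toC @^-1` Omega.
Let D : set (R * R) := toC @^-1` (@unit_disc R).

(** Extended by 0, so as to be measurable on the whole plane. *)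
Definition plane_map (A : set (R * R)) (f : Cplx R -> Cplx R) (x : R * R) : R * R :=
  if `[< A x >] then ofC (f (toC x)) else 0.

Lemma plane_mapE A f x : A x -> plane_map A f x = ofC (f (toC x)).
Proof. by rewrite /plane_map; case: asboolP. Qed.

Let T := plane_map U phi.
Let S := plane_map D psi.

Definition conformal_factor (x : R * R) : R := nc (derive1 phi (toC x)).
Let a := conformal_factor.
Definition inverse_factor (y : R * R) : R := (conformal_factor (S y))^-1.
Let b := inverse_factor.

Lemma conformal_open_domain : open U. Proof. exact: open_to_complex. Qed.
Lemma conformal_open_disc : open D. Proof. exact/open_to_complex/open_unit_disc. Qed.

Lemma conformal_mapK x : U x -> D (T x) /\ S (T x) = x.
Proof.
move=> Ux; have Dx : @unit_disc R (phi (toC x)) by have [+ _ _] := bij; exact.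
have DT : D (T x) by rewrite /D /= /T plane_mapE// of_complexK.
split=> //; rewrite /S plane_mapE// /T plane_mapE// of_complexK psiK ?to_complexK//.
exact: mem_set.
Qed.

Lemma conformal_inverseK y : D y -> U (S y) /\ T (S y) = y.
Proof.
move=> Dy; have [_ _ sj] := bij; have [z Oz zy] := sj _ Dy.
have Sy : S y = ofC z by rewrite /S plane_mapE// -zy psiK//; exact: mem_set.
have US : U (S y) by rewrite /U /= Sy of_complexK.
by split=> //; rewrite /T plane_mapE// Sy of_complexK zy to_complexK.
Qed.

Lemma conformal_factor_gt0 x : U x -> 0 < a x.
Proof.
move=> Ux; have [_ p0] := conf Ux.
rewrite lt_neqAle nc_ge0 andbT eq_sym; apply: contra p0 => /eqP h.
exact/eqP/(@Normc.eq0_normc R).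
Qed.

Lemma inverse_factor_gt0 y : D y -> 0 < b y.
Proof. by move=> /conformal_inverseK[/conformal_factor_gt0 h _]; rewrite invr_gt0. Qed.

Lemma inverse_factorE y : D y -> a (S y) * b y = 1.
Proof.
by move=> /conformal_inverseK[/conformal_factor_gt0 h _]; rewrite /b /inverse_factor mulfV// gt_eqF.
Qed.

Lemma psi_continuous_in w : @unit_disc R w -> {for w, continuous psi}.
Proof.
move=> Dw; have := cpsi; rewrite continuous_open_subspace; last exact: open_unit_disc.
by move=> /(_ w); apply; exact: mem_set.
Qed.

Lemma of_complexB z w : ofC (z - w) = ofC z - ofC w.
Proof. by case: z w => [? ?] [? ?]. Qed.

Lemma conformal_lipschitz x : U x -> exists2 e, 0 < e & forall x', U x' ->
  `|x' - x| < e -> `|T x' - T x| <= 2 * a x * `|x' - x|.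
Proof.
move=> Ux; have [dp p0] := conf Ux; have [d d0 H] := derive_nc_le dp p0.
exists (2 / 3 * d); first by rewrite mulr_gt0// divr_gt0.
move=> x' Ux' xx'; have nle := nc_le_sup (x' - x).
have [|h _] := H (toC x'); first by rewrite -to_complexB (le_lt_trans nle)//; lra.
rewrite /T !plane_mapE// -of_complexB (le_trans (sup_le_nc _))// of_complexK.
apply: le_trans h _; rewrite -to_complexB.
have := conformal_factor_gt0 Ux; rewrite -/(conformal_factor x) -/a => a0.
have -> : 2 * a x * `|x' - x| = 4 / 3 * a x * (3 / 2 * `|x' - x|) by field.
by rewrite ler_wpM2l// mulr_ge0// ltW.
Qed.

(** The continuity of [psi] brings [psi y'] into the neighbourhood in which
    the two-sided estimate of [derive_nc_le] holds. *)
Lemma inverse_lipschitz y : D y -> exists2 e, 0 < e & forall y', D y' ->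
  `|y' - y| < e -> `|S y' - S y| <= 2 * b y * `|y' - y|.
Proof.
move=> Dy; have [US TSy] := conformal_inverseK Dy; have [dp p0] := conf US.
have [d d0 H] := derive_nc_le dp p0.
have Sy : toC (S y) = psi (toC y) by rewrite /S plane_mapE// of_complexK.
have : nbhs (toC y) (psi @^-1` [set z | nc (z - toC (S y)) < d]).
  apply: (psi_continuous_in Dy); apply/cplx_nbhsP; exists d => // w.
  by rewrite Sy.
move=> /cplx_nbhsP[e e0 He].
exists (2 / 3 * e); first by rewrite mulr_gt0// divr_gt0.
move=> y' Dy' yy'; have nle := nc_le_sup (y' - y).
have [US' TSy'] := conformal_inverseK Dy'.
have Sy' : toC (S y') = psi (toC y') by rewrite /S plane_mapE// of_complexK.
have [|_] := H (toC (S y')).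
  by rewrite Sy'; apply: He; rewrite -to_complexB (le_lt_trans nle)//; lra.
have phiS v : D v -> phi (toC (S v)) = toC v.
  by move=> /conformal_inverseK[USv TSv]; rewrite -{2}TSv /T plane_mapE// of_complexK.
rewrite !phiS// -!to_complexB => h.
apply: le_trans (sup_le_nc _) _; apply: le_trans h _.
rewrite -/(conformal_factor (S y)) -/(inverse_factor y) -/b.
have -> : 2 * b y * `|y' - y| = 4 / 3 * b y * (3 / 2 * `|y' - y|) by field.
by rewrite ler_wpM2l// mulr_ge0// ltW// inverse_factor_gt0.
Qed.

Lemma continuous_plane (f : Cplx R -> Cplx R) x :
  {for toC x, continuous f} -> {for x, continuous (ofC \o f \o toC)}.
Proof.
move=> cf; apply/cvgrPdist_lt => eps eps0.
have : nbhs (toC x) (f @^-1` [set z | nc (z - f (toC x)) < eps]).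
  by apply: cf; apply/cplx_nbhsP; exists eps.
move=> /cplx_nbhsP[e e0 He]; apply/plane_nbhsP; exists (2 / 3 * e).
  by rewrite mulr_gt0// divr_gt0.
move=> y yx; rewrite /= distrC -of_complexB (le_lt_trans (sup_le_nc _))// of_complexK.
apply: He; rewrite -to_complexB (le_lt_trans (nc_le_sup _))//; lra.
Qed.

Lemma measurable_conformal_map : measurable_fun [set: plane R] (T : plane R -> plane R).
Proof.
apply: (measurable_on_open conformal_open_domain) => x Ux.
apply: continuous_plane; have [dp _] := conf Ux.
by apply: differentiable_continuous; exact/derivable1_diffP.
Qed.

Lemma measurable_conformal_inverse : measurable_fun [set: plane R] (S : plane R -> plane R).
Proof.
apply: (measurable_on_open conformal_open_disc) => x Dx.
by apply: continuous_plane; exact: psi_continuous_in.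
Qed.

(** The derivative is a pointwise limit of difference quotients along the real
    direction. *)
Lemma measurable_conformal_factor : measurable_fun (U : set (plane R)) (a : plane R -> R).
Proof.
have oU := conformal_open_domain.
pose sh n (x : R * R) : R * R := (x.1 + n.+1%:R^-1, x.2).
pose q n (x : plane R) : R := n.+1%:R * nc (toC (T (sh n x) - T x)).
have mT := measurable_conformal_map.
have mT1 : measurable_fun [set: plane R] (fun x => (T x).1).
  by have [] := proj1 (measurable_fun_pairP T) mT.
have mT2 : measurable_fun [set: plane R] (fun x => (T x).2).
  by have [] := proj1 (measurable_fun_pairP T) mT.
have msh n : measurable_fun [set: plane R] (sh n : plane R -> plane R).
  apply: measurable_fun_pair; last exact: measurable_snd.
  by apply: measurable_funD => //; exact: measurable_fst.
have mq n : measurable_fun [set: plane R] (q n).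
  apply: measurable_funM; first exact: measurable_cst.
  apply: (measurableT_comp (continuous_measurable_fun (@sqrt_continuous R))); apply: measurable_funD.
    apply: measurable_funX; apply: measurable_funB => //.
    exact: (measurableT_comp mT1 (msh n)).
  apply: measurable_funX; apply: measurable_funB => //.
  exact: (measurableT_comp mT2 (msh n)).
apply: (@measurable_fun_cvg _ _ _ _ q) => [n|x Ux]; first exact: measurable_funS (mq n).
have [dp _] := conf Ux.
apply/cvgrPdist_le => eps eps0.
have [d d0 H] := derive_nc dp eps0.
have /plane_nbhsP[d' d'0 HU] : nbhs x U by apply: open_nbhs_nbhs.
have dd0 : 0 < Num.min d d' by rewrite lt_min d0.
have := @near_infty_natSinv_lt R (PosNum dd0); apply: filterS => n /=.
rewrite lt_min => /andP[nd nd'].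
have n0 : 0 < n.+1%:R^-1 :> R by rewrite invr_gt0 ltr0n.
have shE : sh n x - x = (n.+1%:R^-1, 0) by congr pair; rewrite /= ?subrr// addrC addKr.
have shN : toC (sh n x) - toC x = (n.+1%:R^-1)%:C%C by rewrite -to_complexB shE.
have ncC (r : R) : 0 <= r -> nc (r%:C)%C = r.
  by move=> r0; rewrite /Normc.normc /= expr0n addr0 sqrtr_sqr ger0_norm.
have Ush : U (sh n x).
  by apply: HU; rewrite shE prod_normE /= normr0 ger0_norm ?ltW// gt_max nd'.
have := H (toC (sh n x)); rewrite shN (ncC _ (ltW n0)) => /(_ nd).
have qE : q n x = n.+1%:R * nc (phi (toC (sh n x)) - phi (toC x)).
  by rewrite /q /T !plane_mapE// -of_complexB of_complexK.
set p := derive1 phi (toC x); set u := phi _ - phi _ => h.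
have aE : a x = n.+1%:R * nc (p * (n.+1%:R^-1)%:C%C).
  by rewrite Normc.normcM (ncC _ (ltW n0)) mulrCA mulfV ?mulr1// pnatr_eq0.
rewrite qE -/u aE -mulrBr normrM normr_nat.
have : `|nc (p * (n.+1%:R^-1)%:C%C) - nc u| <= nc (u - p * (n.+1%:R^-1)%:C%C).
  rewrite ler_norml; apply/andP; split.
    rewrite lerNl opprB lerBlDr -[X in nc X <= _](subrK (p * (n.+1%:R^-1)%:C%C)).
    exact: nc_triangle.
  rewrite lerBlDr ncB -[X in nc X <= _](subrK u); exact: nc_triangle.
move=> /le_trans/(_ h) k.
by rewrite mulrC -ler_pdivlMr ?ltr0n.
Qed.

Lemma measurable_inverse_factor : measurable_fun (D : set (plane R)) (b : plane R -> R).
Proof.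
have mU : measurable (U : set (plane R)) by apply: open_measurable_plane; exact: conformal_open_domain.
have maS : measurable_fun (D : set (plane R)) (fun y : plane R => a (S y)).
  apply: (@measurable_comp _ _ _ _ _ _ (U : set (plane R)) (a : plane R -> R)) => //.
  - by move=> _ [y Dy <-]; have [] := conformal_inverseK Dy.
  - exact: measurable_conformal_factor.
  - by apply: measurable_funS measurable_conformal_inverse.
apply: eq_measurable_fun (measurableT_comp (measurable_powR (-1)) maS) => y _ /=.
by rewrite powR_inv1// nc_ge0.
Qed.

End conformal_maps.

(** * Differentiable functions with compact support *)

Section test_functions.
Variable R : realType.
Local Notation mu := (lebesgue2 R).
Local Notation lam := (@lebesgue_measure R).
Implicit Types (U K : set (R * R)) (f g p : R * R -> R) (i : bool).

Definition dir i : R * R := if i then (0, 1) else (1, 0).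

Lemma partialE i f z : partial i f z = 'D_(dir i) f z. Proof. by []. Qed.

Lemma dir_decomposition (v : R * R) : v = v.1 *: dir false + v.2 *: dir true.
Proof.
case: v => p q; apply: injective_projections;
  by rewrite /= /GRing.scale /= mulr1 mulr0 ?addr0 ?add0r.
Qed.

Definition support_closure f : set (R * R) := closure [set z | f z != 0].

Lemma off_support f z : ~ support_closure f z -> f z = 0.
Proof.
move=> nz; apply/eqP; apply: contrapT => /negP fz; apply: nz.
exact: subset_closure.
Qed.

Lemma differential_slope f z eps : differentiable f z -> 0 < eps ->
  exists2 e, 0 < e & forall w, `|w - z| < e ->
    `|f w - f z| <= (`|partial false f z| + `|partial true f z| + eps) * `|w - z|.
Proof.
move=> df eps0; have := diff_locally df => /eqaddoP/(_ _ eps0).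
move=> /plane_nbhsP[e e0 He]; exists e => // w wz.
have := He (w - z); rewrite subr0 => /(_ wz).
rewrite /= !fctE /= subrK => h.
have dE : 'd f z (w - z) = (w - z).1 * partial false f z + (w - z).2 * partial true f z.
  by rewrite !partialE !deriveE//= {1}[w - z]dir_decomposition linearD !linearZ.
rewrite dE in h; set v := w - z in h *.
have [v1 v2] : `|v.1| <= `|v| /\ `|v.2| <= `|v|.
  by apply/andP; rewrite -plane_norm_le.
have -> : f w - f z = (f w - (f z + (v.1 * partial false f z + v.2 * partial true f z))) +
   (v.1 * partial false f z + v.2 * partial true f z) by ring.
apply: le_trans (ler_normD _ _) _; rewrite [leRHS]mulrDl [leRHS]addrC; apply: lerD => //.
apply: le_trans (ler_normD _ _) _; rewrite [leRHS]mulrDl; apply: lerD; rewrite normrM mulrC; exact: ler_wpM2l.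
Qed.

(** The compact set [K] is recorded, rather than the support: it carries all
    the products with functions of this class, which makes integration by
    parts immediate. *)
Definition C1_off K f := [/\ forall z, differentiable f z,
  forall i, continuous (partial i f), compact K & forall z, ~ K z -> f z = 0].

Lemma C1_off_continuous K f : C1_off K f -> continuous f.
Proof. by move=> [df _ _ _] z; exact: differentiable_continuous. Qed.

Lemma C1_slope K f : C1_off K f ->
  slope_bound f (fun z => `|partial false f z| + `|partial true f z|).
Proof.
move=> [df cf _ _]; split.
- by apply: measurable_funD; apply: measurableT_comp => //; exact: continuous_measurable_plane.
- by move=> w; rewrite addr_ge0.
- by move=> w eps; exact: differential_slope.
Qed.

Lemma partial_off K f i z : C1_off K f -> ~ K z -> partial i f z = 0.
Proof.
move=> [df _ cK fK] Kz; rewrite partialE (@near_eq_derive _ _ _ f (cst 0)); first exact: derive_cst.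
have : nbhs z (~` K).
  apply: open_nbhs_nbhs; split=> //; apply: closed_openC.
  by apply: compact_closed => //; exact: norm_hausdorff.
by apply: filterS => y /fK.
Qed.

Lemma compact_in_square K : compact K ->
  exists2 M : R, 0 < M & K `<=` sq (- M) (- M) (M *+ 2).
Proof.
move=> /compact_bounded[M [_ HM]]; exists (`|M| + 2); first by rewrite ltr_wpDl.
move=> x Kx; have xM := HM (`|M| + 1) (ltr_pwDr ltr01 (ler_norm M)) x Kx.
have : `|x| < `|M| + 2 by rewrite (le_lt_trans xM)// ltrD2l ltr1n.
rewrite plane_norm_lt !ltr_norml mulr2n => /andP[/andP[? ?] /andP[? ?]].
by apply/sqP; split; lra.
Qed.

Lemma compact_support_integrable K p : continuous p -> compact K ->
  (forall z, ~ K z -> p z = 0) -> mu.-integrable [set: plane R] (fun z => (p z)%:E).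
Proof.
move=> cp cK pK; have [M M0 KM] := compact_in_square cK.
pose Q : set (plane R) := sq (- M) (- M) (M *+ 2).
have mQ : measurable Q by exact: sq_measurable.
have mp := continuous_measurable_plane cp.
have iQ : mu.-integrable Q (fun z => (p z)%:E).
  apply: measurable_bounded_integrable => //.
  - by rewrite lebesgue2_sq ?ltry// pmulrn_lge0// ltW.
  - exact: measurable_funS mp.
  - have /compact_bounded[B [Br HB]] : compact (p @` K).
      by apply: continuous_compact => //; exact: continuous_subspaceT.
    exists `|B|; split; first exact: num_real.
    move=> B' BB' z _; have B'0 : 0 <= B' by rewrite (le_trans _ (ltW BB')).
    have [Kz|nKz] := pselect (K z); last by rewrite /= pK// normr0.
    by apply: HB; [exact: le_lt_trans (ler_norm B) BB'|exists z].
have := proj1 (integrable_mkcond _ mQ) iQ.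
apply: eq_integrable => // z _; rewrite patchE; case: ifPn => // /negP nQ.
by rewrite pK// => /KM Qz; apply: nQ; exact: mem_set.
Qed.

Lemma line_derivative p i (x y : R) : differentiable p (x, y) ->
  is_derive (if i then y else x) (1 : R)
    (fun t => p (if i then (x, t) else (t, y))) (partial i p (x, y)).
Proof.
move=> dp; have dv : derivable p (x, y) (dir i) by exact: diff_derivable.
have E : (fun h : R => h^-1 *: (((fun t => p (if i then (x, t) else (t, y))) \o shift (if i then y else x)) (h *: 1) - p (x, y))) =
  (fun h : R => h^-1 *: ((p \o shift (x, y)) (h *: dir i) - p (x, y))).
  apply/funext => h /=; congr (_ *: (p _ - _)).
  by case: i {dv} => /=; apply: injective_projections; rewrite /= /GRing.scale /= ?mulr1 ?mulr0 ?add0r.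
split.
- by rewrite /derivable; case: i dv E => dv /= E; rewrite E.
- by rewrite partialE /derive; case: i dv E => dv /= E; rewrite E.
Qed.

Lemma line_integral0 (F dF : R -> R) (M : R) : 0 < M -> continuous dF ->
  (forall t : R, is_derive t 1 F (dF t)) -> (forall t, ~ (- M <= t < M) -> F t = 0 /\ dF t = 0) ->
  (\int[lam]_t (dF t)%:E = 0)%E.
Proof.
move=> M0 cF DF F0.
have MM : - M - 1 < M + 1 by lra.
rewrite (@integral_supported R _ (measurableTypeR R) lam (`[- M - 1, M + 1]%classic : set (measurableTypeR R))); last first.
  move=> t /=; rewrite in_itv /= => nt; have [|_ ->//] := F0 t.
  by move=> /andP[h1 h2]; apply: nt; apply/andP; split; lra.
have cFt : continuous F.
  by move=> t; apply: differentiable_continuous; apply/derivable1_diffP; exact: (@ex_derive _ _ _ _ _ _ _ (DF t)).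
rewrite (@continuous_FTC2 R dF F).
- have [-> _] : F (M + 1) = 0 /\ dF (M + 1) = 0 by apply: F0 => /andP[]; lra.
  have [-> _] : F (- M - 1) = 0 /\ dF (- M - 1) = 0 by apply: F0 => /andP[]; lra.
  by rewrite subee.
- exact: MM.
- exact: continuous_subspaceT.
- split.
  + by move=> t _; exact: (@ex_derive _ _ _ _ _ _ _ (DF t)).
  + by apply: cvg_at_right_filter; exact: cFt.
  + by apply: cvg_at_left_filter; exact: cFt.
- by move=> t _; rewrite derive1E; exact: (@derive_val _ _ _ _ _ _ _ (DF t)).
Qed.

(** Integrating first in the variable of the derivative, along lines that
    leave the support. *)
Lemma integral_partial0 K p i : C1_off K p -> (\int[mu]_z (partial i p z)%:E = 0)%E.
Proof.
move=> C1p; have [dp cp cK pK] := C1p.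
have [M M0 KM] := compact_in_square cK.
have ip := compact_support_integrable (cp i) cK (fun z => partial_off i C1p).
have cpair1 (x : R) : continuous (fun y : R => (x, y)).
  move=> y; apply/cvgrPdist_lt => e e0; apply/nbhs_ballP; exists e => //= t.
  by rewrite /ball /= prod_normE /= subrr normr0 gt_max e0 ?andbT => ->.
have cpair2 (y : R) : continuous (fun x : R => (x, y)).
  move=> x; apply/cvgrPdist_lt => e e0; apply/nbhs_ballP; exists e => //= t.
  by rewrite /ball /= prod_normE /= subrr normr0 gt_max e0 ?andbT => ->.
have off x y : ~ (- M <= (if i then y else x) < M) -> p (x, y) = 0 /\ partial i p (x, y) = 0.
  move=> h; have nK : ~ K (x, y).
    move=> /KM/sqP[/= h1 h2 h3 h4]; apply: h; rewrite mulr2n in h2 h4.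
    by case: (i) => /=; apply/andP; split; lra.
  by split; [exact: pK nK|exact: (partial_off i C1p nK)].
case: i ip off => ip off.
- have z0 x : (\int[lam]_y (partial true p (x, y))%:E = 0)%E.
    apply: (@line_integral0 (fun y => p (x, y)) (fun y => partial true p (x, y)) M) => //.
    + by move=> y; apply: continuous_comp; [exact: cpair1|exact: cp].
    + by move=> y; exact: (@line_derivative p true x y).
    + by move=> y; exact: off.
  by rewrite -(integral12_prod_meas1 ip) /fubini_F (eq_integral (fun=> 0%E)) ?integral0.
- have z0 y : (\int[lam]_x (partial false p (x, y))%:E = 0)%E.
    apply: (@line_integral0 (fun x => p (x, y)) (fun x => partial false p (x, y)) M) => //.
    + by move=> x; apply: continuous_comp; [exact: cpair2|exact: cp].
    + by move=> x; exact: (@line_derivative p false x y).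
    + by move=> x; exact: off.
  by rewrite -(integral21_prod_meas1 ip) /fubini_G (eq_integral (fun=> 0%E)) ?integral0.
Qed.

End test_functions.

(** * Weak gradients *)

Section weak_gradients.
Variable R : realType.
Local Notation locally_integrable := (@Defs.locally_integrable R).
Local Notation mu := (lebesgue2 R).
Implicit Types (U K : set (R * R)) (f g p q : R * R -> R) (i : bool).

Lemma test_C1 U f : test_function U f -> C1_off (support_closure f) f.
Proof.
move=> [sf cf _]; split=> //; first exact: (sf [::]).
  by move=> i z; apply: differentiable_continuous; exact: (sf [:: i]).
exact: off_support.
Qed.

Lemma closure_sub_closed (A B : set (R * R)) : closed B -> A `<=` B -> closure A `<=` B.
Proof. by move=> cB AB; rewrite (proj1 (closure_id B) cB); exact: closure_subset. Qed.

Lemma test_partial U f i : test_function U f -> test_function U (partial i f).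
Proof.
move=> tf; have [sf cf fU] := tf; have C1f := test_C1 tf.
have sub : closure [set z | partial i f z != 0] `<=` support_closure f.
  apply: closure_sub_closed; first exact: closed_closure.
  move=> z /= /eqP nz; apply: contrapT => nK; apply: nz.
  exact: partial_off C1f nK.
split; last exact: subset_trans sub fU.
- by move=> s z; rewrite -foldr_rcons; exact: sf.
- by apply: subclosed_compact sub => //; exact: closed_closure.
Qed.

Lemma smoothB f g : smooth f -> smooth g -> smooth (f \- g).
Proof.
move=> sf sg s.
have E : foldr (@partial R) (f \- g) s = foldr (@partial R) f s \- foldr (@partial R) g s.
  elim: s => [//|i s IH] /=; rewrite IH; apply/funext => z; rewrite /= !partialE.
  by apply: deriveB; apply: diff_derivable; [exact: sf|exact: sg].
by move=> z; rewrite E; apply: differentiableB; [exact: sf|exact: sg].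
Qed.

Lemma test_sub U f g : test_function U f -> test_function U g ->
  test_function U (f \- g).
Proof.
move=> [sf cf fU] [sg cg gU].
have sub : closure [set z | (f \- g) z != 0] `<=` support_closure f `|` support_closure g.
  apply: closure_sub_closed; first by apply: closedU; exact: closed_closure.
  move=> z /= nz; apply: contrapT => /not_orP[nf ng].
  by move: nz; rewrite (off_support nf) (off_support ng) subr0 eqxx.
split; first exact: smoothB.
- by apply: subclosed_compact sub; [exact: closed_closure|exact: compactU].
- by apply: subset_trans sub _; rewrite subUset.
Qed.

Lemma partialB U f g i z : test_function U f -> test_function U g ->
  partial i (f \- g) z = partial i f z - partial i g z.
Proof.
move=> [sf _ _] [sg _ _]; rewrite !partialE; apply: deriveB; apply: diff_derivable.
  exact: (sf [::]).
exact: (sg [::]).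
Qed.

Lemma C1_off_mul K K' f g : C1_off K f -> C1_off K' g -> C1_off K (f \* g) /\
  forall i z, partial i (f \* g) z = f z * partial i g z + partial i f z * g z.
Proof.
move=> C1f C1g; have cf := C1_off_continuous C1f; have cg := C1_off_continuous C1g.
move: C1f C1g => [df pf cK fK] [dg pg _ _].
have E i z : partial i (f \* g) z = f z * partial i g z + partial i f z * g z.
  rewrite !partialE (_ : f \* g = f * g)// deriveM; [|exact: diff_derivable..].
  by rewrite /GRing.scale /= [g z * _]mulrC.
split=> //; split=> //.
- by move=> z; exact: (differentiableM (df z) (dg z)).
- move=> i; rewrite (_ : partial i _ = (f \* partial i g) \+ (partial i f \* g)); last first.
    by apply/funext => z; rewrite E.
  move=> z; apply: continuousD; apply: continuousM; [exact: cf|exact: pg|exact: pf|exact: cg].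
- by move=> z /fK; rewrite /= => ->; rewrite mul0r.
Qed.

(** The product has compact support, so the integral of its partial derivative
    vanishes. *)
Lemma integration_by_parts_plane K K' f g i : C1_off K f -> C1_off K' g ->
  (\int[mu]_z (f z * partial i g z)%:E = - \int[mu]_z (partial i f z * g z)%:E)%E.
Proof.
move=> C1f C1g; have [C1fg E] := C1_off_mul C1f C1g.
have cf := C1_off_continuous C1f; have cg := C1_off_continuous C1g.
have [_ pf cK fK] := C1f; have [_ pg cK' gK'] := C1g.
have i1 : mu.-integrable [set: plane R] (fun z => (f z * partial i g z)%:E).
  apply: (@compact_support_integrable R K (f \* partial i g)) => //.
    by move=> z; apply: continuousM; [exact: cf|exact: pg].
  by move=> z /fK; rewrite /= => ->; rewrite mul0r.
have i2 : mu.-integrable [set: plane R] (fun z => (partial i f z * g z)%:E).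
  apply: (@compact_support_integrable R K' (partial i f \* g)) => //.
    by move=> z; apply: continuousM; [exact: pf|exact: cg].
  by move=> z /gK'; rewrite /= => ->; rewrite mulr0.
have := integral_partial0 i C1fg.
under eq_integral do rewrite E EFinD.
rewrite integralD//.
have f1 := integrable_fin_num measurableT i1; have f2 := integrable_fin_num measurableT i2.
rewrite -(fineK f1) -(fineK f2) -EFinD -EFinN => -[/eqP]; rewrite addr_eq0 => /eqP ->.
by [].
Qed.

Lemma integral_on_support U K p : K `<=` U -> (forall z, ~ K z -> p z = 0) ->
  (\int[mu]_(z in U) (p z)%:E = \int[mu]_z (p z)%:E)%E.
Proof.
move=> KU pK; apply/esym; apply: (@integral_supported _ _ (plane R)) => z nU.
by rewrite pK// => /KU.
Qed.

Lemma test_weak_partial U f i : test_function U f -> is_weak_partial U i f (partial i f).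
Proof.
move=> tf psi tpsi; have C1f := test_C1 tf; have C1p := test_C1 tpsi.
have [_ _ fU] := tf; have [_ _ pU] := tpsi.
rewrite (@integral_on_support U (support_closure f) (f \* partial i psi))//; last first.
  by move=> z /off_support /= ->; rewrite mul0r.
rewrite (@integral_on_support U (support_closure psi) (partial i f \* psi))//; last first.
  by move=> z /off_support /= ->; rewrite mulr0.
exact: integration_by_parts_plane C1f C1p.
Qed.

Lemma compact_measurable_plane K : compact K -> measurable (K : set (plane R)).
Proof.
by move=> cK; apply: closed_measurable_plane; apply: compact_closed => //; exact: norm_hausdorff.
Qed.

Lemma continuous_locally_integrable U p : continuous p -> locally_integrable U p.
Proof.
move=> cp K cK _; have mK := compact_measurable_plane cK.
have [M M0 KM] := compact_in_square cK.
apply: measurable_bounded_integrable => //.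
- apply: (@le_lt_trans _ _ (mu (sq (- M) (- M) (M *+ 2)))).
    by apply: le_measure => //; rewrite inE//; exact: sq_measurable.
  by rewrite lebesgue2_sq ?ltry// pmulrn_lge0// ltW.
- by apply: measurable_funS (continuous_measurable_plane cp).
- have /compact_bounded[B [Br HB]] : compact (p @` K).
    by apply: continuous_compact => //; exact: continuous_subspaceT.
  exists B; split=> // B' BB' z Kz /=.
  by apply: (HB _ BB'); exists z.
Qed.

Lemma locally_integrable_mul U K f q : measurable (U : set (plane R)) ->
  locally_integrable U f -> compact K -> K `<=` U ->
  continuous q -> (forall z, ~ K z -> q z = 0) ->
  mu.-integrable U (fun z => (f z * q z)%:E).
Proof.
move=> mU lf cK KU cq qK; have mK := compact_measurable_plane cK.
have iK : mu.-integrable K (fun z => (f z * q z)%:E).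
  have := @integrableMr _ _ _ mu K mK q (fun z => (f z)%:E) _ _ (lf K cK KU).
  have m1 : measurable_fun (K : set (plane R)) (q : plane R -> R).
    by apply: measurable_funS (continuous_measurable_plane cq).
  have b1 : [bounded q x | x in K].
    have /compact_bounded[B [Br HB]] : compact (q @` K).
      by apply: continuous_compact => //; exact: continuous_subspaceT.
    exists B; split=> // B' BB' z Kz /=.
    by apply: (HB _ BB'); exists z.
  move=> /(_ m1 b1); apply: eq_integrable => // z _ /=.
  by rewrite -EFinM mulrC.
have iT : mu.-integrable [set: plane R] (fun z => (f z * q z)%:E).
  have := proj1 (integrable_mkcond _ mK) iK.
  apply: eq_integrable => // z _; rewrite patchE; case: ifPn => // /negP nK.
  by rewrite qK ?mulr0// => Kz; apply: nK; exact: mem_set.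
exact: integrableS iT.
Qed.

Lemma weak_partialB U i f g v w : measurable (U : set (plane R)) ->
  locally_integrable U f -> locally_integrable U g ->
  locally_integrable U v -> locally_integrable U w ->
  is_weak_partial U i f v -> is_weak_partial U i g w ->
  is_weak_partial U i (f \- g) (v \- w).
Proof.
move=> mU lf lg lv lw fv gw psi tpsi.
have tp := test_partial i tpsi.
have [_ cp pU] := tpsi; have [_ cdp dpU] := tp.
have C1p := test_C1 tpsi; have C1dp := test_C1 tp.
have I1 h : locally_integrable U h -> mu.-integrable U (fun z => (h z * partial i psi z)%:E).
  move=> lh; apply: locally_integrable_mul lh cdp dpU _ (@off_support _ _) => //.
  exact: C1_off_continuous C1dp.
have I2 h : locally_integrable U h -> mu.-integrable U (fun z => (h z * psi z)%:E).
  move=> lh; apply: locally_integrable_mul lh cp pU _ (@off_support _ _) => //.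
  exact: C1_off_continuous C1p.
under eq_integral do rewrite mulrBl.
under [X in (_ = - X)%E]eq_integral do rewrite mulrBl.
rewrite !integralB_EFin//; [|exact: I2..|exact: I1|exact: I1].
have fw := integrable_fin_num mU (I2 _ lw).
by rewrite (fv _ tpsi) (gw _ tpsi) fin_num_oppeB// oppeK.
Qed.

Lemma locally_integrableB U f g : locally_integrable U f -> locally_integrable U g ->
  locally_integrable U (f \- g).
Proof.
move=> lf lg K cK KU; have mK := compact_measurable_plane cK.
by apply: eq_integrable (integrableB mK (lf K cK KU) (lg K cK KU)).
Qed.

Definition gradient f (z : R * R) : R * R := (partial false f z, partial true f z).

Lemma test_weak_gradient U f : test_function U f -> is_weak_gradient U f (gradient f).
Proof.
move=> tf; have C1f := test_C1 tf; have [_ pf _ _] := C1f.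
split; [exact: continuous_locally_integrable (pf false)|
  exact: continuous_locally_integrable (pf true)| |]; exact: test_weak_partial.
Qed.

Lemma weak_gradientB U f g v w : measurable (U : set (plane R)) ->
  locally_integrable U f -> locally_integrable U g ->
  is_weak_gradient U f v -> is_weak_gradient U g w ->
  is_weak_gradient U (f \- g) (fun z => v z - w z).
Proof.
move=> mU lf lg [v1 v2 fv1 fv2] [w1 w2 gw1 gw2]; split.
- exact: locally_integrableB v1 w1.
- exact: locally_integrableB v2 w2.
- exact: weak_partialB fv1 gw1.
- exact: weak_partialB fv2 gw2.
Qed.

(** An open set is a countable union of compact sets. *)
Lemma locally_integrable_measurable U f : open U -> locally_integrable U f ->
  measurable_fun (U : set (plane R)) (f : plane R -> R).
Proof.
move=> oU lf.
pose Q n : set (R * R) := `[(- n%:R)%R, n%:R] `*` `[(- n%:R)%R, n%:R].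
pose C n : set (R * R) := Q n `&` inner U n.
have cQ n : compact (Q n) by apply: compact_setX; exact: segment_compact.
have clQ n : closed (Q n) by apply: compact_closed => //; exact: norm_hausdorff.
have cC n : closed (C n) by apply: closedI => //; exact: closed_inner.
have CU n : C n `<=` U by move=> x [_ /inner_sub].
have -> : U = \bigcup_n C n.
  apply/seteqP; split=> [x Ux|x [n _ /CU//]].
  have [n nx] := open_inner oU Ux.
  pose m := maxn n (Num.truncn `|x|).+1.
  have xm : `|x| < m%:R.
    by apply: lt_le_trans (truncnS_gt _) _; rewrite ler_nat leq_maxr.
  exists m => //; split; last by apply: inner_mono nx; exact: leq_maxl.
  move: xm; rewrite plane_norm_lt !ltr_norml => /andP[/andP[? ?] /andP[? ?]].
  by split; rewrite /= in_itv /=; apply/andP; split; exact: ltW.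
apply/measurable_fun_bigcup => n; first exact: closed_measurable_plane.
have cpt : compact (C n) by apply: subclosed_compact (cC n) (cQ n) _ => x [].
by have := measurable_int _ (lf _ cpt (@CU n)) => /measurable_EFinP.
Qed.

(** Tested against the partial derivatives of [f] itself, a weak gradient and
    the classical gradient have the same integral, so that the latter is the
    orthogonal projection of the former. This replaces the uniqueness of weak
    gradients: any weak gradient, in particular the chosen representative, may
    be used to estimate test functions. *)
Lemma dirichlet_le U f v (M : R) : open U -> test_function U f ->
  is_weak_gradient U f v ->
  (\int[mu]_(z in U) ((v z).1 ^+ 2 + (v z).2 ^+ 2)%:E <= M%:E)%E ->
  (\int[mu]_(z in U) (partial false f z ^+ 2 + partial true f z ^+ 2)%:E <= M%:E)%E.
Proof.
move=> oU tf [lv1 lv2 fv1 fv2] vM.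
have mU : measurable (U : set (plane R)) by exact: open_measurable_plane.
have mv1 := locally_integrable_measurable oU lv1.
have mv2 := locally_integrable_measurable oU lv2.
have tp i := test_partial i tf.
have C1p i := test_C1 (tp i).
have cp i : continuous (partial i f) by exact: C1_off_continuous (C1p i).
have mp i : measurable_fun (U : set (plane R)) (partial i f : plane R -> R).
  by apply: measurable_funS (continuous_measurable_plane (cp i)).
have I h i : locally_integrable U h -> mu.-integrable U (fun z => (h z * partial i f z)%:E).
  move=> lh; have [_ cK KU] := tp i.
  exact: locally_integrable_mul lh cK KU (cp i) (@off_support _ _).
have Ip i : mu.-integrable U (fun z => (partial i f z ^+ 2)%:E).
  have := I (partial i f) i (continuous_locally_integrable (cp i)).
  by apply: eq_integrable => // z _; rewrite expr2.
have E i h : locally_integrable U h -> is_weak_partial U i f h ->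
    (\int[mu]_(z in U) (partial i f z ^+ 2)%:E = \int[mu]_(z in U) (h z * partial i f z)%:E)%E.
  move=> lh fh; have := fh _ (tp i); rewrite (test_weak_partial i tf (tp i)) => /oppe_inj <-.
  by apply: eq_integral => z _; rewrite expr2.
have E1 := E false _ lv1 fv1; have E2 := E true _ lv2 fv2.
have sq0 (x y : R) : (0 <= (x ^+ 2 + y ^+ 2)%:E)%E by rewrite lee_fin addr_ge0 ?sqr_ge0.
set D := (\int[mu]_(z in U) (partial false f z ^+ 2 + partial true f z ^+ 2)%:E)%E.
have Dfin : D \is a fin_num.
  apply: integrable_fin_num => //.
  by apply: eq_integrable (integrableD mU (Ip false) (Ip true)).
have DE : D = (\int[mu]_(z in U) ((v z).1 * partial false f z + (v z).2 * partial true f z)%:E)%E.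
  rewrite /D; under eq_integral do rewrite EFinD.
  rewrite (integralD mU (Ip false) (Ip true)) E1 E2.
  under [RHS]eq_integral do rewrite EFinD.
  by rewrite (integralD mU (I _ false lv1) (I _ true lv2)).
have mD : measurable_fun (U : set (plane R)) (fun z => (partial false f z ^+ 2 + partial true f z ^+ 2)%:E).
  by apply/measurable_EFinP; apply: measurable_funD; apply: measurable_funX; exact: mp.
have mV : measurable_fun (U : set (plane R)) (fun z => ((v z).1 ^+ 2 + (v z).2 ^+ 2)%:E).
  by apply/measurable_EFinP; apply: measurable_funD; apply: measurable_funX.
have h : (2%:E * D <= (\int[mu]_(z in U) ((v z).1 ^+ 2 + (v z).2 ^+ 2)%:E) + D)%E.
  have <- : (\int[mu]_(z in U) (((v z).1 ^+ 2 + (v z).2 ^+ 2)%:E +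
      (partial false f z ^+ 2 + partial true f z ^+ 2)%:E) =
      \int[mu]_(z in U) ((v z).1 ^+ 2 + (v z).2 ^+ 2)%:E + D)%E.
    by rewrite ge0_integralD.
  have -> : (2%:E * D = \int[mu]_(z in U) (2%:E * ((v z).1 * partial false f z + (v z).2 * partial true f z)%:E))%E.
    rewrite DE integralZl//.
    by apply: eq_integrable (integrableD mU (I _ false lv1) (I _ true lv2)).
  apply: (@le_trans _ _ (\int[mu]_(z in U) `|2%:E * ((v z).1 * partial false f z + (v z).2 * partial true f z)%:E|)%E).
    apply: le_trans (lee_abs _) _; apply: le_abse_integral => //.
    apply: measurable_funeM; apply/measurable_EFinP; apply: measurable_funD; exact: measurable_funM.
  apply: ge0_le_integral => //.
  - apply: measurableT_comp => //; apply: measurable_funeM; apply/measurable_EFinP.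
    by apply: measurable_funD; exact: measurable_funM.
  - exact: emeasurable_funD.
  - move=> z _; rewrite -EFinM abse_EFin -EFinD lee_fin ler_norml.
    set a := (v z).1; set b := (v z).2; set c := partial _ _ _; set d := partial _ _ _.
    have h1 := sqr_ge0 (a - c); have h2 := sqr_ge0 (b - d).
    have h3 := sqr_ge0 (a + c); have h4 := sqr_ge0 (b + d).
    by apply/andP; split; nra.
have := le_trans h (leeD vM (lexx D)).
by rewrite -(fineK Dfin) -EFinM -EFinD !lee_fin; lra.
Qed.

End weak_gradients.

(** * The Dirichlet integral of test functions *)

Section dirichlet_integral.
Variable R : realType.
Local Notation mu := (lebesgue2 R).
Implicit Types (f g : R * R -> R).

Definition dirichlet (U : set (R * R)) f : \bar R :=
  (\int[mu]_(z in U) (partial false f z ^+ 2 + partial true f z ^+ 2)%:E)%E.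

Definition weighted_integral (U : set (R * R)) (r : R) (h : R * R -> R) f : \bar R :=
  (\int[mu]_(z in U) (`|f z| `^ r * h z)%:E)%E.

Lemma test_continuous U f : test_function U f -> continuous f.
Proof. by move=> tf; exact: C1_off_continuous (test_C1 tf). Qed.

Lemma test_measurable U f : test_function U f -> measurable_fun [set: plane R] (f : plane R -> R).
Proof. by move=> tf; apply: continuous_measurable_plane; exact: test_continuous tf. Qed.

Lemma partial_measurable U f i : test_function U f ->
  measurable_fun [set: plane R] (partial i f : plane R -> R).
Proof. by move=> tf; exact: test_measurable (test_partial i tf). Qed.

Lemma dirichletB U f g (E : R) : open U -> test_function U f -> test_function U g ->
  (dirichlet U f <= E%:E)%E -> (dirichlet U g <= E%:E)%E ->
  (dirichlet U (f \- g)%R <= (4 * E)%:E)%E.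
Proof.
move=> oU tf tg fE gE.
have mU : measurable (U : set (plane R)) by exact: open_measurable_plane.
have mq k : test_function U k ->
    measurable_fun (U : set (plane R)) (fun z => (partial false k z ^+ 2 + partial true k z ^+ 2)%:E).
  move=> tk; apply/measurable_EFinP; apply: measurable_funS measurableT (@subsetT _ _) _.
  by apply: measurable_funD; apply: measurable_funX; exact: partial_measurable tk.
have q0 k z : (0 <= (partial false k z ^+ 2 + partial true k z ^+ 2)%:E)%E.
  by rewrite lee_fin addr_ge0// sqr_ge0.
apply: (@le_trans _ _ (2%:E * (dirichlet U f + dirichlet U g))%E); last first.
  apply: (@le_trans _ _ (2%:E * (E%:E + E%:E))%E).
    by apply: lee_wpmul2l => //; exact: leeD.
  by rewrite -EFinD -EFinM lee_fin; lra.
rewrite /dirichlet -ge0_integralD//; [|exact: mq..].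
rewrite -ge0_integralZl//; last 2 first.
- by apply: emeasurable_funD; exact: mq.
- by move=> z _; rewrite adde_ge0.
apply: ge0_le_integral => //.
- by apply: mq; exact: test_sub.
- by apply: measurable_funeM; apply: emeasurable_funD; exact: mq.
- move=> z _; rewrite !(partialB _ _ tf tg) -EFinD -EFinM lee_fin.
  set x := partial _ f z; set y := partial _ g z; set x' := partial _ f z; set y' := partial _ g z.
  have h1 := sqr_ge0 (x + y); have h2 := sqr_ge0 (x' + y'); nra.
Qed.

End dirichlet_integral.

(** * Transport to the disc *)

Section transport.
Variable R : realType.
Local Notation mu := (lebesgue2 R).
Local Notation e1 := (expR 1 : R).
Variables (U D : set (R * R)) (T S : R * R -> R * R) (a b : R * R -> R).
Hypotheses (oU : open U) (oD : open D) (DS : D `<=` @ref_square R).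
Hypotheses (mT : measurable_fun [set: plane R] (T : plane R -> plane R))
           (mS : measurable_fun [set: plane R] (S : plane R -> plane R)).
Hypotheses (TU : forall x, U x -> D (T x) /\ S (T x) = x)
           (SD : forall y, D y -> U (S y) /\ T (S y) = y).
Hypotheses (ma : measurable_fun (U : set (plane R)) (a : plane R -> R))
           (mb : measurable_fun (D : set (plane R)) (b : plane R -> R)).
Hypotheses (a0 : forall x, U x -> 0 < a x) (b0 : forall y, D y -> 0 < b y)
           (ab : forall y, D y -> a (S y) * b y = 1).
Hypothesis Tlip : forall x, U x -> exists2 e, 0 < e & forall x', U x' ->
  `|x' - x| < e -> `|T x' - T x| <= 2 * a x * `|x' - x|.
Hypothesis Slip : forall y, D y -> exists2 e, 0 < e & forall y', D y' ->
  `|y' - y| < e -> `|S y' - S y| <= 2 * b y * `|y' - y|.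

Let mU : measurable (U : set (plane R)). Proof. exact: open_measurable_plane. Qed.
Let mD : measurable (D : set (plane R)). Proof. exact: open_measurable_plane. Qed.

Definition pullback (f : R * R -> R) (y : R * R) : R :=
  if `[< D y >] then f (S y) else 0.

Lemma pullbackE f y : D y -> pullback f y = f (S y).
Proof. by rewrite /pullback; case: asboolP. Qed.

Lemma pullback_off f y : ~ D y -> pullback f y = 0.
Proof. by rewrite /pullback; case: asboolP. Qed.

(** The change of variables along [S], where [2 * b] is the Lipschitz
    constant: its square cancels the weight. *)
Lemma integral_weight_le (G : plane R -> R) :
  measurable_fun (U : set (plane R)) G -> (forall x, U x -> 0 <= G x) ->
  (\int[mu]_(x in U) (G x * a x ^+ 2)%:E <=
  (16 * e1)%:E * \int[mu]_(y in D) (G (S y))%:E)%E.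
Proof.
move=> mG G0.
have mGa : measurable_fun (U : set (plane R)) (fun x => (G x * a x ^+ 2)%:E).
  by apply/measurable_EFinP; apply: measurable_funM => //; exact: measurable_funX.
have mGS : measurable_fun (D : set (plane R)) (fun y => (G (S y))%:E).
  apply/measurable_EFinP; apply: (@measurable_comp _ _ _ _ _ _ (U : set (plane R)) G) => //.
    by move=> _ [y Dy <-]; have [] := SD Dy.
  exact: measurable_funS mS.
have p y : D y -> (0 <= (G (S y))%:E)%E by move=> /SD[/G0 ? _]; rewrite lee_fin.
have c0 : (0 <= (16 * e1)%:E)%E by rewrite lee_fin mulr_ge0// expR_ge0.
rewrite -(ge0_integralZl _ mD mGS p c0).
apply: le_trans (@lipschitz_change_of_variables R D U S T (fun y => 2 * b y) _ _ _ _ _ _ _ _ _ _ mGa _) _ => //.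
- by move=> y /SD[].
- by apply: measurable_funM => //; exact: measurable_cst.
- by move=> y Dy; rewrite mulr_gt0// b0.
- by move=> x Ux; rewrite lee_fin mulr_ge0 ?G0// sqr_ge0.
rewrite le_eqVlt; apply/orP; left; apply/eqP; apply: eq_integral => y /set_mem Dy.
rewrite -!EFinM; congr EFin.
have h : (a (S y) * b y) ^+ 2 = 1 by rewrite ab// expr1n.
transitivity (16 * e1 * G (S y) * (a (S y) * b y) ^+ 2); first by ring.
by rewrite h mulr1.
Qed.

(** Conformal invariance of the Dirichlet integral: the chain rule contributes
    the factor [b ^+ 2], which the change of variables along [T] cancels. *)
Lemma integral_energy_le (G : plane R -> R) :
  measurable_fun (U : set (plane R)) G -> (forall x, U x -> 0 <= G x) ->
  (\int[mu]_(y in D) (G (S y) * b y ^+ 2)%:E <=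
  (16 * e1)%:E * \int[mu]_(x in U) (G x)%:E)%E.
Proof.
move=> mG G0.
have mGS : measurable_fun (D : set (plane R)) (fun y => (G (S y) * b y ^+ 2)%:E).
  apply/measurable_EFinP; apply: measurable_funM; last exact: measurable_funX.
  apply: (@measurable_comp _ _ _ _ _ _ (U : set (plane R)) G) => //.
    by move=> _ [y Dy <-]; have [] := SD Dy.
  exact: measurable_funS mS.
have p x : U x -> (0 <= (G x)%:E)%E by move=> /G0; rewrite lee_fin.
have c0 : (0 <= (16 * e1)%:E)%E by rewrite lee_fin mulr_ge0// expR_ge0.
have mGE : measurable_fun (U : set (plane R)) (fun x => (G x)%:E) by exact/measurable_EFinP.
rewrite -(ge0_integralZl _ mU mGE p c0).
apply: le_trans (@lipschitz_change_of_variables R U D T S (fun x => 2 * a x) _ _ _ _ _ _ _ _ _ _ mGS _) _ => //.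
- by move=> x /TU[].
- by apply: measurable_funM => //; exact: measurable_cst.
- by move=> x Ux; rewrite mulr_gt0// a0.
- by move=> y Dy; rewrite lee_fin mulr_ge0 ?sqr_ge0// G0//; have [] := SD Dy.
rewrite le_eqVlt; apply/orP; left; apply/eqP; apply: eq_integral => x /set_mem Ux.
rewrite -!EFinM; congr EFin; have [DT STx] := TU Ux; rewrite STx.
have h : (a x * b (T x)) ^+ 2 = 1 by have := ab DT; rewrite STx => ->; rewrite expr1n.
transitivity (16 * e1 * G x * (a x * b (T x)) ^+ 2); first by ring.
by rewrite h mulr1.
Qed.

Lemma T_continuous_in x : U x -> {for x, continuous T}.
Proof.
move=> Ux; apply/cvgrPdist_lt => eps eps0.
have [e e0 He] := Tlip Ux; have /plane_nbhsP[d d0 dU] : nbhs x U by apply: open_nbhs_nbhs.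
have a2 : 0 < 2 * a x by rewrite mulr_gt0// a0.
apply/plane_nbhsP; exists (Num.min d (Num.min e (eps / (2 * a x)))).
  by rewrite !lt_min d0 e0 divr_gt0.
move=> y; rewrite !lt_min => /and3P[y1 y2 y3].
rewrite distrC (le_lt_trans (He _ (dU _ y1) y2))// mulrC -ltr_pdivlMr//.
Qed.

(** Inside [D] this is the chain rule. Near a point outside of [D] the
    pullback vanishes, since its support is the image under [T] of a compact
    set, hence is closed: no regularity of [S] at the boundary is involved. *)
Lemma pullback_slope (f n : R * R -> R) (K : set (R * R)) :
  slope_bound f n -> compact K -> K `<=` U -> (forall x, ~ K x -> f x = 0) ->
  slope_bound (pullback f) (fun y => if `[< D y >] then 2 * n (S y) * b y else 0).
Proof.
move=> [mn n0 nloc] cK KU fK; split.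
- rewrite (_ : (fun y => _) = ((fun y => 2 * n (S y) * b y) \_ D)); last first.
    apply/funext => y; rewrite patchE; case: asboolP => Dy; first by rewrite mem_set.
    by rewrite memNset.
  have m1 : measurable_fun (D : set (plane R)) (fun y : plane R => n (S y)).
    by apply: measurable_funS (measurableT_comp mn mS).
  have m2 : measurable_fun (D : set (plane R)) (fun y : plane R => 2 * n (S y) * b y).
    by apply: measurable_funM => //; apply: measurable_funM => //; exact: measurable_cst.
  exact: (proj1 (measurable_restrictT _ mD) m2).
- by move=> y; case: asboolP => // Dy; rewrite mulr_ge0 ?(ltW (b0 Dy))// mulr_ge0.
- move=> y eps eps0; case: asboolP => Dy.
    have b2 : 0 < 2 * b y by rewrite mulr_gt0// b0.
    have [d1 d10 H1] := nloc (S y) (eps / (2 * b y)) (divr_gt0 eps0 b2).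
    have [d2 d20 H2] := Slip Dy.
    have /plane_nbhsP[d3 d30 H3] : nbhs y D by apply: open_nbhs_nbhs.
    exists (Num.min d3 (Num.min d2 (d1 / (2 * b y)))); first by rewrite !lt_min d30 d20 divr_gt0.
    move=> y'; rewrite !lt_min => /and3P[y1 y2 y3].
    have Dy' := H3 _ y1; rewrite !pullbackE//.
    have h := H2 _ Dy' y2.
    have h' : `|S y' - S y| < d1 by rewrite (le_lt_trans h)// mulrC -ltr_pdivlMr.
    have ne0 : 0 <= n (S y) + eps / (2 * b y) by rewrite addr_ge0// divr_ge0 ?ltW.
    apply: le_trans (H1 _ h') _; apply: le_trans (ler_wpM2l ne0 h) _.
    rewrite mulrA le_eqVlt; apply/orP; left; apply/eqP; congr (_ * _).
    by field; rewrite gt_eqF// b0.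
  have cTK : compact (T @` K).
    apply: continuous_compact => //; apply: continuous_in_subspaceT => x /set_mem /KU Ux.
    exact: T_continuous_in.
  have : nbhs y (~` (T @` K)).
    apply: open_nbhs_nbhs; split.
      by apply: closed_openC; apply: compact_closed => //; exact: norm_hausdorff.
    by move=> [x Kx xy]; apply: Dy; rewrite -xy; have [] := TU (KU _ Kx).
  move=> /plane_nbhsP[d d0 Hd]; exists d => // y' yy'.
  rewrite (pullback_off _ Dy) subr0.
  have -> : pullback f y' = 0.
    rewrite /pullback; case: asboolP => // Dy'; apply: fK => KS; apply: (Hd _ yy').
    by exists (S y') => //; have [] := SD Dy'.
  by rewrite normr0 mulr_ge0// add0r ltW.
Qed.

Lemma pullback_energy (f n : R * R -> R) (K : set (R * R)) (E : R) :
  slope_bound f n -> compact K -> K `<=` U -> (forall x, ~ K x -> f x = 0) ->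
  (\int[mu]_(x in U) (n x ^+ 2)%:E <= E%:E)%E ->
  energy_le (64 * e1 * E) (pullback f).
Proof.
move=> sf cK KU fK nE; have [mn n0 _] := sf.
exists (fun y => if `[< D y >] then 2 * n (S y) * b y else 0); split.
- exact: pullback_slope sf cK KU fK.
- by move=> w nS; apply: pullback_off => /DS.
- by move=> w nS; case: asboolP => // /DS.
- have -> : (\int[mu]_(z in @ref_square R) ((if `[< D z >] then 2 * n (S z) * b z else 0) ^+ 2)%:E =
     \int[mu]_(z in D) (4 * n (S z) ^+ 2 * b z ^+ 2)%:E)%E.
    rewrite [LHS]integral_mkcond [RHS]integral_mkcond; apply: eq_integral => z _.
    rewrite !patchE; have [Dz|nDz] := pselect (D z).
      rewrite mem_set; last exact: DS.
      by rewrite mem_set// asboolT//; congr EFin; ring.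
    by rewrite asboolF// (memNset nDz) expr0n if_same.
  apply: le_trans (@integral_energy_le (fun x => 4 * n x ^+ 2) _ _) _.
  + apply: measurable_funM; first exact: measurable_cst.
    by apply: measurable_funX; exact: measurable_funS mn.
  + by move=> x _; rewrite mulr_ge0// sqr_ge0.
  have mn2 : measurable_fun (U : set (plane R)) (fun x => (n x ^+ 2)%:E).
    by apply/measurable_EFinP; apply: measurable_funX; exact: measurable_funS mn.
  have -> : (\int[mu]_(x in U) (4 * n x ^+ 2)%:E = 4%:E * \int[mu]_(x in U) (n x ^+ 2)%:E)%E.
    by rewrite -(ge0_integralZl _ mU mn2)// => x _; rewrite lee_fin sqr_ge0.
  have -> : (64 * e1 * E)%:E = ((16 * e1)%:E * (4%:E * E%:E))%E.
    by rewrite -!EFinM; congr EFin; ring.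
  apply: lee_wpmul2l; first by rewrite lee_fin mulr_ge0// expR_ge0.
  exact: lee_wpmul2l.
Qed.

Lemma pullback_lp (f : R * R -> R) (r : R) :
  measurable_fun (U : set (plane R)) (f : plane R -> R) ->
  (\int[mu]_(x in U) (`|f x| `^ r * a x ^+ 2)%:E <=
  (16 * e1)%:E * \int[mu]_(y in @ref_square R) (`|pullback f y| `^ r)%:E)%E.
Proof.
move=> mf.
have mfr : measurable_fun (U : set (plane R)) (fun x => `|f x| `^ r).
  apply: (measurableT_comp (measurable_powR r)); exact: measurableT_comp.
apply: le_trans (integral_weight_le mfr _) _; first by move=> x _; exact: powR_ge0.
apply: lee_wpmul2l; first by rewrite lee_fin mulr_ge0// expR_ge0.
rewrite [leLHS](_ : _ = \int[mu]_(y in D) (`|pullback f y| `^ r)%:E)%E; last first.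
  by apply: eq_integral => y /set_mem Dy; rewrite pullbackE.
have m2 : measurable_fun (D : set (plane R)) (fun y : plane R => f (S y)).
  apply: (@measurable_comp _ _ _ _ _ _ (U : set (plane R)) (f : plane R -> R)) => //.
    by move=> _ [y Dy <-]; have [] := SD Dy.
  exact: measurable_funS mS.
have m3 : measurable_fun [set: plane R] (pullback f : plane R -> R).
  rewrite (_ : pullback f = ((fun y => f (S y)) \_ D)).
    exact: (proj1 (measurable_restrictT _ mD) m2).
  apply/funext => y; rewrite patchE /pullback; case: asboolP => Dy; first by rewrite mem_set.
  by rewrite memNset.
apply: ge0_subset_integral => //; first exact: ref_square_measurable.
apply/measurable_EFinP; apply: measurable_funS measurableT (@subsetT _ _) _ => //.
by apply: (measurableT_comp (measurable_powR r)); exact: measurableT_comp.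
Qed.

Local Notation N r f := (weighted_integral U r (fun z => a z ^+ 2) f).

Lemma test_pullback_energy f (E : R) : test_function U f ->
  (dirichlet U f <= E%:E)%E -> energy_le (128 * e1 * E) (pullback f).
Proof.
move=> tf fE; have [_ cK KU] := tf.
have := @pullback_energy f (fun z => `|partial false f z| + `|partial true f z|) (support_closure f) (2 * E)
  (C1_slope (test_C1 tf)) cK KU (@off_support R f).
rewrite (_ : 64 * e1 * (2 * E) = 128 * e1 * E); last by ring.
apply; rewrite EFinM; apply: le_trans (lee_wpmul2l _ fE) => //.
have mq : measurable_fun (U : set (plane R)) (fun z => (partial false f z ^+ 2 + partial true f z ^+ 2)%:E).
  apply/measurable_EFinP; apply: measurable_funS measurableT (@subsetT _ _) _.
  by apply: measurable_funD; apply: measurable_funX; exact: partial_measurable tf.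
have q0 z : (0 <= (partial false f z ^+ 2 + partial true f z ^+ 2)%:E)%E.
  by rewrite lee_fin addr_ge0// sqr_ge0.
rewrite /dirichlet -ge0_integralZl//.
apply: ge0_le_integral => //.
- apply/measurable_EFinP; apply: measurable_funS measurableT (@subsetT _ _) _.
  apply: measurable_funX; apply: measurable_funD; apply: measurableT_comp => //; exact: partial_measurable tf.
- exact: measurable_funeM.
- move=> z _; rewrite -EFinM lee_fin.
  rewrite -[(partial false f z ^+ 2)]real_normK ?num_real// -[(partial true f z ^+ 2)]real_normK ?num_real//.
  by have := sqr_ge0 (`|partial false f z| - `|partial true f z|); nra.
Qed.

Lemma test_weighted_le f r : test_function U f ->
  (N r f <= (16 * e1)%:E * \int[mu]_(y in @ref_square R) (`|pullback f y| `^ r)%:E)%E.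
Proof.
move=> tf; apply: pullback_lp.
exact: measurable_funS measurableT (@subsetT _ _) (test_measurable tf).
Qed.

Let c0 : (0 < 16 * e1). Proof. by rewrite mulr_gt0// expR_gt0. Qed.
Let c1 : (0 < 128 * e1). Proof. by rewrite mulr_gt0// expR_gt0. Qed.

(** This lemma and the next two are the estimates on the square, read on [U]:
    for test functions, the weighted norm is continuous and compact with
    respect to the Dirichlet integral. *)
Lemma embedding_vanishing r (eps : R) : 1 <= r -> 0 < eps ->
  exists2 E : R, 0 < E & forall f, test_function U f ->
    (dirichlet U f <= E%:E)%E -> (N r f <= eps%:E)%E.
Proof.
move=> r1 eps0; have e0 : 0 < eps / (16 * e1) by rewrite divr_gt0.
have [E E0 H] := energy_lp_vanishing r1 e0.
exists (E / (128 * e1)); first by rewrite divr_gt0.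
move=> f tf /(test_pullback_energy tf); rewrite mulrC divfK ?gt_eqF// => /H h.
apply: le_trans (test_weighted_le r tf) _.
apply: le_trans (lee_wpmul2l _ h) _; first by rewrite lee_fin ltW.
by rewrite -EFinM lee_fin mulrC divfK ?gt_eqF.
Qed.

Lemma embedding_bounded r (E : R) : 1 <= r ->
  exists B : R, forall f, test_function U f ->
    (dirichlet U f <= E%:E)%E -> (N r f <= B%:E)%E.
Proof.
move=> r1; have [B HB] := energy_lp_bounded (128 * e1 * E) r1.
exists (16 * e1 * B) => f tf /(test_pullback_energy tf) /HB h.
apply: le_trans (test_weighted_le r tf) _.
by rewrite EFinM; apply: lee_wpmul2l h; rewrite lee_fin ltW.
Qed.

Lemma embedding_precompact r (E eps : R) (F : set_system nat) (psi : nat -> R * R -> R) :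
  1 <= r -> UltraFilter F -> (forall n, test_function U (psi n)) ->
  (forall n, dirichlet U (psi n) <= E%:E)%E -> 0 < eps ->
  exists2 A, F A & forall n m, A n -> A m -> (N r (psi n \- psi m)%R <= eps%:E)%E.
Proof.
move=> r1 UF tpsi psiE eps0.
pose E' := 128 * e1 * (4 * E).
have E0 : 0 <= E.
  by rewrite -lee_fin; apply: le_trans (psiE 0%N); apply: integral_ge0 => z _; rewrite lee_fin addr_ge0// sqr_ge0.
have en n : energy_le E' (pullback (psi n)).
  apply: (@energy_le_mono _ (128 * e1 * E)); last by apply: test_pullback_energy.
  by rewrite /E' ler_wpM2l ?(ltW c1)//; lra.
have pullbackB n m : pullback (psi n \- psi m) = (fun z => pullback (psi n) z - pullback (psi m) z).
  by apply/funext => z; rewrite /pullback; case: asboolP => //; rewrite subr0.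
have enm n m : energy_le E' (fun z => pullback (psi n) z - pullback (psi m) z).
  by rewrite -pullbackB; apply: test_pullback_energy; [exact: test_sub|exact: dirichletB].
have e0 : 0 < eps / (16 * e1) by rewrite divr_gt0.
have [d d0 Hd] := energy_lp_small E' r1 e0.
have [A FA HA] := @rellich R F E' d (fun n => pullback (psi n)) UF en enm d0.
exists A => // n m An Am.
apply: le_trans (test_weighted_le r (test_sub (tpsi n) (tpsi m))) _.
have := Hd _ (enm n m) (HA n m An Am); rewrite pullbackB => h.
apply: le_trans (lee_wpmul2l _ h) _; first by rewrite lee_fin ltW.
by rewrite -EFinM lee_fin mulrC divfK ?gt_eqF.
Qed.

End transport.

(** * Almost everywhere limits and extraction *)

Section almost_everywhere_limits.
Variables (R : realType) (d : measure_display) (T : measurableType d).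
Variables (mu : {measure set T -> \bar R}) (D : set T).
Hypothesis mD : measurable D.

Lemma powR_cvg (r : R) (u : nat -> R) (l : R) : 1 <= r -> (forall n, 0 <= u n) ->
  u n @[n --> \oo] --> l -> (u n `^ r) @[n --> \oo] --> l `^ r.
Proof.
move=> r1 u0 ul; have r0 : 0 < r by exact: lt_le_trans r1.
have l0 : 0 <= l.
  have <- : limn u = l by exact/cvg_lim.
  by apply: limr_ge; [apply/cvg_ex; exists l|exact: nearW].
have [lE|lN0] := eqVneq l 0.
  rewrite lE powR0 ?gt_eqF//; apply/cvgrPdist_le => eps eps0.
  move: ul; rewrite lE => /cvgrPdist_le/(_ (Num.min eps 1)).
  rewrite lt_min eps0 => /(_ ltr01); apply: filterS => n; rewrite !sub0r !normrN le_min => /andP[h1 h2].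
  rewrite ger0_norm ?powR_ge0//; rewrite ger0_norm// in h1 h2.
  apply: le_trans h1; have [->|un0] := eqVneq (u n) 0; first by rewrite powR0 ?gt_eqF.
  have up : 0 < u n by rewrite lt_neqAle eq_sym un0 u0.
  rewrite -[leRHS]powRr1//; have -> : r = 1 + (r - 1) by rewrite addrC subrK.
  rewrite powRD ?un0 ?implybT// powRr1// ler_piMr//.
  have := @ge0_ler_powR R (r - 1) _ (u n) 1; rewrite powR1 !nnegrE subr_ge0.
  by apply.
have lp : 0 < l by rewrite lt_neqAle eq_sym lN0.
rewrite /powR (negbTE lN0).
have c : {for l, continuous (fun x : R => expR (r * ln x))}.
  apply: continuous_comp; last exact: continuous_expR.
  by apply: continuousM; [exact: cst_continuous|exact: continuous_ln].
apply: (@cvg_trans _ ((fun n => expR (r * ln (u n))) @ \oo)); last exact: (cvg_comp _ _ ul c).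
apply: near_eq_cvg; move/cvgrPdist_lt : ul => /(_ _ lp); apply: filterS => n.
by case: eqP => // ->; rewrite subr0 ger0_norm// ltxx.
Qed.

Local Open Scope ereal_scope.

Lemma measurable_limn_einf (f : nat -> T -> \bar R) :
  (forall n, measurable_fun D (f n)) -> measurable_fun D (fun x => limn_einf (f^~ x)).
Proof.
move=> mf; apply: measurableT_comp => //.
by apply: (@measurable_fun_limn_esup _ _ _ D (fun n x => - f n x)) => n; exact: measurableT_comp.
Qed.

Lemma fatou_ae (f : T -> \bar R) (F : nat -> T -> \bar R) (B : \bar R) :
  measurable_fun D f -> (forall n, measurable_fun D (F n)) ->
  (forall x, D x -> 0 <= f x) -> (forall n x, D x -> 0 <= F n x) ->
  {ae mu, forall x, D x -> F n x @[n --> \oo] --> f x} ->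
  (forall n, \int[mu]_(x in D) F n x <= B) -> \int[mu]_(x in D) f x <= B.
Proof.
move=> mf mF f0 F0 Ff FB.
have l0 x : D x -> 0 <= limn_einf (F^~ x).
  move=> Dx; rewrite limn_einf_lim; apply: lime_ge; first exact: is_cvg_einfs.
  by apply: nearW => n; apply: le_ereal_inf_tmp => _ [m _ <-]; exact: F0.
apply: (@le_trans _ _ (\int[mu]_(x in D) limn_einf (F^~ x))).
  apply: ae_ge0_le_integral => //; first exact: measurable_limn_einf.
  by apply: filterS Ff => x h Dx; have [-> _] := cvg_limn_einf_sup (h Dx).
apply: le_trans (fatou mu mD mF F0) _; rewrite limn_einf_lim.
apply: lime_le; first exact: is_cvg_einfs.
apply: nearW => n; apply: le_trans (FB n); apply: ereal_inf_lbound; exists n => //=.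
Qed.

(** A fast rate of decay in L1 lets the series be integrated term by term. *)
Lemma ae_cvg_series (p : nat -> T -> R) :
  (forall n, measurable_fun D (p n)) -> (forall n x, D x -> (0 <= p n x)%R) ->
  (forall n, \int[mu]_(x in D) (p n x)%:E <= (1 / (2 ^ n.+1)%:R)%:E) ->
  {ae mu, forall x, D x -> cvgn (series (p ^~ x))}.
Proof.
move=> mp p0 pB.
have mpE n : measurable_fun D (fun x => (p n x)%:E) by exact/measurable_EFinP.
have pE0 n x : D x -> 0 <= (p n x)%:E by move=> /p0; rewrite lee_fin.
have mS : measurable_fun D (fun x => \sum_(0 <= n <oo) (p n x)%:E).
  by apply: ge0_emeasurable_sum => // n x Dx _; exact: pE0.
have S0 x : D x -> 0 <= \sum_(0 <= n <oo) (p n x)%:E.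
  by move=> Dx; apply: nneseries_ge0 => n _ _; exact: pE0.
have iS : mu.-integrable D (fun x => \sum_(0 <= n <oo) (p n x)%:E).
  apply/integrableP; split=> //.
  have -> : \int[mu]_(x in D) `|\sum_(0 <= n <oo) (p n x)%:E| =
      \int[mu]_(x in D) \sum_(0 <= n <oo) (p n x)%:E.
    by apply: eq_integral => x /set_mem Dx; rewrite gee0_abs// S0.
  rewrite integral_nneseries//; apply: (@le_lt_trans _ _ 1%:E); last by rewrite ltry.
  apply: le_trans (@epsilon_trick0 R 1 xpredT ler01).
  apply: lee_nneseries => [n _|n _]; last exact: pB.
  by move=> *; apply: integral_ge0 => x; exact: pE0.
apply: filterS (integrable_ae mD iS) => x h Dx; have fx := h Dx.
apply: nondecreasing_is_cvgn.
  by apply: nondecreasing_series => n _ _; exact: p0.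
exists (fine (\sum_(0 <= n <oo) (p n x)%:E)) => _ [n _ <-].
rewrite -lee_fin fineK// /series /= -sumEFin.
by apply: (nneseries_lim_ge (u_ := fun n => (p n x)%:E)) => k _ _; exact: pE0.
Qed.

Lemma ae_cvg_to0 (p : nat -> T -> R) :
  (forall n, measurable_fun D (p n)) -> (forall n x, D x -> (0 <= p n x)%R) ->
  (forall n, \int[mu]_(x in D) (p n x)%:E <= (1 / (2 ^ n.+1)%:R)%:E) ->
  {ae mu, forall x, D x -> (p n x @[n --> \oo] --> 0)%R}.
Proof.
move=> mp p0 pB; apply: filterS (ae_cvg_series mp p0 pB) => x h Dx.
exact: cvg_series_cvg_0 (h Dx).
Qed.

Lemma ae_limit (f : nat -> T -> R) (w : T -> R) :
  (forall n, measurable_fun D (f n)) -> measurable_fun D w ->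
  (forall x, D x -> (0 < w x)%R) ->
  (forall n, \int[mu]_(x in D) (`|f n.+1 x - f n x| * w x)%:E <= (1 / (2 ^ n.+1)%:R)%:E) ->
  exists2 g : T -> R, measurable_fun D g &
    {ae mu, forall x, D x -> (f n x @[n --> \oo] --> g x)%R}.
Proof.
move=> mf mw w0 fB.
pose g x := fine (limn_esup (fun n => (f n x)%:E)).
exists g.
  apply: (measurableT_comp (fine_measurable measurableT)).
  by apply: (@measurable_fun_limn_esup _ _ _ D (fun n x => (f n x)%:E)) => n; exact/measurable_EFinP.
have mp n : measurable_fun D (fun x => `|f n.+1 x - f n x| * w x)%R.
  by apply: measurable_funM => //; apply: measurableT_comp => //; exact: measurable_funB.
have p0 n x : D x -> (0 <= `|f n.+1 x - f n x| * w x)%R.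
  by move=> Dx; rewrite mulr_ge0// ltW// w0.
have H := ae_cvg_series mp p0 fB.
apply: filterS H => x h Dx; have wx := w0 _ Dx.
have cs : cvgn (series (fun n => `|f n.+1 x - f n x|%R)).
  have -> : series (fun n => `|f n.+1 x - f n x|%R) =
      (fun n => (w x)^-1 * series (fun n => (`|f n.+1 x - f n x| * w x)%R) n)%R.
    apply/funext => n; rewrite /series /= mulr_sumr; apply: eq_bigr => i _.
    by rewrite mulrC mulfK// gt_eqF.
  by apply: is_cvgMr; exact: h.
have cf : cvgn (f ^~ x).
  have cd : cvgn (series (fun n => f n.+1 x - f n x)%R) by apply: normed_cvg.
  have -> : f ^~ x = (fun n => series (fun n => f n.+1 x - f n x)%R n + f 0%N x)%R.
    by apply/funext => n; rewrite /series /= telescope_sumr// subrK.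
  by apply: is_cvgD => //; exact: is_cvg_cst.
have [l fl] := proj1 (cvg_ex _) cf.
suff -> : g x = l by [].
rewrite /g; have : (f n x)%:E @[n --> \oo] --> l%:E.
  by apply: cvg_EFin => //; exact: nearW.
by move=> /cvg_limn_einf_sup[_ ->].
Qed.

End almost_everywhere_limits.

Section extraction.

(** The members of an ultrafilter settle all the scales at once, so a single
    diagonal choice remains. *)
Lemma ultra_extraction (F : set_system nat) (A : nat -> set nat) :
  ProperFilter F -> (\oo `<=` F) -> (forall k, F (A k)) ->
  exists s : nat -> nat, {homo s : m n / (m < n)%N} /\
    forall k l, (k <= l)%N -> A k (s l).
Proof.
move=> PF ooF FA.
pose B k := [set n | forall i, (i <= k)%N -> A i n].
have FB k : F (B k).
  elim: k => [|k IH].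
    by apply: filterS (FA 0%N) => n A0 i; rewrite leqn0 => /eqP ->.
  apply: filterS (filterI IH (FA k.+1)) => n [Bn An] i.
  by rewrite leq_eqVlt ltnS => /predU1P[->|/Bn].
have step k m : exists n, (m < n)%N /\ B k n.
  have : F (B k `&` [set n | (m < n)%N]).
    by apply: filterI => //; apply: ooF; exact: nbhs_infty_gt.
  by move=> /filter_ex[n [Bn mn]]; exists n.
have [f Hf] := choice (fun km : nat * nat => step km.1 km.2).
pose s := fix s k := if k is k'.+1 then f (k, s k') else f (0%N, 0%N).
have sB k : B k (s k) by case: k => [|k]; [have [_] := Hf (0%N, 0%N)|have [_] := Hf (k.+1, s k)].
exists s; split; last by move=> k l kl; exact: sB.
apply: homo_ltn => [y x z xy yz|k]; first exact: ltn_trans xy yz.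
by have [] := Hf (k.+1, s k).
Qed.

End extraction.

(** * Compactness on the closure of the test functions *)

Section sobolev_embedding.
Variable R : realType.
Local Notation mu := (lebesgue2 R).
Local Notation locally_integrable := (@Defs.locally_integrable R).
Implicit Types (f g u psi eta : R * R -> R).
Variables (U : set (R * R)) (h : R * R -> R).
Hypothesis oU : open U.
Hypotheses (mh : measurable_fun (U : set (plane R)) (h : plane R -> R))
  (h0 : forall z, U z -> 0 < h z).
Local Notation N r f := (weighted_integral U r h f).
Hypothesis vanishing : forall r eps, 1 <= r -> 0 < eps ->
  exists2 E : R, 0 < E & forall f, test_function U f ->
    (dirichlet U f <= E%:E)%E -> (N r f <= eps%:E)%E.
Hypothesis bounded : forall r E, 1 <= r ->
  exists B : R, forall f, test_function U f ->
    (dirichlet U f <= E%:E)%E -> (N r f <= B%:E)%E.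
Hypothesis precompact : forall r E eps (F : set_system nat) (psi : nat -> R * R -> R),
  1 <= r -> UltraFilter F -> (forall n, test_function U (psi n)) ->
  (forall n, dirichlet U (psi n) <= E%:E)%E -> 0 < eps ->
  exists2 A, F A & forall n m, A n -> A m -> (N r (psi n \- psi m)%R <= eps%:E)%E.

Let mU : measurable (U : set (plane R)). Proof. exact: open_measurable_plane. Qed.

Let ae_filter : Filter (nbhs (almost_everywhere mu)).
Proof. exact: (ae_filter_ringOfSetsType mu). Qed.

Lemma sqrt_norm_le (x : \bar R) (M : R) : (0 <= x)%E -> 0 <= M ->
  (x `^ 2^-1 <= M%:E -> x <= (M ^+ 2)%:E)%E.
Proof.
move=> x0 M0 H.
have := @gt0_ler_poweR R 2 (ler0n R 2) _ _ _ _ H.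
rewrite -poweRrM mulVf// poweRe1// poweR_EFin powR_mulrn//; apply.
  by rewrite in_itv /= poweR_ge0 leey.
by rewrite in_itv /= lee_fin M0 leey.
Qed.

(** The chosen representative is a weak gradient as soon as one exists. *)
Lemma sobolev_norm_data g (M : R) : weakly_differentiable U g -> 0 <= M ->
  (sobolev_norm U 2 g <= M%:E)%E ->
  exists v, [/\ is_weak_gradient U g v,
    (\int[mu]_(z in U) (g z ^+ 2)%:E <= (M ^+ 2)%:E)%E &
    (\int[mu]_(z in U) ((v z).1 ^+ 2 + (v z).2 ^+ 2)%:E <= (M ^+ 2)%:E)%E].
Proof.
move=> [v0 gv0] M0 H; exists (weak_gradient U g); split.
- exact: (@xgetPex _ (fun=> (0, 0)) [set v | is_weak_gradient U g v] (ex_intro _ v0 gv0)).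
- apply: sqrt_norm_le => //; first by apply: integral_ge0 => z _; rewrite lee_fin sqr_ge0.
  apply: le_trans H; rewrite /sobolev_norm /lebesgue_norm.
  under [X in (_ <= X `^ _ + _)%E]eq_integral do rewrite powR_mulrn// real_normK ?num_real//.
  by rewrite leeDl// poweR_ge0.
- apply: sqrt_norm_le => //.
    by apply: integral_ge0 => z _; rewrite lee_fin addr_ge0// sqr_ge0.
  apply: le_trans H; rewrite /sobolev_norm /lebesgue_norm.
  under [X in (_ <= _ + X `^ _)%E]eq_integral do
    rewrite powR_mulrn// real_normK ?num_real// /euclidean_norm /= sqr_sqrtr ?addr_ge0 ?sqr_ge0//.
  by rewrite leeDr// poweR_ge0.
Qed.

(** A test function written as a difference of Sobolev functions inherits
    their gradient bounds, by [dirichlet_le]. *)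
Lemma dirichlet_difference p q psi v w (A B : R) :
  locally_integrable U p -> locally_integrable U q ->
  is_weak_gradient U p v -> is_weak_gradient U q w ->
  test_function U psi -> p \- q = psi ->
  (\int[mu]_(z in U) ((v z).1 ^+ 2 + (v z).2 ^+ 2)%:E <= A%:E)%E ->
  (\int[mu]_(z in U) ((w z).1 ^+ 2 + (w z).2 ^+ 2)%:E <= B%:E)%E ->
  (dirichlet U psi <= (2 * A + 2 * B)%:E)%E.
Proof.
move=> lp lq pv qw tpsi pq vA wB.
have W := weak_gradientB mU lp lq pv qw; rewrite pq in W.
apply: (dirichlet_le oU tpsi W).
have [v1 v2 _ _] := pv; have [w1 w2 _ _] := qw.
have m1 := locally_integrable_measurable oU v1.
have m2 := locally_integrable_measurable oU v2.
have m3 := locally_integrable_measurable oU w1.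
have m4 := locally_integrable_measurable oU w2.
have mv : measurable_fun (U : set (plane R)) (fun z => ((v z).1 ^+ 2 + (v z).2 ^+ 2)%:E).
  by apply/measurable_EFinP; apply: measurable_funD; apply: measurable_funX.
have mw : measurable_fun (U : set (plane R)) (fun z => ((w z).1 ^+ 2 + (w z).2 ^+ 2)%:E).
  by apply/measurable_EFinP; apply: measurable_funD; apply: measurable_funX.
have s0 (x y : R) : (0 <= (x ^+ 2 + y ^+ 2)%:E)%E by rewrite lee_fin addr_ge0// sqr_ge0.
apply: (@le_trans _ _ (2%:E * (\int[mu]_(z in U) ((v z).1 ^+ 2 + (v z).2 ^+ 2)%:E +
    \int[mu]_(z in U) ((w z).1 ^+ 2 + (w z).2 ^+ 2)%:E))%E); last first.
  rewrite -mulrDr EFinM; apply: lee_wpmul2l => //.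
  by rewrite EFinD; exact: leeD.
rewrite -ge0_integralD// -ge0_integralZl//; last 2 first.
- exact: emeasurable_funD.
- by move=> z _; rewrite adde_ge0.
apply: ge0_le_integral => //.
- apply/measurable_EFinP; apply: measurable_funD; apply: measurable_funX; exact: measurable_funB.
- by apply: measurable_funeM; exact: emeasurable_funD.
- move=> z _; rewrite -EFinD -EFinM lee_fin /=.
  have a1 := sqr_ge0 ((v z).1 + (w z).1); have a2 := sqr_ge0 ((v z).2 + (w z).2); nra.
Qed.

Lemma sobolev0_approx f (e : R) : sobolev0 U 2 f -> 0 < e ->
  exists psi w, [/\ test_function U psi, is_weak_gradient U (f \- psi) w,
    (\int[mu]_(z in U) ((f z - psi z) ^+ 2)%:E <= (e ^+ 2)%:E)%E &
    (\int[mu]_(z in U) ((w z).1 ^+ 2 + (w z).2 ^+ 2)%:E <= (e ^+ 2)%:E)%E].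
Proof.
move=> [[lf [v fv] _] H] e0; have [psi tpsi /ltW pe] := H e e0.
have lpsi : locally_integrable U psi.
  by apply: continuous_locally_integrable; exact: test_continuous tpsi.
have wd : weakly_differentiable U (f \- psi).
  by eexists; exact: weak_gradientB mU lf lpsi fv (test_weak_gradient tpsi).
have [w [fw F1 F2]] := sobolev_norm_data wd (ltW e0) pe.
by exists psi, w.
Qed.

Lemma measurable_weighted r f : measurable_fun (U : set (plane R)) (f : plane R -> R) ->
  measurable_fun (U : set (plane R)) (fun z => (`|f z| `^ r * h z)%:E).
Proof.
move=> mf; apply/measurable_EFinP; apply: measurable_funM => //.
by apply: (measurableT_comp (measurable_powR r)); exact: measurableT_comp.
Qed.

Lemma weighted_ge0 r f z : U z -> (0 <= (`|f z| `^ r * h z)%:E)%E.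
Proof. by move=> Uz; rewrite lee_fin mulr_ge0 ?powR_ge0// ltW// h0. Qed.

Lemma weighted_integral_lim r f (F : nat -> R * R -> R) (B : \bar R) : 1 <= r ->
  measurable_fun (U : set (plane R)) (f : plane R -> R) ->
  (forall n, measurable_fun (U : set (plane R)) (F n : plane R -> R)) ->
  {ae mu, forall z, U z -> F n z @[n --> \oo] --> f z} ->
  (forall n, N r (F n) <= B)%E -> (N r f <= B)%E.
Proof.
move=> r1 mf mF Ff FB.
apply: (@fatou_ae _ _ _ mu U mU _ (fun n z => (`|F n z| `^ r * h z)%:E)) => //.
- exact: measurable_weighted.
- by move=> n; exact: measurable_weighted.
- by move=> z; exact: weighted_ge0.
- by move=> n z; exact: weighted_ge0.
- refine (@filterS _ _ ae_filter _ _ _ Ff) => z H Uz; apply: cvg_EFin; first exact: nearW.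
  apply: cvgM; last exact: cvg_cst.
  by apply: powR_cvg => //; apply: cvg_norm; exact: H.
Qed.

(** Convergence in L2 at a fast rate implies convergence almost everywhere, so
    that Fatou's lemma applies to any weight. *)
Lemma weighted_integral_approx r f (eta : nat -> R * R -> R) (B : \bar R) : 1 <= r ->
  measurable_fun (U : set (plane R)) (f : plane R -> R) ->
  (forall n, test_function U (eta n)) ->
  (forall n, \int[mu]_(z in U) ((f z - eta n z) ^+ 2)%:E <= (1 / (2 ^ n.+1)%:R)%:E)%E ->
  (forall n, N r (eta n) <= B)%E -> (N r f <= B)%E.
Proof.
move=> r1 mf teta etaf NB.
have meta n : measurable_fun (U : set (plane R)) (eta n : plane R -> R).
  by apply: measurable_funS measurableT (@subsetT _ _) (test_measurable (teta n)).
apply: (weighted_integral_lim r1 mf meta _ NB).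
have mp n : measurable_fun (U : set (plane R)) (fun z => (f z - eta n z) ^+ 2).
  by apply: measurable_funX; exact: measurable_funB.
have := ae_cvg_to0 mU mp (fun n z _ => sqr_ge0 _) etaf.
apply: filterS => z H Uz; apply/cvgrPdist_lt => eps eps0.
have := H Uz => /cvgrPdist_lt/(_ _ (exprn_gt0 2 eps0)); apply: filterS => n.
rewrite sub0r normrN ger0_norm ?sqr_ge0// -[(f z - eta n z) ^+ 2]real_normK ?num_real//.
by rewrite ltr_pXn2r// nnegrE ltW.
Qed.

Lemma weighted_integral_add r f g k : 1 <= r ->
  measurable_fun (U : set (plane R)) (f : plane R -> R) ->
  measurable_fun (U : set (plane R)) (g : plane R -> R) ->
  (forall z, k z = f z + g z) ->
  (N r k <= (2 `^ r)%:E * (N r f + N r g))%E.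
Proof.
move=> r1 mf mg kE; have r0 : 0 <= r by exact: le_trans r1.
have m1 := measurable_weighted r mf; have m2 := measurable_weighted r mg.
have p1 := @weighted_ge0 r f; have p2 := @weighted_ge0 r g.
rewrite /weighted_integral -(ge0_integralD _ mU p1 m1 p2 m2).
have m12 := emeasurable_funD m1 m2.
rewrite -(ge0_integralZl _ mU m12); last 2 first.
- by move=> z Uz; rewrite adde_ge0 ?p1 ?p2.
- by rewrite lee_fin powR_ge0.
apply: ge0_le_integral => //.
- by move=> z; exact: weighted_ge0.
- apply: measurable_weighted; rewrite (_ : k = f \+ g); last by apply/funext.
  exact: measurable_funD.
- exact: measurable_funeM.
- move=> z Uz; rewrite -EFinD -EFinM lee_fin -mulrDl mulrA.
  apply: ler_wpM2r; first exact/ltW/h0.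
  rewrite kE; wlog fg : f g {mf mg kE m1 m2 p1 p2 m12} / `|g z| <= `|f z|.
    move=> H; have [/H//|/ltW/H] := leP `|g z| `|f z|.
    by rewrite addrC [X in _ -> _ <= _ * X]addrC.
  apply: (@le_trans _ _ ((2 * `|f z|) `^ r)).
    apply: ge0_ler_powR => //; rewrite ?nnegrE// ?mulr_ge0//.
    by rewrite (le_trans (ler_normD _ _))// mulr2n mulrDl !mul1r lerD2l.
  by rewrite powRM// ler_wpM2l ?powR_ge0// lerDl powR_ge0.
Qed.

(** The L2 rate is summable, to give almost everywhere convergence; the
    gradients only have to stay within [e]. *)
Lemma fast_approx f (e : R) : sobolev0 U 2 f -> 0 < e ->
  exists theta : nat -> R * R -> R, forall n,
    [/\ test_function U (theta n),
      (\int[mu]_(z in U) ((f z - theta n z) ^+ 2)%:E <= (1 / (2 ^ n.+1)%:R)%:E)%E &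
      exists2 w, is_weak_gradient U (f \- theta n) w &
       (\int[mu]_(z in U) ((w z).1 ^+ 2 + (w z).2 ^+ 2)%:E <= (e ^+ 2)%:E)%E].
Proof.
move=> sf e0.
have c0 n : 0 < (1 / (2 ^ n.+1)%:R : R) by rewrite divr_gt0// ltr0n expn_gt0.
have c1 n : (1 / (2 ^ n.+1)%:R : R) <= 1.
  by rewrite ler_pdivrMr ?ltr0n ?expn_gt0// mul1r ler1n expn_gt0.
have H n : exists psi : R * R -> R, [/\ test_function U psi,
    (\int[mu]_(z in U) ((f z - psi z) ^+ 2)%:E <= (1 / (2 ^ n.+1)%:R)%:E)%E &
    exists2 w, is_weak_gradient U (f \- psi) w &
     (\int[mu]_(z in U) ((w z).1 ^+ 2 + (w z).2 ^+ 2)%:E <= (e ^+ 2)%:E)%E].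
  pose d := Num.min e (1 / (2 ^ n.+1)%:R).
  have d0 : 0 < d by rewrite lt_min e0 c0.
  have de : d <= e by rewrite ge_min lexx.
  have dc : d <= 1 / (2 ^ n.+1)%:R by rewrite ge_min lexx orbT.
  have [psi [w [tpsi fw F1 F2]]] := sobolev0_approx sf d0.
  exists psi; split=> //.
    apply: le_trans F1 _; rewrite lee_fin expr2 -[leRHS]mulr1.
    by apply: ler_pM => //; rewrite ?(ltW d0)// (le_trans dc).
  exists w => //; apply: le_trans F2 _; by rewrite lee_fin ler_pXn2r// nnegrE ltW.
by have [theta Htheta] := choice H; exists theta.
Qed.

Lemma sobolev0_measurable f : sobolev0 U 2 f ->
  measurable_fun (U : set (plane R)) (f : plane R -> R).
Proof. by move=> [[lf _ _] _]; exact: locally_integrable_measurable. Qed.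

Lemma sobolev0_gradient f (M : R) : sobolev0 U 2 f -> 0 <= M ->
  (sobolev_norm U 2 f <= M%:E)%E ->
  exists2 v, is_weak_gradient U f v &
   (\int[mu]_(z in U) ((v z).1 ^+ 2 + (v z).2 ^+ 2)%:E <= (M ^+ 2)%:E)%E.
Proof.
by move=> [[_ wf _] _] M0 /(sobolev_norm_data wf M0)[v [? _ ?]]; exists v.
Qed.

Lemma test_locally_integrable psi : test_function U psi -> locally_integrable U psi.
Proof. by move=> tpsi; apply: continuous_locally_integrable; exact: test_continuous tpsi. Qed.

Lemma sobolev0_weighted_lty r f : 1 <= r -> sobolev0 U 2 f -> (N r f < +oo)%E.
Proof.
move=> r1 sf; have [[lf _ fy] _] := sf.
have n0 : (0 <= sobolev_norm U 2 f)%E by rewrite adde_ge0// poweR_ge0.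
have fin : sobolev_norm U 2 f \is a fin_num by rewrite ge0_fin_numE.
have [|v fv vM] := @sobolev0_gradient f (fine (sobolev_norm U 2 f)) sf (fine_ge0 n0).
  by rewrite fineK.
set M := fine _ in vM.
have [theta Ht] := fast_approx sf ltr01.
have [B HB] := bounded (2 * M ^+ 2 + 2 * 1 ^+ 2) r1.
apply: (@le_lt_trans _ _ B%:E); last exact: ltry.
apply: (weighted_integral_approx r1 (sobolev0_measurable sf) (eta := theta)).
- by move=> n; have [] := Ht n.
- by move=> n; have [] := Ht n.
- move=> n; have [tt _ [w fw wB]] := Ht n; apply: HB => //.
  have lt := test_locally_integrable tt.
  apply: (@dirichlet_difference f (f \- theta n) _ v w) => //.
    exact: locally_integrableB.
  by apply/funext => z /=; rewrite opprB addrC subrK.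
Qed.

(** The difference [u - psi] is followed by the test functions [theta n -
    psi], whose Dirichlet integrals are at most [2 * d ^+ 2 + 2 * d ^+ 2] by
    [dirichlet_difference]; [d] is chosen to make this the threshold of
    [vanishing]. *)
Lemma weighted_remainder r (eps : R) : 1 <= r -> 0 < eps ->
  exists2 d : R, 0 < d & forall u psi w, sobolev0 U 2 u -> test_function U psi ->
    is_weak_gradient U (u \- psi) w ->
    (\int[mu]_(z in U) ((w z).1 ^+ 2 + (w z).2 ^+ 2)%:E <= (d ^+ 2)%:E)%E ->
    (N r (u \- psi)%R <= eps%:E)%E.
Proof.
move=> r1 eps0; have [E E0 HE] := vanishing r1 eps0.
pose d := Num.sqrt (E / 4).
have d0 : 0 < d by rewrite sqrtr_gt0 divr_gt0.
have d2 : d ^+ 2 = E / 4 by rewrite sqr_sqrtr// divr_ge0// ltW.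
exists d => // u psi w su tpsi uw wd.
have [theta Ht] := fast_approx su d0.
have lu : locally_integrable U u by have [[]] := su.
have mu' := sobolev0_measurable su.
have mpsi : measurable_fun (U : set (plane R)) (psi : plane R -> R).
  by apply: measurable_funS measurableT (@subsetT _ _) (test_measurable tpsi).
have lpsi := test_locally_integrable tpsi.
apply: (weighted_integral_approx r1 (measurable_funB mu' mpsi) (eta := fun n => theta n \- psi)).
- by move=> n; apply: test_sub => //; have [] := Ht n.
- move=> n; have [_ H _] := Ht n; apply: le_trans H.
  rewrite le_eqVlt; apply/orP; left; apply/eqP; apply: eq_integral => z _.
  by congr (_ ^+ 2)%:E => /=; ring.
- move=> n; have [tt _ [w' fw' wB']] := Ht n.
  have lt := test_locally_integrable tt.
  apply: HE; first exact: test_sub.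
  have -> : E = 2 * d ^+ 2 + 2 * d ^+ 2 by rewrite d2; lra.
  apply: (@dirichlet_difference (u \- psi) (u \- theta n) _ w w') => //.
  + exact: locally_integrableB.
  + exact: locally_integrableB.
  + exact: test_sub.
  + by apply/funext => z /=; ring.
Qed.

Lemma weighted_norm_cvg0 r (f : nat -> R * R -> R) : 1 <= r ->
  (forall eps : R, 0 < eps -> exists K, forall k, (K <= k)%N -> (N r (f k) <= eps%:E)%E) ->
  weighted_norm U r h (f k) @[k --> \oo] --> 0%E.
Proof.
move=> r1 H; have r0 : 0 < r by exact: lt_le_trans r1.
have small (e : R) : 0 < e -> \forall k \near \oo, (weighted_norm U r h (f k) <= e%:E)%E.
  move=> e0; have [K HK] := H _ (powR_gt0 r e0).
  exists K => // k /HK Nk; rewrite /weighted_norm.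
  have -> : e%:E = ((e `^ r)%:E `^ r^-1)%E.
    by rewrite poweR_EFin -powRrM mulfV ?gt_eqF// powRr1// ltW.
  apply: gt0_ler_poweR => //; first by rewrite invr_ge0 ltW.
    rewrite in_itv /= leey andbT; apply: integral_ge0 => z Uz.
    by rewrite lee_fin mulr_ge0 ?powR_ge0// ltW// h0.
  by rewrite in_itv /= leey lee_fin powR_ge0.
have n0 k : (0 <= weighted_norm U r h (f k))%E by exact: poweR_ge0.
apply/fine_cvgP; split.
  apply: filterS (small 1 ltr01) => k k1.
  by rewrite ge0_fin_numE//; apply: le_lt_trans k1 _; rewrite ltry.
apply/cvgrPdist_le => e e0; apply: filterS (small e e0) => k ke.
have fk : weighted_norm U r h (f k) \is a fin_num.
  by rewrite ge0_fin_numE//; apply: le_lt_trans ke _; rewrite ltry.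
by rewrite sub0r normrN ger0_norm ?fine_ge0//= -lee_fin fineK.
Qed.

Lemma weighted_integral1 f g : (N 1 (f \- g)%R =
  \int[mu]_(z in U) (`|f z - g z| * h z)%:E)%E.
Proof. by apply: eq_integral => z _; rewrite powRr1. Qed.

Lemma test_approximation (u : nat -> R * R -> R) (M : R) :
  (forall n, sobolev0 U 2 (u n)) -> (forall n, sobolev_norm U 2 (u n) <= M%:E)%E ->
  exists psi : nat -> R * R -> R, forall n, [/\ test_function U (psi n),
    (dirichlet U (psi n) <= (2 * `|M| ^+ 2 + 2)%:E)%E &
    exists2 w, is_weak_gradient U (u n \- psi n) w &
      (\int[mu]_(z in U) ((w z).1 ^+ 2 + (w z).2 ^+ 2)%:E <= (n.+1%:R^-1 ^+ 2)%:E)%E].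
Proof.
move=> su HM.
have H n : exists psi : R * R -> R, [/\ test_function U psi,
    (dirichlet U psi <= (2 * `|M| ^+ 2 + 2)%:E)%E &
    exists2 w, is_weak_gradient U (u n \- psi) w &
      (\int[mu]_(z in U) ((w z).1 ^+ 2 + (w z).2 ^+ 2)%:E <= (n.+1%:R^-1 ^+ 2)%:E)%E].
  have n0 : 0 < n.+1%:R^-1 :> R by rewrite invr_gt0.
  have [psi [w [tpsi uw _ wn]]] := sobolev0_approx (su n) n0.
  have [|v uv vM] := @sobolev0_gradient (u n) `|M| (su n) (normr_ge0 M).
    by apply: le_trans (HM n) _; rewrite lee_fin ler_norm.
  exists psi; split=> //; last by exists w.
  have lu : locally_integrable U (u n) by have [[]] := su n.
  have lp := test_locally_integrable tpsi.
  apply: (@le_trans _ _ (2 * `|M| ^+ 2 + 2 * n.+1%:R^-1 ^+ 2)%:E); last first.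
    rewrite lee_fin lerD2l -[leRHS]mulr1 ler_wpM2l// expr_le1// ?invr_ge0//.
    by rewrite invf_le1// ler1n.
  apply: (@dirichlet_difference (u n) (u n \- psi) psi v w) => //.
    exact: locally_integrableB.
  by apply/funext => z /=; ring.
by have [psi Hpsi] := choice H; exists psi.
Qed.

(** Along an ultrafilter the test functions are Cauchy for the weighted norms
    of exponents 1 and [r] at once. Exponent 1 yields a pointwise limit, and
    Fatou's lemma then turns the Cauchy property for the exponent [r] into
    convergence. *)
Lemma test_limit r (E : R) (psi : nat -> R * R -> R) : 1 <= r ->
  (forall n, test_function U (psi n)) -> (forall n, dirichlet U (psi n) <= E%:E)%E ->
  exists s : nat -> nat, {homo s : m n / (m < n)%N} /\
    exists g, [/\ measurable_fun (U : set (plane R)) (g : plane R -> R), (N r g < +oo)%E &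
      forall k, (N r (psi (s k) \- g)%R <= (1 / (2 ^ k.+1)%:R)%:E)%E].
Proof.
move=> r1 tpsi psiE.
have mpsi n : measurable_fun (U : set (plane R)) (psi n : plane R -> R).
  by apply: measurable_funS measurableT (@subsetT _ _) (test_measurable (tpsi n)).
have [F [UF ooF]] := ultraFilterLemma eventually_filter.
have d0 k : 0 < 1 / (2 ^ k.+1)%:R :> R by rewrite divr_gt0// ltr0n expn_gt0.
have HA k : exists A, F A /\ forall n m, A n -> A m ->
    (N r (psi n \- psi m)%R <= (1 / (2 ^ k.+1)%:R)%:E)%E /\
    (N 1 (psi n \- psi m)%R <= (1 / (2 ^ k.+1)%:R)%:E)%E.
  have [A FA HA] := precompact r1 UF tpsi psiE (d0 k).
  have [B FB HB] := precompact (lexx 1) UF tpsi psiE (d0 k).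
  exists (A `&` B); split; first exact: filterI.
  by move=> n m [An Bn] [Am Bm]; split; [exact: HA|exact: HB].
have [A {}HA] := choice HA.
have [s [s_incr sA]] := @ultra_extraction F A _ ooF (fun k => (HA k).1).
exists s; split=> //.
have close k l (kl : (k <= l)%N) := (HA k).2 _ _ (sA k k (leqnn k)) (sA k l kl).
have [|g mg pg] := @ae_limit _ _ _ mu U mU (fun k => psi (s k)) h (fun k => mpsi (s k)) mh h0.
  move=> k; rewrite -weighted_integral1.
  by have [_] := (HA k).2 _ _ (sA k k.+1 (leqnSn k)) (sA k k (leqnn k)).
have [B HB] := bounded E r1.
exists g; split=> //.
- apply: (@le_lt_trans _ _ B%:E); last exact: ltry.
  apply: (weighted_integral_lim r1 mg (F := fun k => psi (s k))) => //.
  by move=> k; exact: HB.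
- move=> k; apply: (weighted_integral_lim r1 (measurable_funB (mpsi (s k)) mg)
    (F := fun n => psi (s k) \- psi (s (n + k)%N))).
  + by move=> n; exact: measurable_funB.
  + refine (@filterS _ _ ae_filter _ _ _ pg) => z H Uz; apply: cvgB; first exact: cvg_cst.
    by have := H Uz; rewrite -(cvg_shiftn k).
  + by move=> n; have [] := close k (n + k)%N (leq_addl n k).
Qed.

(** Test functions [psi n] whose gradients approach those of [u n] have a
    subsequence converging in the weighted norm, and the differences tend to 0
    there by [weighted_remainder]. *)
Theorem sobolev0_embedding_compact r : 1 <= r ->
  compact_operator (sobolev0 U 2) (sobolev_norm U 2)
    (weighted_Lebesgue U r h) (weighted_norm U r h) (fun f => f).
Proof.
move=> r1; split=> //.
  move=> f sf; split; first exact: (sobolev0_measurable sf).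
  exact/poweR_lty/(sobolev0_weighted_lty r1 sf).
move=> u su [M HM].
have [psi Hpsi] := test_approximation su HM.
have tpsi n : test_function U (psi n) by have [] := Hpsi n.
have [|s [s_incr [g [mg gy psig]]]] := test_limit r1 tpsi (E := 2 * `|M| ^+ 2 + 2).
  by move=> n; have [] := Hpsi n.
exists s; split=> //; exists g; first by split=> //; exact: poweR_lty.
have mpsi n : measurable_fun (U : set (plane R)) (psi n : plane R -> R).
  by apply: measurable_funS measurableT (@subsetT _ _) (test_measurable (tpsi n)).
have mu' n := sobolev0_measurable (su n).
have s_ge k : (k <= s k)%N.
  by elim: k => // k IH; apply: leq_ltn_trans IH _; exact: s_incr.
apply: weighted_norm_cvg0 => // eps eps0.
(* Two errors c, and the constant of weighted_integral_add. *)
pose c : R := eps / (2 * 2 `^ r).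
have p0 : 0 < 2 `^ r :> R by exact: powR_gt0.
have c0 : 0 < c by rewrite divr_gt0// mulr_gt0.
have [d d0 Hd] := weighted_remainder r1 c0.
have [K1 _ HK1] := near_infty_natSinv_lt (PosNum d0).
have [K2 _ HK2] := near_infty_natSinv_expn_lt (PosNum c0).
exists (maxn K1 K2) => k; rewrite geq_max => /andP[k1 k2].
apply: (le_trans (@weighted_integral_add r (u (s k) \- psi (s k))
  (psi (s k) \- g) _ r1 _ _ _)).
- exact: measurable_funB.
- exact: measurable_funB.
- by move=> z /=; rewrite -[LHS]/(u (s k) z - g z); ring.
have -> : eps = 2 `^ r * (c + c).
  by rewrite /c; field; rewrite gt_eqF.
rewrite EFinM EFinD; apply: lee_wpmul2l; first by rewrite lee_fin ltW.
apply: leeD.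
  have [tt _ [w uw wn]] := Hpsi (s k).
  apply: (Hd _ _ w) => //; apply: le_trans wn _; rewrite lee_fin.
  rewrite ler_pXn2r// ?nnegrE ?invr_ge0// ?ltW//.
  exact: (HK1 (s k) (leq_trans k1 (s_ge k))).
apply: le_trans (psig k) _; rewrite lee_fin natrX ltW//.
exact: (HK2 k.+1 (leq_trans k2 (leqnSn k))).
Qed.

End sobolev_embedding.

(** * The embedding for the conformal weight *)

Theorem theorem4p2 (R : realType) (Omega : set (Cplx R)) (phi : Cplx R -> Cplx R)
    (hdom : domain Omega) (hsc : simply_connected Omega)
    (hbd : boundary Omega !=set0)
    (hphi : conformal_homeomorphism Omega (@unit_disc R) phi)
    (r : R) (hr : 1 <= r) :
  let U : set (R * R) := @to_complex R @^-1` Omega in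
  let h : R * R -> R := conformal_weight phi \o @to_complex R in
  compact_operator (sobolev0 U 2) (sobolev_norm U 2)
    (weighted_Lebesgue U r h) (weighted_norm U r h) (fun f => f).
Proof.
have [oOmega _ _] := hdom.
have [[bij [psi [psiK _ cpsi]]] conf] := hphi.
move=> U h.
pose D : set (R * R) := @to_complex R @^-1` (@unit_disc R).
have oU : open U := conformal_open_domain oOmega.
have oD : open D := @conformal_open_disc R.
have DS : D `<=` @ref_square R by exact: unit_disc_ref_square.
have mT := measurable_conformal_map oOmega conf.
have mS := measurable_conformal_inverse cpsi.
have TU := conformal_mapK bij psiK.
have SD := conformal_inverseK bij psiK.
have ma := measurable_conformal_factor oOmega conf.
have a0 := conformal_factor_gt0 conf.
have b0 := inverse_factor_gt0 bij psiK conf.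
have ab := inverse_factorE bij psiK conf.
have mb := measurable_inverse_factor oOmega bij psiK cpsi conf.
have Tl := conformal_lipschitz conf.
have Sl := inverse_lipschitz bij psiK cpsi conf.
have h0 z : U z -> 0 < h z by move=> Uz; exact/exprn_gt0/a0.
have mh : measurable_fun (U : set (plane R)) (h : plane R -> R) by exact: measurable_funX.
apply: (sobolev0_embedding_compact oU mh h0 _ _ _ hr).
- exact: (embedding_vanishing oU oD DS mT mS TU SD ma mb a0 b0 ab Tl Sl).
- exact: (embedding_bounded oU oD DS mT mS TU SD ma mb a0 b0 ab Tl Sl).
- exact: (embedding_precompact oU oD DS mT mS TU SD ma mb a0 b0 ab Tl Sl).
Qed.
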